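(* Fix $\epsilon>0$. Suppose that $x,y\ge 100$ satisfy both $$y\ge \exp((\log_2 x)^{1+\epsilon})\qquad\text{and}\qquad y\le x/\exp((\log_2 x)^{1+\epsilon}).$$ Then, as $x\to\infty$, $$\frac1x L(x,y)\le \begin{cases}\mathcal{L}(x/y)^{-1+o(1)} & \text{if } y\ge \mathcal{L}(x)^2,\\ \mathcal{L}(x,y)^{-1+o(1)} & \text{otherwise.}\end{cases}$$ Furthermore, if Hypothesis U (stated in the context) is true, then equality holds in both cases; that is, under the same conditions on $x,y$, as $x\to\infty$, $\frac1x L(x,y)=\mathcal{L}(x/y)^{-1+o(1)}$ if $y\ge\mathcal{L}(x)^2$, and $\frac1x L(x,y)=\mathcal{L}(x,y)^{-1+o(1)}$ otherwise.
   Context: $\log_k$ denotes the $k$-th iterate of the natural logarithm (so $\log_2 x=\log\log x$, not a base-2 logarithm). $\lambda(n)$ (Carmichael's function) is the exponent of the multiplicative group $(\mathbb{Z}/n\mathbb{Z})^\times$, and $L(x,y)=\#\{n\le x:\lambda(n)\le y\}$, where $n$ runs over positive integers. Put $$\mathcal{L}(x,y)=\exp\left(\frac{\log x\,\log_3 x}{\log_2 y}\right),\qquad \mathcal{L}(x)=\mathcal{L}(x,x)=\exp\left(\frac{\log x\,\log_3 x}{\log_2 x}\right).$$ The $o(1)$ terms tend to $0$ as $x\to\infty$, uniformly in all $y$ satisfying the stated constraints (for fixed $\epsilon$): e.g. the first bound means that for each $\eta>0$ there is $x_0(\epsilon,\eta)$ such that $\frac1xL(x,y)\le\mathcal{L}(x/y)^{-1+\eta}$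 for all $x\ge x_0$ and all admissible $y\ge\mathcal{L}(x)^2$. Hypothesis U: Let $P^*(n)$ denote the largest prime power dividing $n$, with $P^*(1)=1$, and let $\Pi^*(x,y)=\#\{p\le x: p \text{ prime},\ P^*(p-1)\le y\}$. Fix $\epsilon>0$. Whenever $x$, $y$, and $u:=\frac{\log x}{\log y}$ tend to infinity with $y\ge(\log x)^{1+\epsilon}$, one has $\Pi^*(x,y)=\pi(x)\exp(-(1+o(1))u\log u)$. (The hypothesis asserts this for each fixed $\epsilon>0$; $\pi(x)$ is the number of primes up to $x$.) *)

(* Defs.v *)
From HB Require Import structures.
From mathcomp Require Import all_boot all_order all_algebra.
From mathcomp Require Import fingroup abelian.
From mathcomp Require Import boolp reals sequences exp.

Set Implicit Arguments.
Unset Strict Implicit.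
Unset Printing Implicit Defensive.

Import Order.TTheory GRing.Theory Num.Theory.

Local Open Scope ring_scope.

(* ['Z_n] is Z/nZ only for n > 1; [ 'Z_1 ] is Z/2Z, whose unit group is trivial
   like that of Z/1Z, so the value at n = 1 is still the right one. *)
Definition carmichael (n : nat) : nat := exponent [set: {unit 'Z_n}].

Definition is_prime_power (d : nat) : Prop :=
  exists p k : nat, [/\ prime p, (0 < k)%N & d = (p ^ k)%N].

Definition max_prime_power (n : nat) : nat :=
  if n == 1%N then 1%N
  else \max_(d <- divisors n | `[< is_prime_power d >]) d.

Section Counting.
Variable R : realType.
Implicit Types x y e : R.

(* For 0 <= x, the naturals n < (Num.truncn x).+1 are those with n <= x. *)
Definition primepi x : nat :=
  (\sum_(1 <= p < (Num.truncn x).+1 | prime p) 1)%N.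

Definition primepi_star x y : nat :=
  (\sum_(1 <= p < (Num.truncn x).+1 |
      prime p && ((max_prime_power p.-1)%:R <= y :> R)) 1)%N.

Definition carmichael_count x y : nat :=
  (\sum_(1 <= n < (Num.truncn x).+1 | (carmichael n)%:R <= y :> R) 1)%N.

(* Iterated natural logarithm, not the logarithm in base k. *)
Definition logk (k : nat) x : R := iter k (@ln R) x.

Definition calL x y : R := expR (ln x * logk 3 x / logk 2 y).

(* "1 + o(1)" is unfolded: the exponent is eventually between 1 - eta and
   1 + eta, for every eta > 0, as x, y and u jointly tend to infinity. *)
Definition hypothesis_U : Prop :=
  forall e : R, 0 < e -> forall eta : R, 0 < eta ->
  exists B : R, forall x y : R,
    let u := ln x / ln y in
    B <= x -> B <= y -> B <= u -> ln x `^ (1 + e) <= y ->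
    (primepi x)%:R * expR (- (1 + eta) * (u * ln u)) <= (primepi_star x y)%:R
    /\ (primepi_star x y)%:R <= (primepi x)%:R * expR (- (1 - eta) * (u * ln u)).

Definition admissible e x y : Prop :=
  [/\ 100 <= x, 100 <= y, expR (logk 2 x `^ (1 + e)) <= y
    & y <= x / expR (logk 2 x `^ (1 + e))].

Definition main_term x y : R :=
  if calL x x ^+ 2 <= y then calL (x / y) (x / y) else calL x y.

End Counting.

(* Main.v *)
Require Import Defs.
From HB Require Import structures.
From mathcomp Require Import all_boot all_order all_algebra.
From mathcomp Require Import fingroup abelian.
From mathcomp Require Import boolp reals sequences exp.
From mathcomp Require Import cyclic.
From mathcomp Require Import zify ring lra.

Import Order.TTheory GRing.Theory Num.Theory.

Local Open Scope ring_scope.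

(* Upper bound.  Let A be a set of primes whose product is a squarefree a, and lam A the
   lcm of the p - 1 for p in A, a divisor of carmichael n when a divides n.  Rankin's
   trick bounds the number of n <= x with carmichael n <= y by
   x (y / x)^d * sum_A a^(d - 1) (lam A)^(- d), up to a factor log x.  Removing a prime p
   from A multiplies (lam A)^(- d) by at most the power gcd(lam(A \ p), p - 1)^d / (p - 1)^d;
   summing over p first (Brun-Titchmarsh, proved here with Selberg's sieve) the sum over
   sets of k primes is at most M / k times the sum over sets of k - 1 primes, so the whole
   sum is at most exp M.  The parameter M is controlled by sum_(l | lam A) l^(d - 1); the
   sets A for which the large primes l contribute more than 1 to it are rare, by an
   exponential moment estimate.  When y is small, Pomerance's direct argument replaces
   this one: for fixed m, every n with carmichael n = m is built from primes p such that
   p - 1 divides m, and Rankin's trick is applied twice.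

   Lower bound, under Hypothesis U.  Take n = q p_1 ... p_j with distinct primes p_i <= v
   such that all the prime powers dividing p_i - 1 are at most z, and q a prime larger
   than v.  Then carmichael n divides (q - 1) z!. *)

Set Implicit Arguments.
Unset Strict Implicit.
Unset Printing Implicit Defensive.

(** * The Carmichael function *)

(** The obstacle is that [carmichael] is an lcm, so the condition [carmichael n] <= y does not
    factor over the primes of n; the gcd of p - 1 with the lcm of the others measures the loss.
    Averaged over p, it becomes a divisor sum in which only primes up to z are under control, hence
    the separation of rare sets. Put s = log log (x / y). A Rankin shift d close to (log s) / s
    saves (x / y)^d, which is the wanted main term, and z = (log (x / y))^(1 + h) makes z^d a power
    of s below s / log s, so M is log log x times a tiny power of log (x / y). Admissibility bounds
    log log x by (log (x / y))^(1 / (1 + e)), so exp M is negligible. In the direct argument for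
    small y the values m <= y are summed trivially, which is harmless as long as log y <= (log x)^(1
    - h). In the lower bound q fills the room up to y, while the p_i fill x / y and cost only the
    factor z! in the Carmichael function. *)

Lemma eqr_Zp_nat n a b : (1 < n)%N ->
  ((a%:R : 'Z_n) == b%:R) = (a == b %[mod n])%N.
Proof. by move=> n1; rewrite -val_eqE /= !val_Zp_nat. Qed.

Lemma expn_carmichael n c :
  (1 < n)%N -> coprime n c -> (c ^ carmichael n = 1 %[mod n])%N.
Proof.
move=> n1 cop.
have uc : (c%:R : 'Z_n) \is a GRing.unit by rewrite unitZpE.
have /(congr1 val) := expg_exponent (in_setT (FinRing.unit _ uc)).
rewrite FinRing.val_unitX /= -natrX => e.
by apply/eqP; rewrite -eqr_Zp_nat //; apply/eqP.
Qed.

Lemma carmichael_dvd n E : (1 < n)%N ->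
  (forall c, coprime n c -> c ^ E = 1 %[mod n])%N -> (carmichael n %| E)%N.
Proof.
move=> n1 H; apply/exponentP => u _; apply/val_inj.
rewrite FinRing.val_unitX /=.
have cop : coprime n (val u : 'Z_n).
  by rewrite -unitZpE // natr_Zp; case: u.
rewrite -[X in X ^+ _]natr_Zp -natrX.
by apply/eqP; rewrite (eqr_Zp_nat _ 1) //; apply/eqP/H.
Qed.

(** A generator of the cyclic group of units modulo p lifts, by the Chinese remainder theorem, to
    some c that is 1 modulo the part of n prime to p, hence coprime to n. Reducing c ^ carmichael n
    = 1 modulo p brings in the order p - 1 of the generator. *)
Lemma prime_pred_dvd_carmichael n p :
  (0 < n)%N -> prime p -> (p %| n)%N -> (p.-1 %| carmichael n)%N.
Proof.
move=> n0 pp pn.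
have p1 := prime_gt1 pp.
have n1 : (1 < n)%N by apply: leq_trans p1 (dvdn_leq n0 pn).
have cyc := field_unit_group_cyclic [set: {unit 'F_p}]%G.
have /cyclicP[g defg] := cyc.
have og : #[g]%g = p.-1.
  by rewrite orderE -defg card_finField_unit card_Fp.
set a : nat := val (val g : 'F_p).
have ga : (a%:R : 'F_p) = val g by rewrite /a natr_Zp.
have ca : coprime p a.
  rewrite -unitFpE // ga; by case: (g).
set k := logn p n.
have k0 : (0 < k)%N by rewrite logn_gt0 mem_primes pp n0.
set c := chinese (p ^ k) (n %/ p ^ k) a 1.
have copn : coprime (p ^ k) (n %/ p ^ k).
  have -> : (n %/ p ^ k = n`_p^')%N.
    by rewrite -[X in (X %/ _)%N](partnC p n0) p_part mulKn // expn_gt0 prime_gt0.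
  by rewrite -p_part coprime_partC.
have en : n = (p ^ k * (n %/ p ^ k))%N by rewrite mulnC divnK // pfactor_dvdnn.
have cc : coprime n c.
  rewrite en coprimeMl; apply/andP; split.
    rewrite -coprime_modr chinese_modl // coprime_modr.
    by rewrite coprime_pexpl.
  by rewrite -coprime_modr chinese_modr // coprime_modr coprimen1.
have := expn_carmichael n1 cc => e.
have {}e : (c ^ carmichael n = 1 %[mod p])%N.
  by rewrite -(modn_dvdm _ pn) e modn_dvdm.
have ea : (c = a %[mod p])%N.
  have := chinese_modl copn a 1 => h.
  have pk : (p %| p ^ k)%N by rewrite dvdn_exp.
  by rewrite -(modn_dvdm _ pk) h modn_dvdm.
rewrite -og order_dvdn; apply/eqP/val_inj.
rewrite FinRing.val_unitX -ga -natrX -[RHS]/(1%:R).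
have F m : (m%:R : 'F_p) = (m %% p)%:R.
  by apply/val_inj; rewrite /= !val_Fp_nat // modn_mod.
by rewrite F -modnXm -ea modnXm e -F.
Qed.

Lemma carmichael_prod_dvd (s : seq nat) E :
  uniq s -> all prime s -> (1 < \prod_(p <- s) p)%N ->
  (forall p, p \in s -> (p.-1 %| E)%N) -> (carmichael (\prod_(p <- s) p) %| E)%N.
Proof.
(* Read contrapositively (a failing congruence forces a common factor with the modulus), the claim
   makes sense for the empty list too, where the modulus is 1, so the induction on [s] can drop
   [n1]. The Chinese remainder theorem peels off one prime, which Fermat's theorem settles. *)
move=> us ps n1 hE; apply: carmichael_dvd => // c; apply: contraTeq => ne.
move: us ps hE ne {n1}; elim: s => [|p s IH] /=.
  by rewrite big_nil !modn1.
case/andP=> ns us /andP[pp ps] hE; rewrite big_cons => ne.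
rewrite coprimeMl negb_and -implybE; apply/implyP => cpc.
apply: IH => // [q qs|]; first by apply: hE; rewrite inE qs orbT.
have cps : coprime p (\prod_(q <- s) q).
  rewrite prime_coprime // Euclid_dvd_prod // big_has.
  apply/hasPn => q qs; rewrite dvdn_prime2 ?(allP ps _ qs) //.
  by apply: contraNneq ns => ->.
move: ne; rewrite (chinese_remainder cps) negb_and => /orP[|//].
have /dvdnP[k ->] := hE p (mem_head _ _).
case/eqP; rewrite mulnC expnM -modnXm -(totient_prime pp).
by rewrite Euler_exp_totient 1?coprime_sym // modnXm exp1n.
Qed.

(** * Squarefree numbers as sets of primes *)

Section PrimeSets.
Variable N : nat.
Implicit Types (A B D : {set 'I_N.+1}) (p q : 'I_N.+1).

(** Squarefree integers are encoded by sets of primes: divisibility, gcd and lcm become inclusion,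
    intersection and union, and sums over divisors become sums over subsets. *)
Definition prime_set A := [forall p in A, prime p].
Definition prodn A := (\prod_(p in A) (p : nat))%N.

Lemma prime_setP A : reflect (forall p, p \in A -> prime p) (prime_set A).
Proof. exact: 'forall_implyP. Qed.

Lemma prime_setS A B : A \subset B -> prime_set B -> prime_set A.
Proof. by move=> /subsetP sAB /prime_setP pB; apply/prime_setP => p /sAB /pB. Qed.

Lemma prime_setD1 A p : prime_set A -> prime_set (A :\ p).
Proof. by apply: prime_setS; exact: subD1set. Qed.

Lemma prodn_gt0 A : prime_set A -> (0 < prodn A)%N.
Proof. by move/prime_setP=> pA; apply: prodn_cond_gt0 => p /pA /prime_gt0. Qed.

Lemma prime_dvd_prodn A (q : nat) : prime_set A -> prime q ->
  (q %| prodn A)%N = [exists p in A, q == p].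
Proof.
move=> /prime_setP pA pq; rewrite /prodn Euclid_dvd_prod // big_orE.
by apply: eq_existsb => p; case: (boolP (p \in A)) => //= /pA pp; rewrite dvdn_prime2.
Qed.

Lemma prodn_dvd A m : prime_set A -> (prodn A %| m)%N = [forall p in A, p %| m]%N.
Proof.
move: {2}#|A|.+1 (ltnSn #|A|) => n; elim: n A => // n IH A; rewrite ltnS => cA pA.
case: (set_0Vmem A) => [->|[p pinA]].
  by rewrite /prodn big_set0 dvd1n; apply/esym/'forall_implyP => p; rewrite inE.
have pD := prime_setD1 p pA.
have pp : prime p by move/prime_setP: pA; apply.
have -> : prodn A = (p * prodn (A :\ p))%N by rewrite /prodn (big_setD1 p).
rewrite Gauss_dvd; last first.
  rewrite prime_coprime // prime_dvd_prodn //; apply/existsP => -[q /andP[+ /eqP/val_inj e]].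
  by rewrite -e !inE eqxx.
rewrite IH // ?(leq_trans _ cA) //; last by rewrite [leqRHS](cardsD1 p) pinA.
apply/andP/'forall_implyP => [[pm /'forall_implyP H] q qA|H].
  by have [->//|nqp] := eqVneq q p; apply: H; rewrite !inE nqp.
by split; [exact: H|apply/'forall_implyP => q; rewrite !inE => /andP[_ /H]].
Qed.

Lemma totient_prodn A : prime_set A -> totient (prodn A) = (\prod_(p in A) p.-1)%N.
Proof.
move: {2}#|A|.+1 (ltnSn #|A|) => n; elim: n A => // n IH A; rewrite ltnS => cA pA.
case: (set_0Vmem A) => [->|[p pinA]].
  by rewrite /prodn !big_set0.
have pD := prime_setD1 p pA.
have pp : prime p by move/prime_setP: pA; apply.
have -> : prodn A = (p * prodn (A :\ p))%N by rewrite /prodn (big_setD1 p).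
rewrite totient_coprime; last first.
  rewrite prime_coprime // prime_dvd_prodn //; apply/existsP => -[q /andP[+ /eqP/val_inj e]].
  by rewrite -e !inE eqxx.
rewrite IH // ?(leq_trans _ cA) ?[leqRHS](cardsD1 p) ?pinA //.
by rewrite totient_prime // [in RHS](big_setD1 p).
Qed.

Lemma prodn_inj A B : prime_set A -> prime_set B -> prodn A = prodn B -> A = B.
Proof.
move=> pA pB e; apply/setP => p.
have H C : prime_set C -> (p \in C) = prime p && (p %| prodn C)%N.
  move=> pC; apply/idP/andP => [pinC|[pp]].
    split; first by move/prime_setP: pC; apply.
    by rewrite /prodn (big_setD1 p) //= dvdn_mulr.
  by rewrite prime_dvd_prodn // => /existsP[q /andP[qC /eqP/val_inj->]].
by rewrite !H // e.
Qed.

(** A prime factor p of n is split off; if it already lies in the set found for n / p, it leaves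
    that set and moves into b, otherwise it joins the set. *)
Lemma square_squarefree n : (0 < n <= N)%N ->
  exists b A, [/\ (0 < b)%N, prime_set A & n = (b ^ 2 * prodn A)%N].
Proof.
elim: n {-2}n (leqnn n) => [|m IH] n nm /andP[n0 nN]; first by move: n0; rewrite ltnNge nm.
have [n1|n1] := leqP n 1.
  exists 1%N, set0; split => //; first by apply/prime_setP => p; rewrite inE.
  by rewrite /prodn big_set0; lia.
have pp := pdiv_prime n1; have pn := pdiv_dvd n; set p := pdiv n in pp pn.
have e : n = (p * (n %/ p))%N by rewrite mulnC divnK.
have lt : (n %/ p < n)%N by rewrite ltn_Pdiv // prime_gt1.
have q0 : (0 < n %/ p)%N by rewrite divn_gt0 ?prime_gt0 // dvdn_leq.
have [||b [A [b0 pA eA]]] := IH (n %/ p)%N; first lia.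
  by rewrite q0; lia.
have pN : (p < N.+1)%N by rewrite ltnS (leq_trans _ nN) // dvdn_leq.
pose P := Ordinal pN.
have [PA|PA] := boolP (P \in A).
  exists (b * p)%N, (A :\ P); split; rewrite ?muln_gt0 ?b0 ?prime_gt0 //.
    exact: prime_setD1.
  by rewrite e eA {1}/prodn (big_setD1 P) //= -/(prodn _); rewrite !expnS !expn0 !muln1; ring.
exists b, (P |: A); split=> //.
  apply/prime_setP => q; rewrite !inE => /orP[/eqP->//|].
  by move/prime_setP: pA; apply.
by rewrite e eA /prodn big_setU1 //= mulnCA.
Qed.

End PrimeSets.

(** * Selberg's sieve *)

Lemma prod1D_subsets (R : comPzRingType) (I : finType) (A : {set I}) (f : I -> R) :
  \prod_(i in A) (1 + f i) = \sum_(F : {set I} | F \subset A) \prod_(i in F) f i.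
Proof.
rewrite big_mkcond /=.
under eq_bigr => i _.
  rewrite (_ : (if _ then _ else _) = (if i \in A then f i else 0) + 1); last by case: ifP; rewrite ?add0r // addrC.
  over.
rewrite bigA_distr [RHS]big_mkcond /=; apply: eq_bigr => J _.
case: ifP => [JA|/negbT/subsetPn[i iJ iA]]; last first.
  by rewrite (bigD1 i) //= iJ (negbTE iA) mul0r.
rewrite [RHS]big_mkcond; apply: eq_bigr => i _; case: ifP => // iJ.
by rewrite (subsetP JA).
Qed.

(** Möbius inversion on the lattice of subsets. In the product each point either joins E (term -1,
    allowed inside G) or stays out (term 1, allowed outside F); a point lying in exactly one of F
    and G gives a zero factor. *)
Lemma sum_sign_interval (R : comPzRingType) (I : finType) (F G : {set I}) :
  \sum_(E : {set I} | (F \subset E) && (E \subset G)) (-1) ^+ #|E| =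
    (if F == G then (-1) ^+ #|F| else 0) :> R.
Proof.
transitivity (\prod_(i : I) ((if i \in G then -1 else 0) + (if i \in F then 0 else 1) : R)).
  rewrite bigA_distr big_mkcond; apply: eq_bigr => J _.
  case: (boolP (F \subset J)) => [FJ|/subsetPn[i iF iJ]] /=; last first.
    by rewrite (bigD1 i) //= (negbTE iJ) iF mul0r.
  case: (boolP (J \subset G)) => [JG|/subsetPn[i iJ iG]] /=; last first.
    by rewrite (bigD1 i) //= iJ (negbTE iG) mul0r.
  rewrite -[#|J|]muln1 -sum_nat_const -prodrXr [LHS]big_mkcond; apply: eq_bigr => i _.
  case: ifP => [iJ|/negbT iJ]; first by rewrite (subsetP JG) ?expr1.
  by rewrite (contraNF (subsetP FJ i)).
case: eqVneq => [->|FG].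
  rewrite -[#|G|]muln1 -sum_nat_const -prodrXr [RHS]big_mkcond; apply: eq_bigr => i _.
  by case: ifP; rewrite ?addr0 ?add0r ?expr1.
have /existsP[i iFG] : [exists i, (i \in F) != (i \in G)].
  apply: contraT; rewrite negb_exists => /forallP H; case/eqP: FG.
  by apply/setP => i; apply/eqP; rewrite -[_ == _]negbK H.
rewrite (bigD1 i) //=; case: (i \in F) iFG; case: (i \in G) => // _;
  by rewrite ?addNr ?addr0 mul0r.
Qed.

Section CountMod.
Variables (e d : nat).
Hypotheses (e0 : (0 < e)%N) (ed : coprime e d).

Lemma dvdn_affine_mod : exists c, forall m, (e %| d * m + 1)%N = (m == c %[mod e])%N.
Proof.
have tot0 : (0 < totient e)%N by rewrite totient_gt0.
have E : (d * d ^ (totient e).-1 = 1 %[mod e])%N.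
  by rewrite -expnS prednK // Euler_exp_totient // coprime_sym.
set k := (d ^ (totient e).-1)%N in E.
exists (k * e.-1)%N => m; apply/idP/eqP => H.
  have H1 : (d * m + 1 = 0 %[mod e])%N by apply/eqP; rewrite mod0n.
  have H2 : (e.-1 + 1 = 0 %[mod e])%N by rewrite addn1 prednK // modnn mod0n.
  have /eqP : (d * m + 1 = e.-1 + 1 %[mod e])%N by rewrite H1 H2.
  rewrite eqn_modDr => /eqP H3.
  rewrite -[in RHS]modnMmr -H3 modnMmr mulnA (mulnC k) -modnMml E modnMml.
  by rewrite mul1n.
rewrite /dvdn -modnDml -modnMmr H modnMmr mulnA -modnMml E modnMml mul1n modnDml.
by rewrite addn1 prednK // modnn.
Qed.

Lemma sum_mod_eq c M :
  (\sum_(m < M | m == c %[mod e]) 1 = M %/ e + (c %% e < M %% e))%N.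
Proof.
elim: M => [|M IH]; first by rewrite big_ord0 div0n mod0n.
rewrite big_mkcond big_ord_recr -big_mkcond /= IH divnS // modnS.
have cl : (c %% e < e)%N by rewrite ltn_mod.
have Ml : (M %% e < e)%N by rewrite ltn_mod.
have -> : (e %| M.+1)%N = ((M %% e).+1 == e).
  rewrite /dvdn -addn1 -modnDml addn1.
  have [h|h|h] := ltngtP (M %% e).+1 e; [by rewrite modn_small| |by rewrite h modnn].
  by move: h; rewrite ltnNge Ml.
have -> : (if M == c %[mod e] then 1 else 0)%N = (M == c %[mod e])%N :> nat by case: ifP.
move: Ml cl; move: (M %% e)%N (c %% e)%N (M %/ e)%N => r c' q rl cl.
case: (eqVneq r.+1 e) => [h|h]; case: (ltngtP c' r) => h1; rewrite /= ?ltnS ?ltn0 ?(ltnW h1) /=;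
  lia.
Qed.

Lemma count_dvd_affine (R : realFieldType) M :
  `|(\sum_(m < M | (e %| d * m + 1)%N) 1)%:R - M%:R / e%:R| <= 1 :> R.
Proof.
have [c Hc] := dvdn_affine_mod.
under eq_bigl do rewrite Hc.
rewrite sum_mod_eq; have er : 0 < e%:R :> R by rewrite ltr0n.
have -> : M%:R / e%:R = (M %/ e)%:R + (M %% e)%:R / e%:R :> R.
  by rewrite {1}(divn_eq M e) natrD natrM mulrDl mulfK // gt_eqF.
rewrite natrD opprD addrACA subrr add0r.
have t0 : 0 <= (M %% e)%N%:R / e%:R :> R by rewrite divr_ge0 ?ler0n.
have t1 : (M %% e)%N%:R / e%:R <= 1 :> R.
  by rewrite ler_pdivrMr // mul1r ler_nat ltnW // ltn_mod.
rewrite ler_norml.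
by case: ltnP => _ /=; rewrite ?mulr1n ?mulr0n; apply/andP; split; lra.
Qed.
End CountMod.

Section Selberg.
Variables (R : realType) (D d : nat).
Hypothesis (d0 : (0 < d)%N).
Hypothesis (D0 : (0 < D)%N).
Notation T := 'I_D.+1.
Implicit Types E F G : {set T}.

(** The squarefree moduli of the sieve, prime to the difference m of the progression; m = 1 gives
    all squarefree moduli up to D. *)
Definition sifting_sets (m : nat) : {set {set T}} :=
  [set E | [&& prime_set E, [forall p in E, ~~ (p %| m)%N] & (prodn E <= D)%N]].

Definition phiset E : R := \prod_(p in E) (p.-1)%:R.

Definition selberg_sum (m : nat) : R := \sum_(E in sifting_sets m) (phiset E)^-1.

Lemma phiset_gt0 E : prime_set E -> 0 < phiset E.
Proof.
move=> /prime_setP pE; apply: prodr_gt0 => p /pE /prime_gt1.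
by rewrite ltr0n; case: (p : nat) => [|[]].
Qed.

Lemma sifting_prime m E : E \in sifting_sets m -> prime_set E.
Proof. by rewrite inE => /and3P[]. Qed.

Lemma siftingS m E F : E \subset F -> F \in sifting_sets m -> E \in sifting_sets m.
Proof.
move=> EF; rewrite !inE => /and3P[pF cF lF]; have pE := prime_setS EF pF.
rewrite pE /=; apply/andP; split.
  by apply/'forall_implyP => p /(subsetP EF) pinF; move/'forall_implyP: cF; apply.
apply: leq_trans lF; rewrite dvdn_leq ?prodn_gt0 // prodn_dvd //.
apply/'forall_implyP => p /(subsetP EF) pinF; rewrite /prodn (bigD1 p) //=.
exact: dvdn_mulr.
Qed.

Lemma sifting0 m : set0 \in sifting_sets m.
Proof.
rewrite inE /prodn big_set0 D0 andbT; apply/andP; split.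
  by apply/prime_setP => p; rewrite inE.
by apply/'forall_implyP => p; rewrite inE.
Qed.

Lemma selberg_sum_gt0 m : 0 < selberg_sum m.
Proof.
rewrite /selberg_sum (bigD1 set0) ?sifting0 //= ltr_wpDr //.
  apply: sumr_ge0 => E /andP[/sifting_prime/phiset_gt0 h _].
  by rewrite invr_ge0 ltW.
by rewrite invr_gt0 phiset_gt0 // (sifting_prime (sifting0 m)).
Qed.

Local Notation S := (selberg_sum d).
Local Notation fam := (sifting_sets d).

(* Selberg's optimal weights, obtained by diagonalising the quadratic form in
   [selberg_quadratic_form]; [prodn E] is the divisor usually written d. *)
Definition selberg_weight E : R :=
  (-1) ^+ #|E| * (prodn E)%:R / S * \sum_(G in fam | E \subset G) (phiset G)^-1.

Lemma selberg_weight0 : selberg_weight set0 = 1.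
Proof.
rewrite /selberg_weight cards0 expr0 mul1r {1}/prodn big_set0.
under eq_bigl do rewrite sub0set andbT.
by rewrite -/S mulrC mul1r mulfV // gt_eqF // selberg_sum_gt0.
Qed.

(** These sums are the variables in which the quadratic form of the sieve is diagonal. After
    exchanging the sums, the alternating sum over E between F and G leaves only G = F. *)
Lemma selberg_weight_transform F :
  \sum_(E in fam | F \subset E) selberg_weight E / (prodn E)%:R =
  if F \in fam then (-1) ^+ #|F| / (S * phiset F) else 0.
Proof.
transitivity (\sum_(G in fam) (S * phiset G)^-1 *
   \sum_(E : {set T} | (F \subset E) && (E \subset G)) (-1) ^+ #|E|).
  transitivity (\sum_(E in fam | F \subset E) \sum_(G in fam | E \subset G)
     (S * phiset G)^-1 * (-1) ^+ #|E|).
    apply: eq_bigr => E /andP[Ef FE]; rewrite /selberg_weight.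
    have pE := prodn_gt0 (sifting_prime Ef).
    have -> s : (-1) ^+ #|E| * (prodn E)%:R / S * s / (prodn E)%:R = (-1) ^+ #|E| / S * s.
      have S0 := lt0r_neq0 (selberg_sum_gt0 d).
      by field; rewrite S0 pnatr_eq0 -lt0n.
    rewrite mulr_sumr; apply: eq_bigr => G _.
    by rewrite invfM [RHS]mulrC mulrA.
  rewrite (exchange_big_dep (mem fam)) /=; last by move=> E G _ /andP[].
  apply: eq_bigr => G Gf; rewrite mulr_sumr; apply: eq_bigl => E.
  rewrite Gf /=; case: (boolP (E \subset G)) => EG; rewrite ?andbF ?andbT //.
  by rewrite (siftingS EG).
under eq_bigr do rewrite sum_sign_interval.
case: ifP => Ff.
  rewrite (bigD1 F) //= eqxx big1 ?addr0; first by rewrite mulrC.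
  by move=> G /andP[_ GF]; rewrite eq_sym (negbTE GF) mulr0.
rewrite big1 // => G Gf; case: eqVneq => e; rewrite ?mulr0 //.
by rewrite e Gf in Ff.
Qed.

Lemma prodn_subsets E : prime_set E ->
  (prodn E)%:R = \sum_(F : {set T} | F \subset E) phiset F :> R.
Proof.
move=> /prime_setP pE; rewrite -prod1D_subsets /prodn natr_prod; apply: eq_bigr => p pinE.
by rewrite -[1]/(1%:R) -natrD add1n prednK // prime_gt0 // pE.
Qed.

Lemma prodnUI E F : (prodn (E :|: F) * prodn (E :&: F) = prodn E * prodn F)%N.
Proof.
pose f G p := (if p \in G then (p : nat) else 1)%N.
have e G H : (prodn G * prodn H = \prod_p (f G p * f H p))%N.
  by rewrite big_split /= /prodn -!big_mkcond.
rewrite !e /f.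
by apply: eq_bigr => p _; rewrite !inE; case: (p \in E); case: (p \in F); rewrite ?mul1n ?muln1.
Qed.

(** One over the lcm is the gcd over the product, and the gcd is the sum of [phiset H] over H
    contained in both sets. The form is thus a sum over H of [phiset H] times the square of the
    transform, which collapses to S / S^2. *)
Lemma selberg_quadratic_form :
  \sum_(E in fam) \sum_(F in fam)
    selberg_weight E * selberg_weight F / (prodn (E :|: F))%:R = S^-1.
Proof.
pose y E := selberg_weight E / (prodn E)%:R.
transitivity (\sum_(E in fam) \sum_(F in fam)
   \sum_(H : {set T} | H \subset E :&: F) phiset H * (y E * y F)).
  apply: eq_bigr => E Ef; apply: eq_bigr => F Ff.
  have pE := sifting_prime Ef; have pF := sifting_prime Ff.
  have pEF : prime_set (E :&: F) by apply: prime_setS pE; exact: subsetIl.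
  have pUF : prime_set (E :|: F).
    by apply/prime_setP => p; rewrite inE => /orP[]; move: p; apply/prime_setP.
  rewrite -mulr_suml -prodn_subsets // /y.
  have := congr1 (fun n => n%:R : R) (prodnUI E F); rewrite !natrM.
  have nz G : prime_set G -> (prodn G)%:R != 0 :> R.
    by move=> /prodn_gt0; rewrite pnatr_eq0 -lt0n.
  move: (nz _ pE) (nz _ pF) (nz _ pUF) => nE nF nU e.
  have -> : (prodn (E :&: F))%:R = (prodn E)%:R * (prodn F)%:R / (prodn (E :|: F))%:R :> R.
    by rewrite -e mulrAC mulfV // mul1r.
  by field; rewrite nE nF nU.
transitivity (\sum_(H : {set T}) phiset H * (\sum_(E in fam | H \subset E) y E) ^+ 2).
  under eq_bigr => E _ do rewrite (exchange_big_dep predT) //=.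
  rewrite exchange_big /=; apply: eq_bigr => H _.
  rewrite expr2 big_distrl /= mulr_sumr [RHS]big_mkcondr /=; apply: eq_bigr => E _.
  case: ifP => HE; last first.
    by rewrite big1 // => F /andP[_]; rewrite subsetI HE.
  rewrite !mulr_sumr; apply: eq_bigl => F; by rewrite subsetI HE.
under eq_bigr do rewrite selberg_weight_transform.
rewrite (bigID (mem fam)) /= [X in _ + X]big1 ?addr0; last first.
  by move=> H /negbTE ->; rewrite expr0n mulr0.
under eq_bigr => H Hf.
  rewrite Hf (_ : _ * _ = (S ^+ 2)^-1 * (phiset H)^-1); last first.
    have S0 := lt0r_neq0 (selberg_sum_gt0 d).
    have p0 := lt0r_neq0 (phiset_gt0 (sifting_prime Hf)).
    rewrite exprMn -exprM mulnC exprM sqrrN expr1n expr1n.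
    by field; rewrite S0 p0.
  over.
rewrite -mulr_sumr -/S; field; exact: lt0r_neq0 (selberg_sum_gt0 d).
Qed.

(** Exchanging the sums, each G carries the sum of [prodn E] over E inside G, that is the product of
    the 1 + p, which is at most the square of [prodn G] since 1 + p <= p^2; the remaining sum over G
    is S and cancels. *)
Lemma sum_selberg_weight : \sum_(E in fam) `|selberg_weight E| <= D%:R ^+ 2.
Proof.
have S0 := selberg_sum_gt0 d.
apply: (@le_trans _ _ (\sum_(E in fam) \sum_(G in fam | E \subset G)
    (phiset G)^-1 * ((prodn E)%:R / S))).
  apply: ler_sum => E Ef.
  rewrite -mulr_suml /selberg_weight normrM (mulrC _ (_ / _)).
  rewrite [X in _ * X]ger0_norm; last first.
    by apply: sumr_ge0 => G /andP[/sifting_prime/phiset_gt0 h _]; rewrite invr_ge0 ltW.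
  rewrite -mulrA normrM normrX normrN1 expr1n mul1r ger0_norm //.
  by rewrite divr_ge0 ?ler0n // ltW.
rewrite (exchange_big_dep (mem fam)) /=; last by move=> E G _ /andP[].
apply: (@le_trans _ _ (\sum_(G in fam) (phiset G)^-1 * (D%:R ^+ 2 / S))).
  apply: ler_sum => G Gf; have pG := sifting_prime Gf.
  rewrite -mulr_sumr; apply: ler_wpM2l; first by rewrite invr_ge0 ltW // phiset_gt0.
  rewrite -mulr_suml; apply: ler_wpM2r; first by rewrite invr_ge0 ltW.
  apply: (@le_trans _ _ (\sum_(E : {set T} | E \subset G) \prod_(p in E) (p : nat)%:R : R)).
    rewrite le_eqVlt; apply/orP; left; apply/eqP.
    transitivity (\sum_(E : {set T} | E \subset G) (prodn E)%:R : R).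
      apply: eq_bigl => E; rewrite Gf /=; case: (boolP (E \subset G)) => EG; rewrite ?andbF //.
      by rewrite (siftingS EG).
    by apply: eq_bigr => E _; rewrite /prodn natr_prod.
  rewrite -prod1D_subsets.
  apply: (@le_trans _ _ ((prodn G)%:R ^+ 2 : R)).
    rewrite /prodn natr_prod -prodrXl; apply: ler_prod => p pinG.
    have p2 : (1 < p)%N by apply: prime_gt1; move/prime_setP: pG; apply.
    by rewrite addr_ge0 ?ler01 ?ler0n //= -natrX -[1]/(1%:R) -natrD ler_nat; nia.
  rewrite lerXn2r ?nnegrE ?ler0n // ler_nat.
  by move: Gf; rewrite inE => /and3P[].
by rewrite -mulr_suml -/S mulrCA mulfV ?mulr1 // gt_eqF.
Qed.

(* The error term is the square of [sum_selberg_weight], far from the usual D^2 but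
   sufficient since the sieving level is only a small power of M. *)
Lemma sieve_count M :
  (\sum_(m < M | prime (d * m + 1) && (D < d * m + 1)%N) 1)%:R
    <= M%:R / S + D%:R ^+ 4 :> R.
Proof.
pose w := selberg_weight; pose a (m : nat) E := (prodn E %| d * m + 1)%N.
(* Selberg's majorant: a prime above D has no divisor in the family except the one of [set0], so the
   square equals 1 there, and it is nonnegative elsewhere. *)
apply: (@le_trans _ _ (\sum_(m < M) (\sum_(E in fam | a m E) w E) ^+ 2)).
  rewrite natr_sum big_mkcond /=; apply: ler_sum => m _.
  case: ifP => [/andP[pm Dm]|_]; last exact: sqr_ge0.
  rewrite (big_pred1 set0) ?selberg_weight0 ?expr1n //; last first.
    move=> E; apply/andP/eqP => [[Ef aE]|->]; last first.
      by rewrite sifting0 /a /prodn big_set0 dvd1n.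
    have pE := sifting_prime Ef.
    apply/eqP; rewrite -subset0; apply/subsetP => p pinE.
    move: aE; rewrite /a prodn_dvd // => /'forall_implyP /(_ p pinE).
    rewrite dvdn_prime2 //; last by move/prime_setP: pE; apply.
    by move=> /eqP e; move: Dm; rewrite -e ltnNge -ltnS ltn_ord.
  by rewrite /w selberg_weight0 expr1n.
have cnt E F : E \in fam -> F \in fam ->
  `|\sum_(m < M | a m E && a m F) 1 - M%:R / (prodn (E :|: F))%:R| <= 1 :> R.
  move=> Ef Ff.
  have pE := sifting_prime Ef; have pF := sifting_prime Ff.
  have pU : prime_set (E :|: F).
    by apply/prime_setP => p; rewrite inE => /orP[]; move: p; apply/prime_setP.
  rewrite (_ : \sum_(m < M | a m E && a m F) 1 =
    (\sum_(m < M | a m E && a m F) 1)%N%:R); last by rewrite natr_sum.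
  have -> : (\sum_(m < M | a m E && a m F) 1 = \sum_(m < M | (prodn (E :|: F) %| d * m + 1)) 1)%N.
    apply: eq_bigl => m; rewrite /a !prodn_dvd //.
    apply/andP/'forall_implyP => [[/'forall_implyP h1 /'forall_implyP h2] p|h].
      by rewrite inE => /orP[/h1|/h2].
    by split; apply/'forall_implyP => p pin; apply: h; rewrite inE pin ?orbT.
  apply: count_dvd_affine; first exact: prodn_gt0.
  rewrite /prodn; apply: (big_ind (fun x => coprime x d)) => [|x y|p pin].
  - exact: coprime1n.
  - by rewrite coprimeMl => -> ->.
  rewrite prime_coprime; last by move/prime_setP: pU; apply.
  move: pin; rewrite inE => /orP[].
    by move: Ef; rewrite inE => /and3P[_ /'forall_implyP + _]; apply.
  by move: Ff; rewrite inE => /and3P[_ /'forall_implyP + _]; apply.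
have -> : \sum_(m < M) (\sum_(E in fam | a m E) w E) ^+ 2 =
  \sum_(E in fam) \sum_(F in fam) w E * w F * \sum_(m < M | a m E && a m F) 1.
  transitivity (\sum_(m < M) \sum_(E in fam) \sum_(F in fam)
      if a m E && a m F then w E * w F else 0).
    apply: eq_bigr => m _; rewrite expr2 big_distrl big_mkcondr /=; apply: eq_bigr => E _.
    case: (a m E) => /=; last by rewrite big1.
    by rewrite mulr_sumr big_mkcondr.
  rewrite exchange_big /=; apply: eq_bigr => E _.
  rewrite exchange_big /=; apply: eq_bigr => F _.
  by rewrite mulr_sumr [RHS]big_mkcond /=; apply: eq_bigr => m _; rewrite mulr1.
apply: (@le_trans _ _ (\sum_(E in fam) \sum_(F in fam)
   (M%:R * (w E * w F / (prodn (E :|: F))%:R) + `|w E| * `|w F|))).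
  apply: ler_sum => E Ef; apply: ler_sum => F Ff.
  have := cnt E F Ef Ff; set c := \sum_(m < M | _) 1; set q := (prodn _)%:R => h.
  have -> : w E * w F * c = M%:R * (w E * w F / q) + w E * w F * (c - M%:R / q) by ring.
  rewrite lerD2l; apply: le_trans (ler_norm _) _.
  by rewrite normrM (normrM (w E)); apply: ler_piMr => //; rewrite mulr_ge0.
under eq_bigr do rewrite big_split /= -!mulr_sumr.
rewrite big_split /= -mulr_sumr selberg_quadratic_form lerD2l.
rewrite -mulr_suml -[4%N]/(2 * 2)%N exprM expr2.
have h := sum_selberg_weight; have h0 : 0 <= \sum_(E in fam) `|w E| by apply: sumr_ge0.
exact: ler_pM.
Qed.
End Selberg.

(** * Sums over finite ranges *)

Section Sums.
Variable R : realType.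

Lemma perm_cat_filter_notin (T : eqType) (s1 s2 : seq T) : uniq s1 -> uniq s2 -> {subset s1 <= s2} ->
  perm_eq s2 (s1 ++ [seq x <- s2 | x \notin s1]).
Proof.
move=> u1 u2 sub; apply: uniq_perm => //.
  rewrite cat_uniq u1 filter_uniq // andbT; apply/hasPn => x.
  by rewrite mem_filter => /andP[].
move=> x; rewrite mem_cat mem_filter; case: (boolP (x \in s1)) => //= /sub ->//.
Qed.

Lemma ler_sum_subseq (T : eqType) (s1 s2 : seq T) (F : T -> R) :
  uniq s1 -> {subset s1 <= s2} -> (forall x, x \in s2 -> 0 <= F x) ->
  \sum_(x <- s1) F x <= \sum_(x <- s2) F x.
Proof.
move=> u1 sub F0; apply: (@le_trans _ _ (\sum_(x <- undup s2) F x)).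
  rewrite (perm_big _ (perm_cat_filter_notin u1 (undup_uniq s2) _)) /=; last first.
    by move=> x /sub; rewrite mem_undup.
  rewrite big_cat /= lerDl big_seq; apply: sumr_ge0 => x.
  by rewrite mem_filter mem_undup => /andP[_ /F0].
elim: s2 F0 {sub} => //= x s IH F0.
have F0' y : y \in s -> 0 <= F y by move=> ys; apply: F0; rewrite inE ys orbT.
rewrite big_cons; case: ifP => _; last by rewrite big_cons lerD2l IH.
by apply: le_trans (IH F0') _; rewrite lerDr F0 ?mem_head.
Qed.

Lemma ler_prod_subseq (T : eqType) (s1 s2 : seq T) (F : T -> R) :
  uniq s1 -> uniq s2 -> {subset s1 <= s2} -> (forall x, x \in s2 -> 1 <= F x) ->
  \prod_(x <- s1) F x <= \prod_(x <- s2) F x.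
Proof.
move=> u1 u2 sub F1; rewrite (perm_big _ (perm_cat_filter_notin u1 u2 sub)) /=.
rewrite big_cat /= -[leLHS]mulr1 ler_wpM2l //.
  by rewrite big_seq; apply: prodr_ge0 => x /sub /F1; apply: le_trans.
rewrite big_seq; apply: (big_ind (fun y : R => 1 <= y)) => //.
  by move=> a b a1 b1; rewrite -[1]mulr1 ler_pM.
by move=> x; rewrite mem_filter => /andP[_ /F1].
Qed.

Lemma ler_sum_inj (I J : finType) (P : pred I) (Q : pred J) (h : I -> J) (F : J -> R) :
  {in P &, injective h} -> (forall i, P i -> Q (h i)) -> (forall j, Q j -> 0 <= F j) ->
  \sum_(i | P i) F (h i) <= \sum_(j | Q j) F j.
Proof.
move=> inj PQ F0; rewrite -[leLHS]big_filter -[leRHS]big_filter -(big_map h xpredT F).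
apply: ler_sum_subseq => [|j|j]; last by rewrite mem_filter => /andP[/F0].
  rewrite map_inj_in_uniq ?filter_uniq ?index_enum_uniq // => x y.
  by rewrite !mem_filter => /andP[Px _] /andP[Py _]; exact: inj.
case/mapP => i; rewrite !mem_filter => /andP[Pi _] ->.
by rewrite PQ //= mem_index_enum.
Qed.

Lemma ler_sum_fiber (J : finType) (P : pred J) (Q : pred nat) (f : J -> nat) (F : nat -> R) N :
  (forall n, 0 <= F n) ->
  (forall n, (0 < n <= N)%N -> Q n -> exists2 j, P j & f j = n) ->
  \sum_(1 <= n < N.+1 | Q n) F n <= \sum_(j | P j) F (f j).
Proof.
move=> F0 H; rewrite -[leRHS]big_filter.
rewrite -(big_map f xpredT F) -[leLHS]big_filter; apply: ler_sum_subseq => //.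
  by rewrite filter_uniq // iota_uniq.
move=> n; rewrite mem_filter mem_index_iota ltnS => /andP[Qn nN].
have [j Pj <-] := H n nN Qn; apply: map_f.
by rewrite mem_filter Pj mem_index_enum.
Qed.

Lemma sum_inv_sqr n : \sum_(1 <= b < n.+1) (b%:R ^+ 2)^-1 <= 2 :> R.
Proof.
suff: \sum_(1 <= b < n.+2) (b%:R ^+ 2)^-1 <= 2 - n.+1%:R^-1 :> R.
  move=> h; apply: le_trans (le_trans _ h) _; last by rewrite gerBl invr_ge0 ler0n.
  by rewrite [leRHS]big_nat_recr //= lerDl invr_ge0 exprn_ge0.
elim: n => [|n IH]; first by rewrite big_nat1 expr1n invr1; lra.
rewrite big_nat_recr //=; apply: le_trans (lerD IH (lexx _)) _.
rewrite -addrA lerD2l.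
have x0 : 0 < n.+1%:R :> R by rewrite ltr0n.
have -> : n.+2%:R = n.+1%:R + 1 :> R by rewrite -[n.+2]addn1 natrD.
move: (n.+1%:R : R) x0 => x x0.
rewrite -subr_ge0.
have -> : - (x + 1)^-1 - (- x^-1 + ((x + 1) ^+ 2)^-1) = (x * (x + 1) ^+ 2)^-1.
  by field; apply/andP; split; lra.
by rewrite invr_ge0; nra.
Qed.

Lemma ln1D_le x : 0 <= x -> ln (1 + x) <= x :> R.
Proof. by move=> x0; apply: le_ln1Dx; lra. Qed.

Lemma ln_le_harmonic n : ln n.+1%:R <= \sum_(1 <= k < n.+1) k%:R^-1 :> R.
Proof.
elim: n => [|n IH]; first by rewrite ln1 big_geq.
rewrite big_nat_recr //=; have x0 : 0 < n.+1%:R :> R by rewrite ltr0n.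
have -> : n.+2%:R = n.+1%:R * (1 + n.+1%:R^-1) :> R.
  by rewrite -[n.+2]addn1 natrD; field; lra.
rewrite lnM ?posrE //; last by rewrite ltr_wpDr // invr_ge0 ltW.
by apply: lerD => //; apply: ln1D_le; rewrite invr_ge0 ltW.
Qed.

Lemma harmonic_le n : \sum_(1 <= k < n.+2) k%:R^-1 <= 1 + ln n.+1%:R :> R.
Proof.
elim: n => [|n IH]; first by rewrite ln1 big_nat1 invr1 addr0.
rewrite big_nat_recr //=; apply: le_trans (lerD IH (lexx _)) _.
rewrite -addrA lerD2l.
have x0 : 0 < n.+1%:R :> R by rewrite ltr0n.
have y0 : 0 < n.+2%:R :> R by rewrite ltr0n.
have e : n.+1%:R = n.+2%:R * (1 + - n.+2%:R^-1) :> R.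
  by rewrite mulrDr mulr1 mulrN mulfV ?gt_eqF // -[n.+2]addn1 natrD; ring.
have p : 0 < 1 - n.+2%:R^-1 :> R by rewrite subr_gt0 invf_lt1 // ltr1n.
rewrite {1}e lnM ?posrE //.
move: (n.+2%:R^-1) p => v p.
have h : ln (1 - v) <= - v by apply: le_ln1Dx; lra.
by lra.
Qed.

End Sums.

Lemma totient_leq d : (0 < d)%N -> (totient d <= d)%N.
Proof.
move=> d0; rewrite {2}(prod_prime_decomp d0) totientE // prime_decompE big_map.
rewrite big_seq [leqRHS]big_seq; apply: leq_prod => p; rewrite mem_primes => /and3P[pp _ pd].
have k0 : (0 < logn p d)%N by rewrite logn_gt0 mem_primes pp d0.
by rewrite /= -{2}(prednK k0) expnS leq_mul2r leq_pred orbT.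
Qed.

(** * Primes in the progression 1 mod d *)

Section BrunTitchmarsh.
Variable R : realType.

(* Split E into the primes dividing d and the others; the former contribute
   the product of 1 + 1 / (p - 1), which is at most d / totient d. *)
Lemma selberg_sum_coprime (D d : nat) : (0 < D)%N -> (0 < d)%N ->
  selberg_sum R D 1 <= d%:R / (totient d)%:R * selberg_sum R D d.
Proof.
move=> D0 d0.
pose A := [set p : 'I_D.+1 | prime p && (p %| d)%N].
pose h (E : {set 'I_D.+1}) := (E :&: A, E :\: A).
pose F (J : {set 'I_D.+1} * {set 'I_D.+1}) := (phiset R J.1)^-1 * (phiset R J.2)^-1 : R.
have pA : prime_set A by apply/prime_setP => p; rewrite inE => /andP[].
pose Q (J : {set 'I_D.+1} * {set 'I_D.+1}) := (J.1 \subset A) && (J.2 \in sifting_sets D d).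
apply: (@le_trans _ _ (\sum_(J | Q J) F J)).
  apply: le_trans (ler_sum_inj (h := h) _ _ _).
  - apply: ler_sum => E Ef; rewrite /F /= -invfM lef_pV2 ?posrE; last 2 first.
    + exact: phiset_gt0 (sifting_prime Ef).
    + by rewrite mulr_gt0 // phiset_gt0 // (prime_setS _ (sifting_prime Ef)) ?subsetIl ?subsetDl.
    by rewrite /phiset -(big_setID A (fun p : 'I_D.+1 => p.-1%:R)).
  - move=> E E' _ _ [e1 e2]; by rewrite -(setID E A) e1 e2 setID.
  - move=> E Ef /=; rewrite /Q /= subsetIr /= inE.
    have : E :\: A \in sifting_sets D 1 by apply: siftingS Ef; exact: subsetDl.
    rewrite inE => /and3P[-> _ ->]; rewrite andbT /=.
    apply/'forall_implyP => p; rewrite !inE => /andP[+ pinE].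
    have -> // : prime p by move/prime_setP: (sifting_prime Ef); apply.
  - move=> [J1 J2] /= /andP[J1A /sifting_prime pJ2].
    by rewrite mulr_ge0 // invr_ge0 ltW // phiset_gt0 // (prime_setS J1A).
rewrite /Q -(pair_big_dep (fun J1 : {set 'I_D.+1} => J1 \subset A) (fun _ J2 => J2 \in sifting_sets D d)
  (fun J1 J2 => (phiset R J1)^-1 * (phiset R J2)^-1)) /=.
under eq_bigr do rewrite -mulr_sumr.
rewrite -mulr_suml ler_wpM2r //; first exact/ltW/selberg_sum_gt0.
have -> : \sum_(J : {set 'I_D.+1} | J \subset A) (phiset R J)^-1 = \prod_(p in A) (p%:R / (p.-1)%:R).
  transitivity (\sum_(J : {set 'I_D.+1} | J \subset A) \prod_(p in J) (p.-1%:R)^-1 : R).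
    by apply: eq_bigr => J _; rewrite -prodfV.
  rewrite -prod1D_subsets; apply: eq_bigr => p /(prime_setP _ pA) pp.
  have p1 : (p.-1)%:R != 0 :> R by rewrite pnatr_eq0 -lt0n; have := prime_gt1 pp; lia.
  have -> : p%:R = 1 + (p.-1)%:R :> R by rewrite nat1r prednK // prime_gt0.
  by rewrite mulrDl mulfV // mul1r addrC.
have -> : d%:R / (totient d)%:R = \prod_(p <- primes d) (p%:R / (p.-1)%:R) :> R.
  rewrite {1}(prod_prime_decomp d0) totientE // prime_decompE big_map !natr_prod.
  rewrite -prodfV -big_split /= big_seq [RHS]big_seq; apply: eq_bigr => p pd.
  move: (pd); rewrite mem_primes => /and3P[pp _ pdvd].
  have k0 : (0 < logn p d)%N by rewrite logn_gt0.
  have p0 : p%:R != 0 :> R by rewrite pnatr_eq0 -lt0n prime_gt0.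
  have p1 : (p.-1)%:R != 0 :> R by rewrite pnatr_eq0 -lt0n; have := prime_gt1 pp; lia.
  rewrite -{1}(prednK k0) expnS !natrM !natrX.
  by field; rewrite p1 expf_neq0.
rewrite -[leLHS]big_filter -(big_map val xpredT (fun p => p%:R / (p.-1)%:R : R)).
apply: ler_prod_subseq.
- by rewrite map_inj_uniq ?filter_uniq ?index_enum_uniq //; exact: val_inj.
- exact: primes_uniq.
- move=> p /mapP[q]; rewrite mem_filter inE => /andP[/andP[pq qd] _] ->.
  by rewrite mem_primes d0 pq.
move=> p; rewrite mem_primes => /and3P[pp _ _].
have p1 : 0 < (p.-1)%:R :> R by rewrite ltr0n; have := prime_gt1 pp; lia.
by rewrite ler_pdivlMr // mul1r ler_nat leq_pred.
Qed.

(* Every n <= D is a square times the product of a set of primes. *)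
Lemma selberg_sum1_ge (D : nat) : (0 < D)%N -> ln D.+1%:R <= 2 * selberg_sum R D 1.
Proof.
move=> D0; apply: le_trans (ln_le_harmonic R D) _.
pose P (J : 'I_D.+1 * {set 'I_D.+1}) := (0 < J.1)%N && (J.2 \in sifting_sets D 1).
pose f (J : 'I_D.+1 * {set 'I_D.+1}) := (J.1 ^ 2 * prodn J.2)%N.
apply: (@le_trans _ _ (\sum_(J | P J) ((f J)%:R)^-1)).
  apply: (ler_sum_fiber (Q := xpredT) (F := fun n => n%:R^-1)) => [n|n nD _].
    by rewrite invr_ge0.
  have [b [A [b0 pA eA]]] := square_squarefree nD.
  have pA0 := prodn_gt0 pA; case/andP: nD => n0 nD.
  have bD : (b < D.+1)%N by rewrite ltnS; nia.
  exists (Ordinal bD, A) => //=; rewrite /P /= b0 inE pA /=; apply/andP; split; last by nia.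
  apply/'forall_implyP => p /(prime_setP _ pA) pp.
  by rewrite dvdn1; apply: contraTneq pp => ->.
rewrite /P -(pair_big_dep (fun b : 'I_D.+1 => (0 < b)%N) (fun _ A => A \in sifting_sets D 1)
  (fun b A => (b ^ 2 * prodn A)%N%:R^-1)) /=.
have -> : 2 * selberg_sum R D 1 = \sum_(A in sifting_sets D 1) 2 * (phiset R A)^-1.
  by rewrite -mulr_sumr.
rewrite exchange_big /=; apply: ler_sum => A Af; have pA := sifting_prime Af.
apply: (@le_trans _ _ (\sum_(i < D.+1 | (0 < i)%N) (i%:R ^+ 2)^-1 * (phiset R A)^-1)).
  apply: ler_sum => b b0; rewrite natrM natrX invfM.
  apply: ler_wpM2l; first by rewrite invr_ge0 exprn_ge0.
  rewrite lef_pV2 ?posrE ?phiset_gt0 ?ltr0n ?prodn_gt0 //.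
  rewrite /phiset /prodn natr_prod; apply: ler_prod => p _.
  by rewrite ler0n ler_nat leq_pred.
rewrite -mulr_suml; apply: ler_wpM2r; first by rewrite invr_ge0 ltW // phiset_gt0.
apply: le_trans (sum_inv_sqr R D).
by rewrite big_mkcond big_ord_recl /= add0r big_add1 /= big_mkord.
Qed.

Lemma selberg_sum_ge (D d : nat) : (0 < D)%N -> (0 < d)%N ->
  ln D.+1%:R <= 2 * (d%:R / (totient d)%:R) * selberg_sum R D d.
Proof.
move=> D0 d0; apply: le_trans (selberg_sum1_ge D0) _.
by rewrite -mulrA ler_wpM2l // selberg_sum_coprime.
Qed.

Lemma prime_count_ap (D d M : nat) : (0 < D)%N -> (0 < d)%N ->
  (\sum_(m < M | prime (d * m + 1) && (D < d * m + 1)%N) 1)%:R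
    <= M%:R * (2 * (d%:R / (totient d)%:R)) / ln D.+1%:R + D%:R ^+ 4 :> R.
Proof.
move=> D0 d0; apply: le_trans (sieve_count _ d0 D0 M) _.
rewrite lerD2r -mulrA; apply: ler_wpM2l => //.
have l0 : 0 < ln D.+1%:R :> R by rewrite ln_gt0 // ltr1n.
have S0 : 0 < selberg_sum R D d by exact: selberg_sum_gt0.
rewrite ler_pdivlMr // ler_pdivrMl //; last by rewrite mulrC selberg_sum_ge.
Qed.

Lemma ln2_ge : 2^-1 <= ln 2 :> R.
Proof.
rewrite -(expRK (2^-1 : R)) ler_ln ?posrE ?expR_gt0 //.
have h := expR_ge1Dx (- 2^-1 : R); rewrite expRN in h.
have e0 := expR_gt0 (2^-1 : R).
rewrite -[leRHS]invrK -[leLHS]invrK lef_pV2 ?posrE ?invr_gt0 //.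
by lra.
Qed.

Lemma harmonic_ord_le J : \sum_(j < J) (j.+1%:R)^-1 <= 1 + ln (J%:R) :> R.
Proof.
case: J => [|J]; first by rewrite big_ord0 ln0 // addr0.
apply: le_trans (harmonic_le R J).
by rewrite big_add1 /= big_mkord.
Qed.

(* On this block the sieving level is 2 ^ j. *)
Lemma prime_ap_block d j : (0 < d)%N ->
  \sum_(2 ^ (8 * j) <= m < 2 ^ (8 * j.+1) | prime (d * m + 1)) ((d * m + 1)%N%:R)^-1
   <= 2049 / (totient d)%:R * (j.+1%:R)^-1 :> R.
Proof.
move=> d0.
have t0 : (0 < totient d)%N by rewrite totient_gt0.
have d0r : 0 < d%:R :> R by rewrite ltr0n.
have p0 k : 0 < (2 ^ k)%N%:R :> R by rewrite ltr0n expn_gt0.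
apply: (@le_trans _ _ ((d%:R * (2 ^ (8 * j))%N%:R)^-1 *
   (\sum_(m < 2 ^ (8 * j.+1) | prime (d * m + 1) && (2 ^ j < d * m + 1)%N) 1)%:R)).
  rewrite natr_sum mulr_sumr.
  rewrite -(big_mkord (fun m => prime (d * m + 1) && (2 ^ j < d * m + 1)%N) (fun=> _ * 1)) /=.
  rewrite [leRHS](big_cat_nat (n := 2 ^ (8 * j))) //=; last by rewrite leq_pexp2l //; lia.
  apply: ler_wpDl; first by apply: sumr_ge0 => i _; rewrite mulr1 invr_ge0 mulr_ge0.
  rewrite big_nat_cond [leRHS]big_nat_cond.
  apply: (@le_trans _ _ (\sum_(2 ^ (8 * j) <= i < 2 ^ (8 * j.+1) |
     (2 ^ (8 * j) <= i < 2 ^ (8 * j.+1))%N && (prime (d * i + 1) && (2 ^ j < d * i + 1)%N))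
       ((d * i + 1)%N%:R)^-1)).
    rewrite le_eqVlt; apply/orP; left; apply/eqP; apply: eq_bigl => m.
    case: (boolP (2 ^ (8 * j) <= m < _)%N) => //= /andP[mj _].
    have : (2 ^ j <= 2 ^ (8 * j))%N by rewrite leq_pexp2l //; lia.
    case: (prime _) => //= h; apply/esym; nia.
  apply: ler_sum => m /andP[/andP[mj _] _].
  rewrite mulr1 lef_pV2 ?posrE ?mulr_gt0 // ?ltr0n ?addn1 //.
  by rewrite -natrM ler_nat; nia.
apply: le_trans (ler_wpM2l _ (prime_count_ap _ _ d0)) _; rewrite ?expn_gt0 //.
  by rewrite invr_ge0 mulr_ge0 // ltW.
have lnj : 4^-1 * j.+1%:R <= ln (2 ^ j).+1%:R :> R.
  have h2 := ln2_ge.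
  have a1 : ln 2 <= ln (2 ^ j).+1%:R :> R.
    by rewrite ler_ln ?posrE ?ltr0n // ler_nat ltnS expn_gt0.
  have a2 : j%:R * ln 2 <= ln (2 ^ j).+1%:R :> R.
    rewrite mulr_natl -lnXn // ler_ln ?posrE ?exprn_gt0 ?ltr0n //.
    by rewrite -natrX ler_nat.
  rewrite -[j.+1]addn1 natrD; have j0 : 0 <= j%:R :> R by [].
  move: (ln (2 ^ j).+1%:R) (ln 2) (j%:R : R) h2 a1 a2 j0 => L l x h2 a1 a2 x0.
  by have := ler_wpM2l x0 h2; lra.
have t0r : 0 < (totient d)%:R :> R by rewrite ltr0n.
have td : (totient d)%:R <= d%:R :> R by rewrite ler_nat totient_leq //.
have j0 : 0 < j.+1%:R :> R by rewrite ltr0n.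
have e8 : (2 ^ (8 * j.+1))%N%:R = 256 * (2 ^ (8 * j))%N%:R :> R.
  by rewrite -natrM mulnS expnD.
have e4 : (2 ^ j)%N%:R ^+ 4 = (2 ^ (4 * j))%N%:R :> R by rewrite -natrX mulnC expnM.
have e84 : (2 ^ (8 * j))%N%:R = (2 ^ (4 * j))%N%:R * (2 ^ (4 * j))%N%:R :> R.
  by rewrite -natrM -expnD; congr (2 ^ _)%N%:R; lia.
have j4 : j.+1%:R <= (2 ^ (4 * j))%N%:R :> R.
  rewrite ler_nat; apply: leq_trans (ltn_expl j (isT : 1 < 2)%N) _.
  by rewrite leq_pexp2l //; lia.
rewrite e8 e4 e84.
move: (p0 (4 * j)%N) j4; move: ((2 ^ (4 * j))%N%:R : R) => P P0 j4.
have L0 : 0 < ln (2 ^ j).+1%:R :> R by apply: lt_le_trans lnj; rewrite mulr_gt0 ?invr_gt0.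
move: L0 lnj; move: (ln (2 ^ j).+1%:R : R) (j.+1%:R : R) j0 j4 => L x x0 xP L0 xL.
move: ((totient d)%:R : R) (d%:R : R) t0r td d0r => t D t0r td D0.
(* With P = 2^(4j), the block starts at P^2 and ends at 256 P^2, and the sieve error is P. The
   logarithm of the level is at least (j + 1) / 4, so the main part is at most 2048 / (t x); the
   error adds the last unit of 2049. *)
have -> : (D * (P * P))^-1 * (256 * (P * P) * (2 * (D / t)) / L + P) =
   512 / (t * L) + (D * P)^-1 by field; rewrite !gt_eqF.
have a1 : 512 / (t * L) <= 2048 / (t * x).
  rewrite ler_pdivrMr ?mulr_gt0 // mulrAC ler_pdivlMr ?mulr_gt0 //.
  by have := ler_wpM2l (ltW t0r) xL; nra.
have a2 : (D * P)^-1 <= (t * x)^-1.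
  by rewrite lef_pV2 ?posrE ?mulr_gt0 //; apply: ler_pM => //; exact: ltW.
have -> : 2049 / t / x = 2048 / (t * x) + (t * x)^-1 by field; do ?[apply/andP; split]; rewrite gt_eqF.
exact: lerD.
Qed.

(** A form of log log N that never drops below 1, so that it absorbs constants. *)
Definition loglog1 (N : nat) : R := 1 + ln (1 + ln N%:R).

(** With p = d m + 1, the j-th block of values of m contributes like 1 / (j + 1), and about log N
    blocks suffice, whence the iterated logarithm. Cutting the range of m instead of that of p makes
    the bound uniform in d, even for d close to N. *)
Lemma sum_inv_prime_ap N d : (0 < N)%N -> (0 < d)%N ->
  \sum_(1 <= p < N.+1 | prime p && (d %| p.-1)%N) p%:R^-1
    <= 4098 * loglog1 N / (totient d)%:R :> R.
Proof.
move=> N0 d0; set J := (trunc_log 2 N).+1.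
have NJ : (N < 2 ^ J)%N by apply: trunc_log_ltn.
have J8 : (2 ^ J <= 2 ^ (8 * J))%N by rewrite leq_pexp2l //; lia.
have t0r : 0 < (totient d)%:R :> R by rewrite ltr0n totient_gt0.
apply: (@le_trans _ _ (\sum_(m < 2 ^ (8 * J) | (0 < m)%N && prime (d * m + 1)) ((d * m + 1)%N%:R)^-1)).
  apply: (ler_sum_fiber (f := fun m : 'I_(2 ^ (8 * J)) => (d * m + 1)%N) (F := fun n => n%:R^-1)).
    by move=> n; rewrite invr_ge0.
  move=> p /andP[p0 pN] /andP[pp /dvdnP[m e]].
  have p1 := prime_gt1 pp.
  have mJ : (m < 2 ^ (8 * J))%N by nia.
  exists (Ordinal mJ) => /=; last by nia.
  have -> : (d * m + 1 = p)%N by nia.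
  by rewrite pp andbT; nia.
apply: (@le_trans _ _ (\sum_(j < J) 2049 / (totient d)%:R * (j.+1%:R)^-1)).
  rewrite -(big_mkord (fun m => (0 < m)%N && prime (d * m + 1)) (fun m => (d * m + 1)%N%:R^-1)).
  elim: J {NJ J8} => [|J IH].
    by rewrite muln0 expn0 big_mkcond big_nat1 /= big_ord0.
  rewrite (big_cat_nat (n := 2 ^ (8 * J))) //=; last by rewrite leq_pexp2l //; lia.
  rewrite big_ord_recr /=; apply: lerD => //.
  apply: le_trans (prime_ap_block J d0).
  rewrite big_nat_cond [leRHS]big_nat_cond le_eqVlt; apply/orP; left; apply/eqP.
  apply: eq_bigl => m; case: (boolP (2 ^ (8 * J) <= m < _)%N) => //= /andP[h _].
  by have := expn_gt0 2 (8 * J); case: (m : nat) h => //; lia.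
rewrite -mulr_sumr; apply: le_trans (ler_wpM2l _ (harmonic_ord_le J)) _.
  by rewrite divr_ge0 // ltW.
have h2 := ln2_ge.
have lnN : 0 <= ln N%:R :> R by rewrite ln_ge0 // ler1n.
have JN : J%:R <= 2 * (1 + ln N%:R) :> R.
  have : ln ((2 ^ trunc_log 2 N)%N%:R) <= ln N%:R :> R.
    by rewrite ler_ln ?posrE ?ltr0n ?expn_gt0 // ler_nat trunc_logP.
  rewrite natrX lnXn // -[ln 2 *+ _]mulr_natl => h.
  have -> : J%:R = (trunc_log 2 N)%:R + 1 :> R by rewrite /J -[_.+1]addn1 natrD.
  have T0 : 0 <= (trunc_log 2 N)%:R :> R by [].
  move: (ln 2) h2 ((trunc_log 2 N)%:R : R) T0 h => l h2 T T0 h.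
  by have := ler_wpM2l T0 h2; lra.
have lJ : ln J%:R <= 1 + ln (1 + ln N%:R) :> R.
  apply: (@le_trans _ _ (ln (2 * (1 + ln N%:R)))).
    by rewrite ler_ln ?posrE ?ltr0n //; lra.
  rewrite lnM ?posrE //; last by lra.
  by rewrite lerD2r; have := @ln_sublinear R 2; have := @le_ln1Dx R 1; lra.
have l1 : 0 <= ln (1 + ln N%:R) :> R by rewrite ln_ge0; lra.
rewrite mulrAC; apply: ler_wpM2r; first by rewrite invr_ge0 ltW.
rewrite /loglog1; lra.
Qed.
End BrunTitchmarsh.

(** * Sums over divisors *)

Section DivisorSums.
Variable R : realType.

(** An Euler product bound for submultiplicative [f]: the part of m at its least prime is split off
    with the factor 1 + g p <= exp (g p). *)
Lemma sum_divisors_le (f g : nat -> R) m :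
  (forall n, 0 <= f n) -> f 1%N <= 1 ->
  (forall a b, (0 < a)%N -> (0 < b)%N -> coprime a b -> f (a * b)%N <= f a * f b) ->
  (forall p K, prime p -> \sum_(1 <= k < K.+1) f (p ^ k)%N <= g p) ->
  (0 < m)%N ->
  \sum_(d <- divisors m) f d <= expR (\sum_(p <- primes m) g p).
Proof.
move=> f0 f1 fM fg; elim: m {-2}m (leqnn m) => [|M IH] m mM m0.
  by move: m0; rewrite ltnNge mM.
have [m1|m1] := leqP m 1.
  have -> : m = 1%N by lia.
  by rewrite big_nil expR0 /divisors /= big_seq1.
have pp := pdiv_prime m1; have pm := pdiv_dvd m; set p := pdiv m in pp pm.
set k := logn p m; set m' := (m`_p^')%N.
have em : m = (p ^ k * m')%N by rewrite -p_part partnC.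
have m'0 : (0 < m')%N by apply: part_gt0.
have k0 : (0 < k)%N by rewrite logn_gt0 mem_primes pp m0.
have m'M : (m' <= M)%N.
  have : (p ^ 1 <= p ^ k)%N by rewrite leq_exp2l // prime_gt1.
  rewrite expn1 => h.
  by have := prime_gt1 pp; nia.
have g0 : 0 <= g p by apply: le_trans (fg p 0%N pp); rewrite big_geq.
apply: (@le_trans _ _ (\sum_(d <- [seq (p ^ i * d)%N | i <- iota 0 k.+1, d <- divisors m']) f d)).
  apply: ler_sum_subseq => [|d|d _]; [exact: divisors_uniq| |exact: f0].
  rewrite -dvdn_divisors // => dm; have d0 := dvdn_gt0 m0 dm.
  rewrite -(partnC p d0) p_part; apply: allpairs_f.
    rewrite mem_iota /= add0n ltnS; exact: dvdn_leq_log.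
  by rewrite -dvdn_divisors //; exact: partn_dvd.
rewrite big_allpairs_dep /=.
apply: (@le_trans _ _ ((1 + g p) * expR (\sum_(q <- primes m') g q))).
  apply: (@le_trans _ _ (\sum_(i <- iota 0 k.+1) f (p ^ i)%N * \sum_(d <- divisors m') f d)).
    apply: ler_sum => i _; rewrite mulr_sumr big_seq [leRHS]big_seq; apply: ler_sum => d.
    rewrite -dvdn_divisors // => dm'; apply: fM.
    - by rewrite expn_gt0 prime_gt0.
    - exact: dvdn_gt0 m'0 dm'.
    apply: coprime_dvdr dm' _; apply: coprimeXl; rewrite /m'.
    by have := coprime_partC p p m; rewrite part_pnat_id // pnat_id.
  rewrite -mulr_suml; apply: ler_pM => //.
  - exact: sumr_ge0.
  - exact: sumr_ge0.
  - have -> : iota 0 k.+1 = 0%N :: index_iota 1 k.+1 by rewrite /index_iota subn1.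
    by rewrite big_cons expn0; apply: lerD => //; exact: fg.
  - exact: IH.
have -> : \sum_(q <- primes m) g q = g p + \sum_(q <- primes m') g q.
  rewrite primes_part (bigD1_seq p) ?primes_uniq //=; last by rewrite mem_primes pp m0.
  by rewrite big_filter; congr (_ + _); apply: eq_bigl => q; rewrite inE /= inE.
rewrite expRD ler_wpM2r ?expR_ge0 //; exact: expR_ge1Dx.
Qed.

Lemma sum_geometric_le (r s : R) K : 0 <= r <= s -> s < 1 ->
  \sum_(1 <= k < K.+1) r ^+ k <= r / (1 - s).
Proof.
move=> /andP[r0 rs] s1.
suff -> : \sum_(1 <= k < K.+1) r ^+ k = r * (1 - r ^+ K) / (1 - r).
  rewrite ler_pdivrMr; last lra.
  rewrite mulrAC ler_pdivlMr; last lra.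
  have rK : 0 <= r ^+ K by rewrite exprn_ge0.
  rewrite -mulrA ler_wpM2l //; nra.
elim: K => [|K IH]; first by rewrite big_geq // expr0 subrr mulr0 mul0r.
by rewrite big_nat_recr //= IH exprS; field; rewrite subr_eq0 eq_sym lt_eqF //; lra.
Qed.

Lemma powR_expR (a x : R) : 0 < a -> a `^ x = expR (x * ln a).
Proof. by move=> a0; rewrite /powR gt_eqF. Qed.

(** The factor 1 / (1 - p^(- kappa)) of a geometric series at its worst prime p = 2. *)
Definition geom_const (kappa : R) : R := (1 - 2 `^ (- kappa))^-1.

Lemma powR2N_lt1 (kappa : R) : 0 < kappa -> 2 `^ (- kappa) < 1 :> R.
Proof.
move=> k0; rewrite powRN invf_lt1 ?powR_gt0 //.
by rewrite powR_expR // expR_gt1 mulr_gt0 // ln_gt0 // ltr1n.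
Qed.

Lemma geom_const_ge1 (kappa : R) : 0 < kappa -> 1 <= geom_const kappa.
Proof.
move=> /powR2N_lt1 h; have p := powR_gt0 (- kappa) (ltr0n R 2).
rewrite /geom_const -[leLHS]invr1 lef_pV2 ?posrE //; lra.
Qed.

Definition prime_power_sum (kappa : R) (m : nat) : R :=
  \sum_(p <- primes m) p%:R `^ (- kappa).

Lemma powRXn (p k : nat) (a : R) : (p ^ k)%N%:R `^ a = (p%:R `^ a) ^+ k.
Proof.
elim: k => [|k IH]; first by rewrite expn0 powR1.
by rewrite expnS natrM powRM // IH exprS.
Qed.

Lemma natpowN_le (kappa : R) (a b : nat) : 0 <= kappa -> (0 < a)%N -> (a <= b)%N ->
  b%:R `^ (- kappa) <= a%:R `^ (- kappa) :> R.
Proof.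
move=> k0 a0 ab; rewrite !powRN lef_pV2 ?posrE ?powR_gt0 ?ltr0n ?(leq_trans a0 ab) //.
by apply: ge0_ler_powR; rewrite ?nnegrE ?ler0n // ler_nat.
Qed.

Lemma sum_prime_powers_le (kappa : R) p K : 0 < kappa -> prime p ->
  \sum_(1 <= k < K.+1) (p ^ k)%N%:R `^ (- kappa) <= geom_const kappa * p%:R `^ (- kappa).
Proof.
move=> k0 pp; under eq_bigr do rewrite powRXn.
rewrite mulrC; apply: sum_geometric_le; last exact: powR2N_lt1.
by rewrite powR_ge0 /= natpowN_le // ?ltW // prime_gt1.
Qed.

Lemma sum_divisors_powR (kappa : R) m : 0 < kappa -> (0 < m)%N ->
  \sum_(d <- divisors m) d%:R `^ (- kappa)
    <= expR (geom_const kappa * prime_power_sum kappa m).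
Proof.
move=> k0 m0; rewrite /prime_power_sum mulr_sumr; apply: sum_divisors_le => //.
- by move=> n; apply: powR_ge0.
- by rewrite powR1.
- by move=> a b _ _ _; rewrite natrM powRM.
- by move=> p K pp; apply: sum_prime_powers_le.
Qed.

(** This is the sum left by [sum_inv_prime_ap] once gcd^(1 - kappa) is expanded over divisors d. The
    totient costs only the factor p / (p - 1) <= 2 at each prime power. *)
Lemma sum_divisors_totient (kappa : R) m : 0 < kappa -> (0 < m)%N ->
  \sum_(d <- divisors m) d%:R `^ (1 - kappa) / (totient d)%:R
    <= expR (2 * geom_const kappa * prime_power_sum kappa m).
Proof.
move=> k0 m0; rewrite /prime_power_sum mulr_sumr; apply: sum_divisors_le => //.
- by move=> n; apply: divr_ge0; rewrite ?powR_ge0.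
- by rewrite powR1 divr1.
- by move=> a b a0 b0 cab; rewrite totient_coprime // !natrM powRM // invfM mulrACA.
- move=> p K pp.
  have p0 : 0 < p%:R :> R by rewrite ltr0n prime_gt0.
  apply: le_trans (_ : 2 * \sum_(1 <= k < K.+1) (p ^ k)%N%:R `^ (- kappa) <= _); last first.
    by rewrite -mulrA ler_pM2l // sum_prime_powers_le.
  rewrite mulr_sumr big_nat_cond [leRHS]big_nat_cond; apply: ler_sum => k /andP[/andP[k1 _] _].
  rewrite totient_pfactor // powRD; last by rewrite natrX expf_neq0 ?implybT // gt_eqF.
  rewrite powRr1 // mulrAC ler_wpM2r ?powR_ge0 // ler_pdivrMr; last first.
    by rewrite ltr0n muln_gt0 expn_gt0 (prime_gt0 pp) -ltnS prednK ?prime_gt0 // prime_gt1.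
  rewrite -natrM ler_nat -{1}(prednK k1) expnS mulnA leq_mul2r; apply/orP; right.
  by have := prime_gt1 pp; lia.
Qed.

Lemma mertens_le N : (0 < N)%N ->
  \sum_(1 <= p < N.+1 | prime p) p%:R^-1 <= 4098 * loglog1 R N.
Proof.
move=> N0; have := sum_inv_prime_ap R N0 (isT : 0 < 1)%N; rewrite divr1.
by under eq_bigl do rewrite dvd1n andbT.
Qed.

Lemma sum_primes_powR (kappa : R) N : (0 < N)%N -> kappa <= 1 ->
  \sum_(1 <= p < N.+1 | prime p) p%:R `^ (- kappa)
    <= N%:R `^ (1 - kappa) * (4098 * loglog1 R N).
Proof.
move=> N0 k1; apply: le_trans (ler_wpM2l (powR_ge0 _ _) (mertens_le N0)).
rewrite mulr_sumr big_nat_cond [leRHS]big_nat_cond; apply: ler_sum => p /andP[/andP[p0 pN] _].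
have pp : 0 < p%:R :> R by rewrite ltr0n.
have -> : p%:R `^ (- kappa) = p%:R `^ (1 - kappa) / p%:R.
  by rewrite -[X in _ / X]powRr1 // -powRB ?(gt_eqF pp) ?implybT //; congr (_ `^ _); ring.
rewrite ler_wpM2r ?invr_ge0 //.
by apply: ge0_ler_powR; rewrite ?nnegrE ?ler0n ?subr_ge0 // ler_nat.
Qed.

Lemma exp2_num_primes m : (0 < m)%N -> (2 ^ size (primes m) <= m)%N.
Proof.
move=> m0; rewrite {2}(prod_prime_decomp m0) prime_decompE big_map.
have -> : (2 ^ size (primes m) = \prod_(p <- primes m) 2)%N.
  by rewrite big_const_seq count_predT iter_muln_1.
rewrite big_seq [leqRHS]big_seq; apply: leq_prod => p; rewrite mem_primes => /and3P[pp _ pd].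
have k0 : (0 < logn p m)%N by rewrite logn_gt0 mem_primes pp m0.
by rewrite /= -(prednK k0) expnS (leq_trans (prime_gt1 pp)) // leq_pmulr // expn_gt0 prime_gt0.
Qed.

(** Primes up to z cost a fixed amount whatever m is. The remaining sum is controlled later in two
    ways: by the number of primes of m, or by the definition of a good set. *)
Lemma prime_power_sum_le (kappa z : R) m : 0 < kappa -> kappa <= 1 -> 1 <= z -> (0 < m)%N ->
  prime_power_sum kappa m <=
    z `^ (1 - kappa) * (4098 * loglog1 R (Num.truncn z)) +
    \sum_(p <- primes m | z < p%:R) p%:R `^ (- kappa).
Proof.
move=> k0 k1 z1 m0; rewrite /prime_power_sum (bigID (fun p => p%:R <= z)) /=.
under [X in _ + X]eq_bigl do rewrite -ltNge.
rewrite lerD2r.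
have N0 : (0 < Num.truncn z)%N by rewrite truncn_gt0.
have z0 : 0 <= z by lra.
have l1 : 0 <= loglog1 R (Num.truncn z).
  rewrite /loglog1 addr_ge0 // ln_ge0 // lerDl ln_ge0 // ler1n //.
apply: le_trans (le_trans (sum_primes_powR N0 k1) _).
  rewrite -big_filter -[leRHS]big_filter; apply: ler_sum_subseq => [|p|p _].
  - by rewrite filter_uniq // primes_uniq.
  - rewrite !mem_filter mem_primes mem_index_iota => /andP[pz /and3P[pp _ _]].
    by rewrite pp prime_gt0 // ltnS truncn_ge_nat.
  - exact: powR_ge0.
apply: ler_wpM2r; first by rewrite mulr_ge0.
apply: ge0_ler_powR; rewrite ?nnegrE ?ler0n ?subr_ge0 //.
by rewrite truncn_le.
Qed.
End DivisorSums.

Lemma carmichael_gt0 n : (0 < carmichael n)%N.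
Proof. exact: exponent_gt0. Qed.

Lemma dvdn_expn_primes n Q N : (0 < n <= N)%N ->
  (forall p, prime p -> (p %| n)%N -> (p %| Q)%N) -> (n %| Q ^ N)%N.
Proof.
move=> /andP[n0 nN] H; apply/dvdn_partP => // p; rewrite mem_primes => /and3P[pp _ pn].
rewrite p_part; apply: dvdn_trans (dvdn_exp2r _ (H p pp pn)) _; apply: dvdn_exp2l.
apply: leq_trans nN; apply: leq_trans (ltnW (ltn_expl _ (prime_gt1 pp))) _.
by apply: dvdn_leq => //; exact: pfactor_dvdnn.
Qed.

(** * Upper bound for small y *)

Section Pomerance.
Variable R : realType.

(* Every n counted here divides a power of the product Q of the primes p with p - 1 | m. *)
Lemma sum_carmichael_fiber (kappa : R) N m : 0 < kappa -> (0 < m)%N ->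
  \sum_(1 <= n < N.+1 | carmichael n == m) n%:R `^ (- kappa)
    <= expR (geom_const kappa * expR (geom_const kappa * prime_power_sum kappa m)).
Proof.
move=> k0 m0; have c0 : 0 < geom_const kappa by apply: lt_le_trans (geom_const_ge1 k0).
pose qs := [seq p <- index_iota 1 N.+1 | prime p && (p.-1 %| m)%N].
have Q0 : (0 < \prod_(p <- qs) p)%N.
  rewrite big_seq; apply: prodn_cond_gt0 => p.
  by rewrite mem_filter => /andP[/andP[/prime_gt0]].
set Q := (\prod_(p <- qs) p)%N in Q0.
apply: (@le_trans _ _ (\sum_(d <- divisors (Q ^ N)) d%:R `^ (- kappa))).
  rewrite -big_filter; apply: ler_sum_subseq => [|n|n _]; last exact: powR_ge0.
    by rewrite filter_uniq // iota_uniq.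
  rewrite mem_filter mem_index_iota ltnS => /andP[/eqP en nN].
  rewrite -dvdn_divisors ?expn_gt0 ?Q0 //; apply: dvdn_expn_primes => // p pp pn.
  case/andP: nN => n0 nN.
  have pqs : p \in qs.
    rewrite mem_filter pp /= -en prime_pred_dvd_carmichael //= mem_index_iota prime_gt0 //=.
    by rewrite ltnS (leq_trans _ nN) // dvdn_leq.
  by rewrite /Q (big_rem p) //= dvdn_mulr.
apply: le_trans (sum_divisors_powR k0 _) _; first by rewrite expn_gt0 Q0.
rewrite ler_expR ler_pM2l //.
(* The second use of Rankin's trick: p maps to p - 1 injectively from the primes of Q to the
   divisors of m, which produces the double exponential. *)
apply: le_trans _ (sum_divisors_powR k0 m0).
apply: (@le_trans _ _ (\sum_(p <- primes (Q ^ N)) (p.-1)%:R `^ (- kappa))).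
  rewrite /prime_power_sum big_seq [leRHS]big_seq; apply: ler_sum => p.
  rewrite mem_primes => /and3P[pp _ _]; apply: natpowN_le; rewrite ?leq_pred ?ltW //.
  by rewrite -ltnS prednK ?prime_gt0 // prime_gt1.
rewrite -(big_map predn xpredT (fun n => n%:R `^ (- kappa))).
apply: ler_sum_subseq => [|d|d _]; last exact: powR_ge0.
  rewrite map_inj_in_uniq ?primes_uniq // => p q.
  by rewrite !mem_primes => /andP[/prime_gt0 p0 _] /andP[/prime_gt0 q0 _]; lia.
case/mapP => p; rewrite mem_primes => /and3P[pp _ pQ] ->.
have {}pQ : (p %| Q)%N by move: pQ; rewrite Euclid_dvdX // => /andP[].
move: pQ; rewrite /Q Euclid_dvd_prod // big_has => /hasP[q].
rewrite mem_filter => /andP[/andP[pq qm] _]; rewrite dvdn_prime2 // => /eqP ->.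
by rewrite -dvdn_divisors.
Qed.

(** Each n <= x is counted with weight (x / n)^kappa and grouped by m = [carmichael n]; the bound on
    a group does not depend on m, so the number of groups gives the factor y. *)
Lemma carmichael_count_small (x y kappa V : R) :
  0 < kappa -> 0 < x -> 0 <= y ->
  (forall m, (0 < m)%N -> m%:R <= y -> prime_power_sum kappa m <= V) ->
  (carmichael_count x y)%:R <=
    y * x `^ kappa * expR (geom_const kappa * expR (geom_const kappa * V)).
Proof.
move=> k0 x0 y0 HV.
have c0 : 0 < geom_const kappa by apply: lt_le_trans (geom_const_ge1 k0).
set N := Num.truncn x; set Y := Num.truncn y.
have xk : 0 < x `^ kappa by rewrite powR_gt0.
apply: (@le_trans _ _ (\sum_(1 <= n < N.+1) \sum_(1 <= m < Y.+1 | carmichael n == m)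
    x `^ kappa * n%:R `^ (- kappa))).
  rewrite /carmichael_count -/N natr_sum big_mkcond /= big_nat [leRHS]big_nat.
  apply: ler_sum => n /andP[n0 nN]; case: ifP => [ny|_]; last first.
    by apply: sumr_ge0 => m _; rewrite mulr_ge0 ?powR_ge0.
  rewrite (big_rem (carmichael n)) ?eqxx /=; last first.
    by rewrite mem_index_iota carmichael_gt0 ltnS truncn_ge_nat.
  rewrite ler_wpDr //; first by apply: sumr_ge0 => m _; rewrite mulr_ge0 ?powR_ge0.
  have nr : 0 < n%:R :> R by rewrite ltr0n.
  rewrite powRN ler_pdivlMr ?powR_gt0 // mul1r.
  apply: ge0_ler_powR; rewrite ?nnegrE ?ler0n ?(ltW x0) ?(ltW k0) //.
  by rewrite -truncn_ge_nat // ltW.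
rewrite (exchange_big_dep_nat xpredT) //=.
apply: (@le_trans _ _ (\sum_(1 <= m < Y.+1) x `^ kappa *
   expR (geom_const kappa * expR (geom_const kappa * V)))).
  rewrite big_nat [leRHS]big_nat; apply: ler_sum => m /andP[m0 mY].
  rewrite -mulr_sumr; apply: ler_wpM2l; first exact: ltW.
  apply: le_trans (sum_carmichael_fiber N k0 m0) _.
  rewrite ler_expR ler_pM2l // ler_expR ler_pM2l //.
  by apply: HV => //; rewrite -truncn_ge_nat.
rewrite sumr_const_nat subSS subn0 -[leLHS]mulr_natl -mulrA.
apply: ler_wpM2r; last by rewrite truncn_le.
by rewrite mulr_ge0 ?expR_ge0 // ltW.
Qed.
End Pomerance.

Lemma prime_pred_gt0 p : prime p -> (0 < p.-1)%N.
Proof. by move=> pp; rewrite -ltnS prednK ?prime_gt0 // prime_gt1. Qed.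

(** * Weighted sums over sets of primes *)

Section Expansion.
Variable R : realType.

Lemma sum_expR_le (M : R) n : 0 <= M -> \sum_(k < n) M ^+ k / k`!%:R <= expR M.
Proof.
move=> M0; rewrite -(big_mkord xpredT (fun k => M ^+ k / k`!%:R)).
apply: (nondecreasing_cvgn_le (u_ := series (exp_coeff M))).
  apply: nondecreasing_series => k _ _; exact: exp_coeff_ge0.
exact: is_cvg_series_exp_coeff.
Qed.

Lemma expR_le_1D2x (u : R) : 0 <= u <= 2^-1 -> expR u <= 1 + 2 * u.
Proof.
move=> /andP[u0 u1]; have h := expR_ge1Dx (- u); have e0 := expR_gt0 u.
rewrite expRN in h.
have h2 : expR u * (1 - u) <= 1.
  by have := ler_wpM2l (ltW e0) h; rewrite mulfV // gt_eqF.
nra.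
Qed.

Lemma prod1D_le_expR (I : finType) (A : {set I}) (f : I -> R) :
  (forall i, i \in A -> 0 <= f i) -> \prod_(i in A) (1 + f i) <= expR (\sum_(i in A) f i).
Proof.
move=> f0; rewrite expR_sum; apply: ler_prod => i iA.
by rewrite addr_ge0 ?f0 //= expR_ge1Dx.
Qed.

(** The comparison of the sum of n^(-3/2) with its integral, put in telescoping form. *)
Lemma sqrt_tail_step (n : nat) : (0 < n)%N ->
  (n.+1%:R * Num.sqrt n.+1%:R)^-1 <= 2 / Num.sqrt n%:R - 2 / Num.sqrt n.+1%:R :> R.
Proof.
move=> n0.
have a0 : 0 < Num.sqrt n%:R :> R by rewrite sqrtr_gt0 ltr0n.
have b0 : 0 < Num.sqrt n.+1%:R :> R by rewrite sqrtr_gt0 ltr0n.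
have ea : Num.sqrt n%:R ^+ 2 = n%:R :> R by rewrite sqr_sqrtr.
have eb : Num.sqrt n.+1%:R ^+ 2 = n.+1%:R :> R by rewrite sqr_sqrtr.
have eab : n.+1%:R = n%:R + 1 :> R by rewrite -[n.+1]addn1 natrD.
move: a0 b0 ea eb; move: (Num.sqrt n%:R : R) (Num.sqrt n.+1%:R : R) => a b a0 b0 ea eb.
rewrite -eb; have {eab ea}eb : b ^+ 2 = a ^+ 2 + 1 by rewrite eb eab ea.
have ab0 := addr_gt0 a0 b0.
have ab : a <= b by nra.
have -> : 2 / a - 2 / b = 2 / (a + b) / (a * b).
  have -> : 2 / a - 2 / b = 2 * (b - a) / (a * b) by field; rewrite !gt_eqF.
  congr (_ / _); apply: (mulIf (lt0r_neq0 ab0)); rewrite divfK ?lt0r_neq0 //; nra.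
rewrite -mulrA -invfM ler_pdivlMr ?mulr_gt0 // mulrC ler_pdivrMr ?mulr_gt0 ?exprn_gt0 //.
have h1 : (a + b) * a <= (b + b) * b by apply: ler_pM; lra.
have := ler_wpM2r (ltW b0) h1; lra.
Qed.

Lemma sum_sqrt_tail (Z N : nat) : (0 < Z)%N ->
  \sum_(Z.+1 <= n < N.+1) (n%:R * Num.sqrt n%:R)^-1 <= 2 / Num.sqrt Z%:R :> R.
Proof.
move=> Z0; have s0 n : 0 <= 2 / Num.sqrt n%:R :> R by rewrite divr_ge0 ?sqrtr_ge0.
have [ZN|NZ] := leqP Z N; last by rewrite big_geq // ltnW.
suff: \sum_(Z.+1 <= n < N.+1) (n%:R * Num.sqrt n%:R)^-1 <=
   2 / Num.sqrt Z%:R - 2 / Num.sqrt N%:R :> R.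
  by move/le_trans; apply; rewrite gerBl.
rewrite -(subnKC ZN); elim: (N - Z)%N => [|k IH]; first by rewrite addn0 big_geq // subrr.
rewrite addnS big_nat_recr /=; last by rewrite ltnS leq_addr.
apply: le_trans (lerD IH (sqrt_tail_step _)) _; first lia.
lra.
Qed.
End Expansion.

Section PrimeSetWeights.
Variables (R : realType) (N : nat) (kappa z : R).
Hypotheses (N0 : (0 < N)%N) (k2 : 2^-1 <= kappa) (k1 : kappa < 1) (z1 : 1 <= z).
Notation T := 'I_N.+1.
Implicit Types A B D : {set T}.

Definition rough_sum (m : nat) : R := \sum_(p <- primes m | z < p%:R) p%:R `^ (- kappa).

Definition lcm_pred A : nat := \big[lcmn/1%N]_(p in A) (p : nat).-1.

Lemma kappa_gt0 : 0 < kappa. Proof. by apply: lt_le_trans k2; rewrite invr_gt0. Qed.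
Let k0 := kappa_gt0.

Lemma rough_sumS m m' : (0 < m')%N -> (m %| m')%N -> rough_sum m <= rough_sum m'.
Proof.
move=> m'0 mm'; rewrite /rough_sum -big_filter -[leRHS]big_filter.
apply: ler_sum_subseq => [|p|p _]; last exact: powR_ge0.
  by rewrite filter_uniq // primes_uniq.
rewrite !mem_filter !mem_primes => /andP[-> /and3P[-> _ pm]].
by rewrite m'0 (dvdn_trans pm).
Qed.

Lemma rough_sum_lcm a b : (0 < a)%N -> (0 < b)%N ->
  rough_sum (lcmn a b) <= rough_sum a + rough_sum b.
Proof.
move=> a0 b0; rewrite /rough_sum -[leLHS]big_filter -[X in _ <= X + _]big_filter.
rewrite -[X in _ <= _ + X]big_filter -big_cat.
apply: ler_sum_subseq => [|p|p _]; last exact: powR_ge0.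
  by rewrite filter_uniq // primes_uniq.
rewrite mem_cat !mem_filter !mem_primes => /andP[-> /and3P[pp _ pm]].
rewrite pp a0 b0 /=; rewrite -Euclid_dvdM //; apply: dvdn_trans pm _.
by rewrite -muln_lcm_gcd dvdn_mulr.
Qed.

Lemma lcm_pred_gt0 A : prime_set A -> (0 < lcm_pred A)%N.
Proof.
move=> /prime_setP pA; rewrite /lcm_pred; apply: (big_ind (fun m => 0 < m)%N) => // [a b|p /pA].
  by rewrite lcmn_gt0 => -> ->.
exact: prime_pred_gt0.
Qed.

Lemma lcm_pred_dvd A m : (forall p, p \in A -> (p.-1 %| m)%N) -> (lcm_pred A %| m)%N.
Proof.
move=> H; rewrite /lcm_pred; apply: (big_ind (fun d => d %| m)%N) => // a b.
by rewrite dvdn_lcm => -> ->.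
Qed.

Lemma lcm_predD1 A p : p \in A -> lcm_pred A = lcmn p.-1 (lcm_pred (A :\ p)).
Proof. by move=> pA; rewrite /lcm_pred (big_setD1 p). Qed.

Lemma rough_sum_lcm_pred A : prime_set A ->
  rough_sum (lcm_pred A) <= \sum_(p in A) rough_sum p.-1.
Proof.
move=> /prime_setP pA; rewrite /lcm_pred.
suff : (0 < \big[lcmn/1%N]_(p in A) (p : nat).-1)%N /\
   rough_sum (\big[lcmn/1%N]_(p in A) (p : nat).-1) <= \sum_(p in A) rough_sum p.-1 by case.
apply: (big_rec2 (fun m s => (0 < m)%N /\ rough_sum m <= s)).
  by split => //; rewrite /rough_sum big_nil.
move=> p s m pinA [m0 h]; have p0 := prime_pred_gt0 (pA _ pinA).
split; first by rewrite lcmn_gt0 p0.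
by apply: le_trans (rough_sum_lcm p0 m0) _; rewrite lerD2l.
Qed.

(** The Rankin factor (x / a)^kappa (y / lam A)^(1 - kappa), for a = [prodn A] and lam A =
    [lcm_pred A], stripped of its powers of x and y. *)
Definition weight A : R := (prodn A)%:R `^ (- kappa) * (lcm_pred A)%:R `^ (kappa - 1).

Definition good_sets : {set {set T}} :=
  [set A | prime_set A && (rough_sum (lcm_pred A) <= 1)].

(** This closure under removal is what allows the sum over good sets to be bounded recursively on
    their size. *)
Lemma good_setsD1 A p : A \in good_sets -> p \in A -> A :\ p \in good_sets.
Proof.
rewrite !inE => /andP[pA gA] pinA; rewrite prime_setD1 //=; apply: le_trans gA.
apply: rough_sumS; first exact: lcm_pred_gt0.
by rewrite (lcm_predD1 pinA) dvdn_lcmr.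
Qed.

(* Cost of adjoining the prime p to B; see [weightD1]. *)
Definition branch B (p : T) : R := 2 / p%:R * (gcdn (lcm_pred B) p.-1)%:R `^ (1 - kappa).

(** Since lcm (p - 1, L) gcd (p - 1, L) = (p - 1) L, adjoining p multiplies the weight by p^(-
    kappa) (p - 1)^(kappa - 1) gcd^(1 - kappa), and p <= 2 (p - 1) bounds the first two factors by 2
    / p. *)
Lemma weightD1 A p : prime_set A -> p \in A ->
  weight A <= weight (A :\ p) * branch (A :\ p) p.
Proof.
move=> pA pinA; have pD := prime_setD1 p pA.
have pp : prime p by move/prime_setP: pA; apply.
rewrite /weight (lcm_predD1 pinA) /branch; set B := A :\ p in pD *.
have L0 := lcm_pred_gt0 pD; have P0 := prodn_gt0 pD; have q0 := prime_pred_gt0 pp.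
have p0 := prime_gt0 pp.
have -> : prodn A = (p * prodn B)%N by rewrite /prodn (big_setD1 p).
set L := lcm_pred B in L0 *; set g := gcdn L p.-1.
have g0 : (0 < g)%N by rewrite gcdn_gt0 L0.
have e : (lcmn p.-1 L * g = p.-1 * L)%N by rewrite /g gcdnC muln_lcm_gcd.
have l0 : (0 < lcmn p.-1 L)%N by rewrite lcmn_gt0 q0.
have el : (lcmn p.-1 L)%:R `^ (kappa - 1) =
   (p.-1)%:R `^ (kappa - 1) * L%:R `^ (kappa - 1) * g%:R `^ (1 - kappa) :> R.
  have -> : 1 - kappa = - (kappa - 1) by ring.
  have gk : g%:R `^ (kappa - 1) != 0 :> R by rewrite gt_eqF // powR_gt0 // ltr0n.
  rewrite [_ `^ (- _)]powRN; apply: (mulIf gk); rewrite divfK //.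
  by rewrite -!powRM ?ler0n // -!natrM e.
rewrite el natrM powRM //.
set a := p%:R `^ _; set b := (prodn B)%:R `^ _; set c := (p.-1)%:R `^ _.
set u := L%:R `^ _; set v := g%:R `^ _.
have v0 : 0 <= v by apply: powR_ge0.
have u0 : 0 <= u by apply: powR_ge0.
have b0 : 0 <= b by apply: powR_ge0.
suff h : a * c <= 2 / p%:R.
  have -> : a * b * (c * u * v) = (a * c) * (b * u * v) by ring.
  have -> : b * u * (2 / p%:R * v) = 2 / p%:R * (b * u * v) by ring.
  by apply: ler_wpM2r => //; rewrite !mulr_ge0.
have pr : 0 < p%:R :> R by rewrite ltr0n.
have qr : 0 < (p.-1)%:R :> R by rewrite ltr0n.
have -> : a = (p%:R `^ (1 - kappa)) / p%:R.
  by rewrite -[X in _ / X]powRr1 // -powRB ?(gt_eqF pr) ?implybT //; congr (_ `^ _); ring.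
rewrite mulrAC; apply: ler_wpM2r; first by rewrite invr_ge0 ltW.
have -> : c = (p.-1%:R `^ (1 - kappa))^-1 by rewrite -powRN; congr (_ `^ _); ring.
rewrite ler_pdivrMr ?powR_gt0 //.
apply: (@le_trans _ _ ((2 * p.-1%:R) `^ (1 - kappa))).
  apply: ge0_ler_powR; rewrite ?nnegrE ?mulr_ge0 ?ler0n //; first by rewrite subr_ge0 ltW.
  by rewrite -natrM ler_nat mul2n -addnn; move: q0; case: (p : nat) => //= n n0; rewrite -addn1 leq_add2l.
rewrite powRM ?ler0n // ler_wpM2r ?powR_ge0 //.
rewrite -[leRHS]powRr1 //; apply: ler_powR; rewrite ?ler1n // gerBl (ltW k0) //.
Qed.

(** The gcd is one of the divisors d of L that divide p - 1, so its power is at most the sum of d^(1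
    - kappa) over all of these. Exchanging the sums leaves primes in the progressions 1 mod d;
    goodness of B bounds the primes of L above z by the final + 1. *)
Lemma sum_branch B : B \in good_sets ->
  \sum_(p : T | prime p) branch B p <= 2 * (4098 * loglog1 R N) *
    expR (2 * geom_const kappa * (z `^ (1 - kappa) * (4098 * loglog1 R (Num.truncn z)) + 1)).
Proof.
rewrite inE => /andP[pB gB]; have L0 := lcm_pred_gt0 pB; set L := lcm_pred B in L0 gB *.
have l1 : 0 <= loglog1 R N.
  rewrite /loglog1 addr_ge0 // ln_ge0 // lerDl ln_ge0 // ler1n //.
apply: (@le_trans _ _ (\sum_(1 <= p < N.+1 | prime p)
   2 * \sum_(d <- divisors L | (d %| p.-1)%N) d%:R `^ (1 - kappa) * p%:R^-1)).
  have -> : \sum_(p : T | prime p) branch B p =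
     \sum_(1 <= p < N.+1 | prime p) 2 / p%:R * (gcdn L p.-1)%:R `^ (1 - kappa).
    rewrite -(big_mkord (fun p => prime p) (fun p => 2 / p%:R * (gcdn L p.-1)%:R `^ (1 - kappa))).
    by rewrite big_ltn_cond.
  rewrite big_nat_cond [leRHS]big_nat_cond; apply: ler_sum => p /andP[/andP[p0 _] pp].
  have gd : gcdn L p.-1 \in divisors L by rewrite -dvdn_divisors // dvdn_gcdl.
  rewrite (big_rem _ gd) dvdn_gcdr /= mulrDr ler_wpDr //.
    by rewrite mulr_ge0 // sumr_ge0 // => i _; rewrite mulr_ge0 ?powR_ge0 ?invr_ge0.
  by rewrite -mulrA ler_wpM2l // mulrC.
rewrite -mulr_sumr (exchange_big_dep predT) //= -!mulrA ler_wpM2l //.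
apply: (@le_trans _ _ (\sum_(d <- divisors L) (4098 * loglog1 R N) * (d%:R `^ (1 - kappa) / (totient d)%:R))).
  rewrite big_seq [leRHS]big_seq; apply: ler_sum => d; rewrite -dvdn_divisors // => dL.
  have d0 := dvdn_gt0 L0 dL.
  rewrite -mulr_sumr mulrCA; apply: ler_wpM2l; first exact: powR_ge0.
  exact: sum_inv_prime_ap.
rewrite -mulr_sumr -mulrA ler_wpM2l // ler_wpM2l //.
apply: le_trans (sum_divisors_totient k0 L0) _.
rewrite ler_expR mulrA ler_wpM2l //; first by rewrite mulr_ge0 // (le_trans ler01) // geom_const_ge1.
apply: le_trans (prime_power_sum_le k0 (ltW k1) z1 L0) _.
by rewrite lerD2l.
Qed.
End PrimeSetWeights.

Lemma loglog1_ge1 (R : realType) N : (0 < N)%N -> 1 <= loglog1 R N.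
Proof. by move=> N0; rewrite lerDl ln_ge0 // lerDl ln_ge0 // ler1n. Qed.

Section PrimeSetWeightSums.
Variables (R : realType) (N : nat) (kappa z : R).
Hypotheses (N0 : (0 < N)%N) (k2 : 2^-1 <= kappa) (k1 : kappa < 1) (z1 : 1 <= z).
Notation T := 'I_N.+1.
Implicit Types A B D : {set T}.

Definition branch_bound : R := 2 * (4098 * loglog1 R N) *
    expR (2 * geom_const kappa * (z `^ (1 - kappa) * (4098 * loglog1 R (Num.truncn z)) + 1)).

Lemma branch_bound_ge0 : 0 <= branch_bound.
Proof.
have := loglog1_ge1 R N0 => h.
by rewrite mulr_ge0 ?expR_ge0 // mulr_ge0 // mulr_ge0 // (le_trans ler01).
Qed.

Definition weight_card k : R := \sum_(A in good_sets N kappa z | #|A| == k) weight kappa A.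

Lemma weight_ge0 A : 0 <= weight kappa A.
Proof. by rewrite mulr_ge0 ?powR_ge0. Qed.

(* Each set of k + 1 primes arises k + 1 times as B with one prime adjoined. *)
Lemma weight_card_step k : k.+1%:R * weight_card k.+1 <= branch_bound * weight_card k.
Proof.
pose F (J : {set T} * T) := weight kappa J.1 * branch kappa J.1 J.2.
pose P (J : {set T} * T) := [&& J.1 \in good_sets N kappa z, #|J.1| == k.+1 & J.2 \in J.1].
pose Q (J : {set T} * T) := ((J.1 \in good_sets N kappa z) && (#|J.1| == k)) && prime J.2.
pose h (J : {set T} * T) := (J.1 :\ J.2, J.2).
have good A : A \in good_sets N kappa z -> prime_set A by rewrite inE => /andP[].
apply: (@le_trans _ _ (\sum_(J | P J) F (h J))).
  rewrite /weight_card mulr_sumr.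
  apply: (@le_trans _ _ (\sum_(A in good_sets N kappa z | #|A| == k.+1)
     \sum_(p in A) F (h (A, p)))).
    apply: ler_sum => A /andP[Ag /eqP cA].
    rewrite -cA mulr_natl -sumr_const; apply: ler_sum => p pA.
    exact: weightD1 (good _ Ag) pA.
  rewrite pair_big_dep /= le_eqVlt; apply/orP; left; apply/eqP.
  by apply: eq_big => -[A p] /=; rewrite /P ?andbA.
apply: (@le_trans _ _ (\sum_(J | Q J) F J)).
  apply: ler_sum_inj.
  - move=> [A p] [B q] /and3P[/= _ _ pA] /and3P[/= _ _ qB] [e1 e2].
    by rewrite -(setD1K pA) -(setD1K qB) e1 e2.
  - move=> [A p] /and3P[/= Ag /eqP cA pA]; rewrite /Q /= good_setsD1 //=.
    move: cA; rewrite (cardsD1 p) pA add1n => -[->]; rewrite eqxx /=.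
    by move/prime_setP: (good _ Ag); apply.
  - by move=> [A p] _; rewrite mulr_ge0 ?weight_ge0 // mulr_ge0 ?powR_ge0 // divr_ge0.
rewrite /Q -(pair_big_dep (fun B : {set T} => (B \in good_sets N kappa z) && (#|B| == k))
   (fun _ (p : T) => prime p) (fun (B : {set T}) (p : T) => weight kappa B * branch kappa B p)) /=.
rewrite /weight_card mulr_sumr; apply: ler_sum => B /andP[Bg _].
rewrite -mulr_sumr mulrC ler_wpM2r ?weight_ge0 //.
exact: sum_branch.
Qed.

Lemma weight_card_le k : weight_card k <= branch_bound ^+ k / k`!%:R.
Proof.
elim: k => [|k IH].
  rewrite expr0 fact0 divr1 /weight_card.
  apply: (@le_trans _ _ (\sum_(A | A == set0 :> {set T}) weight kappa A)).
    apply: (ler_sum_inj (h := id)) => [A B _ _ //|A /andP[_]|A _]; last exact: weight_ge0.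
    by rewrite cards_eq0.
  by rewrite big_pred1_eq /weight /prodn /lcm_pred !big_set0 !powR1 mul1r.
have f0 : 0 < k`!%:R :> R by rewrite ltr0n fact_gt0.
have k0 : 0 < k.+1%:R :> R by rewrite ltr0n.
rewrite factS natrM invfM mulrA mulrAC ler_pdivlMr // mulrC.
apply: le_trans (weight_card_step k) _.
rewrite [_ ^+ k.+1 / _](_ : _ = branch_bound * (branch_bound ^+ k / k`!%:R)); last by rewrite exprS mulrA.
by apply: ler_wpM2l => //; exact: branch_bound_ge0.
Qed.

Lemma sum_good_weight :
  \sum_(A in good_sets N kappa z) weight kappa A <= expR branch_bound.
Proof.
apply: le_trans (sum_expR_le N.+2 branch_bound_ge0).
apply: (@le_trans _ _ (\sum_(k < N.+2) weight_card k)).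
  rewrite le_eqVlt; apply/orP; left; apply/eqP.
  rewrite /weight_card (exchange_big_dep (mem (good_sets N kappa z))) /=; last first.
    by move=> i A _ /andP[].
  apply: eq_bigr => A Ag.
  have cA : (#|A| < N.+2)%N by rewrite ltnS -[X in (_ <= X)%N](card_ord N.+1) max_card.
  by rewrite (big_pred1 (Ordinal cA)) // => i; rewrite Ag /= eq_sym -val_eqE.
by apply: ler_sum => k _; apply: weight_card_le.
Qed.

(* The factor 1 / 2 keeps the exponents t q^(- kappa) below 1 / 2 for q > z, where exp u <= 1 + 2 u. *)
Local Notation t := (z `^ kappa / 2).
Let g (q : nat) : R := expR (t * q%:R `^ (- kappa)) - 1.
Let Q0 : {set T} := [set q : T | prime q && (z < q%:R)].
Let t0 : 0 <= t. Proof. by rewrite divr_ge0 ?powR_ge0. Qed.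
Let k0 : 0 < kappa. Proof. exact: kappa_gt0. Qed.
Let z0 : 0 < z. Proof. exact: lt_le_trans z1. Qed.

Lemma expR_rough_sub1_ge0 q : 0 <= g q.
Proof.
rewrite subr_ge0; apply: le_trans (expR_ge1Dx _).
by rewrite lerDl mulr_ge0 ?powR_ge0 // t0.
Qed.

Lemma prime_set_Q0 D : D \subset Q0 -> prime_set D.
Proof. by move=> /subsetP DQ; apply/prime_setP => p /DQ; rewrite inE => /andP[]. Qed.

(** The exponential of an additive function is multiplicative, hence expands over the squarefree
    divisors of m built from primes above z. This reduces an exponential moment to counting primes p
    with [prodn D] dividing p - 1. *)
Lemma expR_rough_sum m : (0 < m <= N)%N ->
  expR (t * rough_sum kappa z m) <=
    \sum_(D : {set T} | (D \subset Q0) && (prodn D %| m)%N) \prod_(q in D) g q.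
Proof.
move=> /andP[m0 mN]; pose Qm := [set q in Q0 | (q %| m)%N].
have -> : \sum_(D : {set T} | (D \subset Q0) && (prodn D %| m)%N) \prod_(q in D) g q =
   \prod_(q in Qm) (1 + g q).
  rewrite prod1D_subsets; apply: eq_bigl => D.
  apply/andP/subsetP => [[DQ Dm] p pD|DQm].
    rewrite inE (subsetP DQ) //=; move: Dm; rewrite prodn_dvd ?prime_set_Q0 //.
    by move/'forall_implyP; apply.
  have DQ : D \subset Q0 by apply/subsetP => p /DQm; rewrite inE => /andP[].
  split => //; rewrite prodn_dvd ?prime_set_Q0 //; apply/'forall_implyP => p /DQm.
  by rewrite inE => /andP[].
have -> : \prod_(q in Qm) (1 + g q) = expR (t * \sum_(q in Qm) q%:R `^ (- kappa)).
  by rewrite mulr_sumr expR_sum; apply: eq_bigr => q _; rewrite /g addrC subrK.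
rewrite ler_expR ler_wpM2l // /rough_sum -[leLHS]big_filter -[leRHS]big_filter.
rewrite -(big_map val xpredT (fun q : nat => q%:R `^ (- kappa))).
apply: ler_sum_subseq => [|p|p _]; last exact: powR_ge0.
  by rewrite filter_uniq // primes_uniq.
rewrite mem_filter mem_primes => /andP[zp /and3P[pp _ pm]].
have pN : (p < N.+1)%N by rewrite ltnS (leq_trans _ mN) // dvdn_leq.
apply/mapP; exists (Ordinal pN) => //.
by rewrite mem_filter mem_index_enum andbT !inE /= pp zp pm.
Qed.

(** By the normalisation of t, g q <= (z / q)^kappa <= (z / q)^(1/2) because kappa >= 1/2; against 1
    / (q - 1) this gives sqrt z times a tail of the sum of n^(-3/2), bounded independently of z. *)
Lemma sum_expR_rough_sub1_le : \sum_(q in Q0) g q / (q.-1)%:R <= 8.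
Proof.
pose Z := Num.truncn z.
have Z0 : (0 < Z)%N by rewrite truncn_gt0.
have sZ : 0 < Num.sqrt Z%:R :> R by rewrite sqrtr_gt0 ltr0n.
have sz : 0 < Num.sqrt z by rewrite sqrtr_gt0.
have zZ : Num.sqrt z <= 2 * Num.sqrt Z%:R.
  have -> : 2 = Num.sqrt (2 ^+ 2) :> R by rewrite sqrtr_sqr ger0_norm.
  rewrite -sqrtrM ?exprn_ge0 // ler_wsqrtr //.
  have : z < Z.+1%:R by apply: truncnS_gt.
  have : 1 <= Z%:R :> R by rewrite ler1n.
  rewrite -[Z.+1]addn1 natrD; lra.
apply: (@le_trans _ _ (2 * Num.sqrt z * \sum_(Z.+1 <= n < N.+1) (n%:R * Num.sqrt n%:R)^-1)).
  rewrite mulr_sumr -[leLHS]big_filter.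
  apply: (@le_trans _ _ (\sum_(n <- [seq val q | q <- [seq q <- index_enum T | q \in Q0]])
     2 * Num.sqrt z * (n%:R * Num.sqrt n%:R)^-1)).
    rewrite big_map big_seq [leRHS]big_seq; apply: ler_sum => q.
    rewrite mem_filter inE => /andP[/andP[pq zq] _].
    have q0 : 0 < q%:R :> R by apply: lt_trans zq.
    have q1 := prime_pred_gt0 pq.
    have sq : 0 < Num.sqrt q%:R :> R by rewrite sqrtr_gt0.
    have e1 : z `^ kappa * q%:R `^ (- kappa) = (z / q%:R) `^ kappa.
      by rewrite powRM ?invr_ge0 ?ltW // -powR_inv1 ?ltW // -powRrM mulN1r.
    have zq1 : 0 < z / q%:R <= 1 by rewrite divr_gt0 //= ler_pdivrMr // mul1r ltW.
    have e2 : (z / q%:R) `^ kappa <= Num.sqrt z / Num.sqrt q%:R.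
      rewrite -sqrtrV ?(ltW q0) // -sqrtrM ?(ltW z0) // -powR12_sqrt; last by case/andP: zq1 => /ltW.
      exact: ger_powR.
    have e3 : (z / q%:R) `^ kappa <= 1.
      by have := ger_powR zq1 (ltW k0); rewrite powRr0.
    have gq : g q <= (z / q%:R) `^ kappa.
      rewrite /g lerBlDl mulrAC e1; apply: le_trans (expR_le_1D2x _) _.
        by rewrite divr_ge0 ?powR_ge0 //= -[leRHS]mul1r ler_wpM2r // invr_ge0.
      by rewrite lerD2l; move: ((z / q%:R) `^ kappa) => w; lra.
    apply: (@le_trans _ _ (Num.sqrt z / Num.sqrt q%:R * (2 / q%:R))).
      apply: ler_pM; [exact: expR_rough_sub1_ge0|by rewrite invr_ge0|exact: le_trans gq e2|].
      rewrite ler_pdivlMr // ler_pdivrMl ?ltr0n // -natrM ler_nat.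
      by move: q1 => {e1 e2 e3 gq zq1 zq}; case: (q : nat) => //= n; lia.
    by rewrite le_eqVlt; apply/orP; left; apply/eqP; field; rewrite !gt_eqF.
  apply: ler_sum_subseq => [|n|n _].
  - by rewrite map_inj_uniq ?filter_uniq ?index_enum_uniq //; exact: val_inj.
  - case/mapP => q; rewrite mem_filter inE => /andP[/andP[pq zq] _] ->.
    by rewrite mem_index_iota ltn_ord andbT truncn_lt_nat // ltW.
  - by rewrite mulr_ge0 ?invr_ge0 ?mulr_ge0 ?sqrtr_ge0.
apply: le_trans (ler_wpM2l _ (sum_sqrt_tail R N Z0)) _; first by rewrite mulr_ge0 ?sqrtr_ge0.
rewrite mulrA ler_pdivrMr //; lra.
Qed.

Lemma sum_expR_rough : 
  \sum_(1 <= p < N.+1 | prime p) p%:R^-1 * expR (t * rough_sum kappa z p.-1)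
    <= 4098 * loglog1 R N * expR 8.
Proof.
have L1 := loglog1_ge1 R N0.
apply: (@le_trans _ _ (\sum_(1 <= p < N.+1 | prime p)
    \sum_(D : {set T} | (D \subset Q0) && (prodn D %| p.-1)%N) (\prod_(q in D) g q) * p%:R^-1)).
  rewrite big_nat_cond [leRHS]big_nat_cond; apply: ler_sum => p /andP[/andP[p0 pN] pp].
  rewrite -mulr_suml mulrC ler_wpM2r ?invr_ge0 // expR_rough_sum // prime_pred_gt0 //=.
  by rewrite -ltnS (leq_ltn_trans (leq_pred p)).
rewrite (exchange_big_dep (fun D : {set T} => D \subset Q0)) /=; last by move=> ? ? _ /andP[].
apply: (@le_trans _ _ (\sum_(D : {set T} | D \subset Q0)
    4098 * loglog1 R N * \prod_(q in D) (g q / (q.-1)%:R))).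
  apply: ler_sum => D DQ; have pD := prime_set_Q0 DQ.
  rewrite -mulr_sumr; rewrite (eq_bigl (fun p => prime p && (prodn D %| p.-1)%N)); last by move=> p; rewrite DQ.
  apply: le_trans (ler_wpM2l _ (sum_inv_prime_ap R N0 (prodn_gt0 pD))) _.
    by apply: prodr_ge0 => q _; exact: expR_rough_sub1_ge0.
  rewrite totient_prodn // mulrCA ler_wpM2l //; first by rewrite mulr_ge0 // (le_trans ler01).
  by rewrite natr_prod -prodfV -big_split.
rewrite -mulr_sumr -prod1D_subsets ler_wpM2l //; first by rewrite mulr_ge0 // (le_trans ler01).
apply: le_trans (prod1D_le_expR _) _.
  by move=> q _; rewrite divr_ge0 ?expR_rough_sub1_ge0.
rewrite ler_expR; exact: sum_expR_rough_sub1_le.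
Qed.

(** A prime dividing the lcm divides some p - 1, so the exponential of the rough sum of the lcm is
    at most a product over p in A, and the sum over all A becomes an Euler product. *)
Lemma sum_prime_sets_rough :
  \sum_(A : {set T} | prime_set A) (prodn A)%:R^-1 * expR (t * rough_sum kappa z (lcm_pred A))
    <= expR (4098 * loglog1 R N * expR 8).
Proof.
pose P := [set p : T | prime p].
pose f (p : T) : R := p%:R^-1 * expR (t * rough_sum kappa z p.-1).
apply: (@le_trans _ _ (\sum_(A : {set T} | A \subset P) \prod_(p in A) f p)).
  have -> : \sum_(A : {set T} | A \subset P) \prod_(p in A) f p = 
     \sum_(A : {set T} | prime_set A) \prod_(p in A) f p.
    apply: eq_bigl => A; apply/subsetP/prime_setP => H p /H; by rewrite inE.
  apply: ler_sum => A pA; rewrite /f big_split /= prodfV -natr_prod -expR_sum.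
  rewrite ler_wpM2l ?invr_ge0 // ler_expR -mulr_sumr ler_wpM2l //.
  exact: rough_sum_lcm_pred.
rewrite -prod1D_subsets; apply: le_trans (prod1D_le_expR _) _.
  by move=> p _; rewrite mulr_ge0 ?invr_ge0 ?expR_ge0.
rewrite ler_expR; apply: le_trans sum_expR_rough.
rewrite le_eqVlt; apply/orP; left; apply/eqP.
transitivity (\sum_(p : T | prime p) f p); first by apply: eq_bigl => p; rewrite inE.
rewrite /f -(big_mkord (fun p => prime p) (fun p => p%:R^-1 * expR (t * rough_sum kappa z p.-1))).
by rewrite big_ltn_cond.
Qed.
End PrimeSetWeightSums.

(** * Rankin's bound from good and exceptional sets *)

Section CountUpper.
Variable R : realType.

(* Write n = b^2 a with a the product of the primes in A.  If A is good, 1 is bounded by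
   (x / n)^kappa (y / lcm_pred A)^(1 - kappa); otherwise by (x / n) exp (t (rough_sum - 1)). *)
Lemma carmichael_count_large (x y kappa z : R) :
  1 <= x -> 0 < y -> 2^-1 <= kappa -> kappa < 1 -> 1 <= z ->
  (carmichael_count x y)%:R <= (1 + ln x) *
    (x `^ kappa * y `^ (1 - kappa) * expR (branch_bound (Num.truncn x) kappa z) +
     x * expR (4098 * loglog1 R (Num.truncn x) * expR 8 - z `^ kappa / 2)).
Proof.
move=> x1 y0 k2 k1 z1; set N := Num.truncn x.
have x0 : 0 < x by apply: lt_le_trans x1.
have k0 : 0 < kappa by exact: kappa_gt0.
have N0 : (0 < N)%N by rewrite truncn_gt0.
have Nx : N%:R <= x by rewrite truncn_le ltW.
set t := z `^ kappa / 2; set LL := 4098 * _ * _.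
have t0 : 0 <= t by rewrite divr_ge0 ?powR_ge0.
pose P (J : 'I_N.+1 * {set 'I_N.+1}) := [&& (0 < J.1)%N, prime_set J.2,
  (J.1 ^ 2 * prodn J.2 <= N)%N & (lcm_pred J.2)%:R <= y].
pose W (A : {set 'I_N.+1}) : R := x `^ kappa * y `^ (1 - kappa) *
   (if A \in good_sets N kappa z then weight kappa A else 0) +
   x * expR (- t) * ((prodn A)%:R^-1 * expR (t * rough_sum kappa z (lcm_pred A))).
have W0 A : prime_set A -> 0 <= W A.
  move=> pA; apply: addr_ge0; rewrite mulr_ge0 ?mulr_ge0 ?powR_ge0 ?expR_ge0 ?invr_ge0 ?(ltW x0) //.
  by case: ifP => // _; exact: weight_ge0.
apply: (@le_trans _ _ (\sum_(J | P J) (1 : R))).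
  rewrite /carmichael_count natr_sum.
  apply: (ler_sum_fiber (f := fun J : 'I_N.+1 * {set 'I_N.+1} => (J.1 ^ 2 * prodn J.2)%N)
    (F := fun _ => 1 : R)) => // n nN ny.
  have [b [A [b0 pA en]]] := square_squarefree nN; case/andP: nN => n0 nN.
  have PA := prodn_gt0 pA.
  have bN : (b < N.+1)%N.
    rewrite ltnS; apply: leq_trans nN; rewrite en; apply: leq_trans (leq_pmulr _ PA).
    by rewrite -{1}(expn1 b) leq_pexp2l.
  exists (Ordinal bN, A) => //; rewrite /P /= b0 pA -en nN /=.
  apply: le_trans ny; rewrite ler_nat; apply: dvdn_leq; first exact: carmichael_gt0.
  apply: lcm_pred_dvd => p pinA; apply: prime_pred_dvd_carmichael => //.
    by move/prime_setP: pA; apply.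
  by rewrite en dvdn_mull // /prodn (big_setD1 p) //= dvdn_mulr.
pose F (J : 'I_N.+1 * {set 'I_N.+1}) : R := (J.1 : nat)%:R^-1 * W J.2.
pose Q (J : 'I_N.+1 * {set 'I_N.+1}) := (0 < J.1)%N && prime_set J.2.
apply: (@le_trans _ _ (\sum_(J | Q J) F J)).
  apply: (@le_trans _ _ (\sum_(J | P J) F J)); last first.
    apply: (ler_sum_inj (h := id)) => // -[b A] /=; first by case/and4P=> /= b0 pA _ _; rewrite /Q /= b0.
    by case/andP=> b0 pA; rewrite /F /= mulr_ge0 ?invr_ge0 // W0.
  apply: ler_sum => -[b A] /and4P[/= b0 pA bAN ly].
  have br : 0 < b%:R :> R by rewrite ltr0n.
  have b1 : 1 <= b%:R :> R by rewrite ler1n.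
  have Pr : 0 < (prodn A)%:R :> R by rewrite ltr0n prodn_gt0.
  have Lr : 0 < (lcm_pred A)%:R :> R by rewrite ltr0n lcm_pred_gt0.
  have bPx : b%:R ^+ 2 * (prodn A)%:R <= x.
    by apply: le_trans Nx; rewrite -natrX -natrM ler_nat.
  rewrite /F /= mulrC ler_pdivlMr // mul1r /W.
  case: ifP => [gA|gA].
    apply: ler_wpDr; first by rewrite !mulr_ge0 ?expR_ge0 ?invr_ge0 // ltW.
    rewrite /weight (_ : (prodn A)%:R `^ (- kappa) = ((prodn A)%:R `^ kappa)^-1); last by rewrite powRN.
    rewrite (_ : _ `^ (kappa - 1) = ((lcm_pred A)%:R `^ (1 - kappa))^-1); last first.
      by rewrite -powRN; congr (_ `^ _); ring.
    rewrite -invfM ler_pdivlMr ?mulr_gt0 ?powR_gt0 // mulrA.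
    apply: ler_pM; rewrite ?mulr_ge0 ?powR_ge0 ?(ltW br) //; last first.
      by apply: ge0_ler_powR; rewrite ?nnegrE ?ler0n ?(ltW y0) ?subr_ge0 ?(ltW k1).
    (* Since kappa >= 1/2, b <= (b^2)^kappa: the square part thus yields the weight 1 / b, whose sum
       over b is the factor 1 + ln x. *)
    apply: (@le_trans _ _ ((b%:R ^+ 2 * (prodn A)%:R) `^ kappa)); last first.
      by apply: ge0_ler_powR; rewrite ?nnegrE ?mulr_ge0 ?exprn_ge0 ?(ltW x0) ?(ltW k0) ?(ltW br).
    rewrite powRM ?exprn_ge0 ?ler0n // ler_wpM2r ?powR_ge0 //.
    rewrite -powR_mulrn // -powRrM -{1}(powRr1 (ltW br)); apply: ler_powR => //.
    by have := k2; lra.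
  rewrite mulr0 add0r.
  have rA : 1 < rough_sum kappa z (lcm_pred A).
    by move/negbT: gA; rewrite inE pA /= -ltNge.
  have -> : x * expR (- t) * ((prodn A)%:R^-1 * expR (t * rough_sum kappa z (lcm_pred A))) =
     x / (prodn A)%:R * expR (t * (rough_sum kappa z (lcm_pred A) - 1)).
    rewrite mulrBr mulr1 expRD; ring.
  apply: (@le_trans _ _ (x / (prodn A)%:R * 1)).
    rewrite mulr1 ler_pdivlMr //; apply: le_trans bPx; rewrite ler_wpM2r ?(ltW Pr) //.
    by rewrite expr2 ler_peMr // ltW.
  apply: ler_wpM2l; first by rewrite divr_ge0 // ltW.
  by apply: le_trans (expR_ge1Dx _); rewrite lerDl mulr_ge0 // subr_ge0 ltW.
rewrite /Q /F -(pair_big (fun b : 'I_N.+1 => (0 < b)%N) (fun A : {set 'I_N.+1} => prime_set A)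
  (fun b A => b%:R^-1 * W A)) /=.
under eq_bigr do rewrite -mulr_sumr.
rewrite -mulr_suml; apply: ler_pM.
- by apply: sumr_ge0 => b _; rewrite invr_ge0.
- exact: sumr_ge0.
- apply: (@le_trans _ _ (1 + ln N%:R)); last first.
    by rewrite lerD2l ler_ln ?posrE ?ltr0n.
  have := harmonic_le R N.-1; rewrite prednK // => h; apply: le_trans h.
  by rewrite big_mkcond big_ord_recl /= add0r big_add1 /= big_mkord.
rewrite /W big_split /= -!mulr_sumr; apply: lerD.
  apply: ler_wpM2l; first by rewrite mulr_ge0 ?powR_ge0.
  apply: le_trans (sum_good_weight N0 k2 k1 z1).
  rewrite -big_mkcondr /=; rewrite le_eqVlt; apply/orP; left; apply/eqP.
  by apply: eq_bigl => A; rewrite inE; case: (prime_set A).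
rewrite [LL - t]addrC expRD mulrA; apply: ler_wpM2l.
  by rewrite mulr_ge0 ?expR_ge0 // ltW.
exact: sum_prime_sets_rough.
Qed.
End CountUpper.

(** * Chebyshev's lower bound and the lower bound construction *)

Lemma central_bin_ge n : (2 ^ n <= 'C(n + n, n))%N.
Proof.
elim: n => // n IH; rewrite expnS.
apply: leq_trans (leq_mul (leqnn 2) IH) _.
have -> : (n.+1 + n.+1 = (n + n).+2)%N by lia.
rewrite binS; have -> : 'C((n + n).+1, n.+1) = 'C((n + n).+1, n).
  by rewrite -bin_sub; [congr ('C(_, _))|]; lia.
rewrite mul2n -addnn; by apply: leq_add; apply: leq_bin2l.
Qed.

(** In Legendre's formula the k-th term floor(2n / p^k) - 2 floor(n / p^k) is at most 1, and it
    vanishes once p^k > 2n. *)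
Lemma logn_central_bin p n : prime p -> (0 < n)%N ->
  (logn p 'C(n + n, n) <= trunc_log p (n + n))%N.
Proof.
move=> pp n0; have p1 := prime_gt1 pp.
have C0 : (0 < 'C(n + n, n))%N by rewrite bin_gt0 leq_addr.
have e : (logn p 'C(n + n, n) + 2 * \sum_(1 <= k < (n + n).+1) n %/ p ^ k =
    \sum_(1 <= k < (n + n).+1) (n + n) %/ p ^ k)%N.
  have -> : (\sum_(1 <= k < (n + n).+1) n %/ p ^ k = \sum_(1 <= k < n.+1) n %/ p ^ k)%N.
    rewrite (big_cat_nat (n := n.+1)) //=; last by lia.
    suff -> : (\sum_(n.+1 <= k < (n + n).+1) n %/ p ^ k = 0)%N by rewrite addn0.
    rewrite big_nat big1 // => k /andP[nk _].
    by rewrite divn_small // (leq_trans nk) // ltnW // ltn_expl.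
  rewrite -!logn_fact // -(bin_fact (leq_addr n n)) addnK.
  by rewrite !lognM ?muln_gt0 ?fact_gt0 //; lia.
have le : (\sum_(1 <= k < (n + n).+1) (n + n) %/ p ^ k <=
   \sum_(1 <= k < (n + n).+1) (2 * (n %/ p ^ k) + (k <= trunc_log p (n + n))))%N.
  apply: leq_sum => k _; have q0 : (0 < p ^ k)%N by rewrite expn_gt0 prime_gt0.
  case: (leqP k (trunc_log p (n + n))) => h.
    have := ltn_ceil n q0; move: q0; set q := (p ^ k)%N; set d := (n %/ q)%N => q0 hd.
    rewrite -ltnS ltn_divLR //= addn1; clearbody d q; clear -hd; nia.
  rewrite divn_small // ltnNge; apply: contraL h => h; rewrite -leqNgt.
  exact: trunc_log_max.
have cnt m T : (\sum_(1 <= k < m.+1) (k <= T) <= T)%N.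
  elim: m => [|m IH]; first by rewrite big_geq.
  rewrite big_nat_recr //=; case: (leqP m.+1 T) => h; last by rewrite addn0.
  apply: leq_trans h; rewrite addn1 ltnS.
  apply: (@leq_trans (\sum_(1 <= i < m.+1) 1)%N).
    by apply: leq_sum => i _; exact: leq_b1.
  by rewrite sum_nat_const_nat subSS subn0 muln1.
move: le; rewrite big_split /= -big_distrr /= -e addnC leq_add2l.
by move/leq_trans; apply; exact: cnt.
Qed.

(** The central binomial coefficient is a product of prime powers, at most one for each prime up to
    2n, and each is at most 2n by [logn_central_bin]. *)
Lemma expn_prime_count_ge n : (0 < n)%N ->
  (2 ^ n <= (n + n) ^ (\sum_(1 <= p < (n + n).+1 | prime p) 1))%N.
Proof.
move=> n0; apply: leq_trans (central_bin_ge n) _.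
have C0 : (0 < 'C(n + n, n))%N by rewrite bin_gt0 leq_addr.
set C := 'C(n + n, n) in C0 *.
have pr p : p \in primes C -> (p < (n + n).+1)%N.
  rewrite mem_primes => /and3P[pp _ pC]; rewrite ltnS.
  have h : (p %| (n + n)`!)%N.
    by rewrite -(bin_fact (leq_addr n n)) dvdn_mulr.
  by move: h; rewrite fact_prod Euclid_dvd_prod // big_has => /hasP[i];
     rewrite mem_index_iota => /andP[i0 iN] pi; apply: leq_trans (dvdn_leq i0 pi) _.
have nn : (0 < n + n)%N by lia.
rewrite {1}(prod_prime_decomp C0) prime_decompE big_map /=.
apply: (@leq_trans (\prod_(p <- primes C) (n + n))%N).
  rewrite big_seq [leqRHS]big_seq; apply: leq_prod => p pC.
  move: (pC); rewrite mem_primes => /and3P[pp _ _].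
  apply: leq_trans (trunc_logP (prime_gt1 pp) nn).
  by rewrite leq_pexp2l ?prime_gt0 // logn_central_bin.
rewrite big_const_seq count_predT iter_muln_1 leq_pexp2l //.
rewrite sum1_count -size_filter; apply: uniq_leq_size; first exact: primes_uniq.
move=> p pC; move: (pC); rewrite mem_filter mem_primes => /and3P[pp _ _].
by rewrite pp mem_index_iota prime_gt0 //= pr.
Qed.

(** This is (n / j)^j <= 'C(n, j). The induction combines 'C(n + 1, j + 1) = (n + 1) / (j + 1) 'C(n,
    j) with (n + 1) / (j + 1) <= n / j. *)
Lemma bin_pow_ge n j : (j <= n)%N -> (n ^ j <= j ^ j * 'C(n, j))%N.
Proof.
elim: j n => [|j IH] n jn; first by rewrite bin0.
case: n jn => // n; rewrite ltnS => jn.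
have [->|j0] := posnP j; first by rewrite bin1 !expn1 mul1n.
have e : (j.+1 * 'C(n.+1, j.+1) = n.+1 * 'C(n, j))%N by rewrite -mul_bin_diag.
have h : ((n.+1 * j) ^ j <= (j.+1 * n) ^ j)%N by rewrite leq_exp2r //; nia.
have jj : (0 < j ^ j)%N by rewrite expn_gt0 j0.
rewrite -(leq_pmul2l jj) [(j.+1 ^ j.+1)%N]expnSr -(mulnA (j.+1 ^ j)%N) e.
have := IH n jn; move: h; rewrite !expnMn [(n.+1 ^ j.+1)%N]expnS.
set a := (n.+1 ^ j)%N; set b := (j ^ j)%N; set c := (j.+1 ^ j)%N; set d := (n ^ j)%N.
move: ('C(n, j)) (n.+1) => B m h1 h2.
have := leq_mul (leqnn m) (leq_trans h1 (leq_mul (leqnn c) h2)).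
by move=> h3; apply: leq_trans (leq_trans h3 _); lia.
Qed.

Section LowerCount.
Variable R : realType.

(** The constant 8 comes from v <= 4 n, for n half of the integer part of v, and from ln 2 >=
    1/2. *)
Lemma primepi_ge (v : R) : 4 <= v -> v / (8 * ln v) <= (primepi v)%:R.
Proof.
move=> v4; have v0 : 0 <= v by lra.
set n := (Num.truncn v)./2.
have nV : (n + n <= Num.truncn v)%N by rewrite /n addnn -[leqRHS]odd_double_half leq_addl.
have V4 : (4 <= Num.truncn v)%N by rewrite truncn_ge_nat.
have nV2 : (Num.truncn v <= n + n + 1)%N by rewrite /n addnn -[leqLHS]odd_double_half; case: odd; lia.
have n0 : (0 < n)%N by lia.
have vn : v <= 4 * n%:R.
  apply: ltW; apply: lt_le_trans (truncnS_gt v) _; rewrite -natrM ler_nat.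
  by apply: (leq_ltn_trans nV2); move: n0; clearbody n; clear; lia.
have nv : (n + n)%:R <= v by apply: le_trans (_ : (Num.truncn v)%:R <= v); rewrite ?ler_nat // truncn_le.
have lv : 0 < ln v by rewrite ln_gt0 //; lra.
rewrite ler_pdivrMr ?mulr_gt0 //.
have h := expn_prime_count_ge n0.
set c := (\sum_(1 <= p < (n + n).+1 | prime p) 1)%N in h.
have cp : (c <= primepi v)%N.
  by rewrite /c /primepi (big_cat_nat (n := (n + n).+1) (p := (Num.truncn v).+1)) //= leq_addr.
have h2 : n%:R * ln 2 <= c%:R * ln v :> R.
  rewrite !mulr_natl -!lnXn ?(lt_le_trans _ v4) //.
  rewrite ler_ln ?posrE ?exprn_gt0 ?(lt_le_trans _ v4) //.
  apply: (@le_trans _ _ ((n + n)%:R ^+ c)); first by rewrite -!natrX ler_nat.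
  by rewrite lerXn2r ?nnegrE.
have cr : c%:R <= (primepi v)%:R :> R by rewrite ler_nat.
have l2 := ln2_ge R.
have n0r : 0 <= n%:R :> R by [].
have h3 := ler_wpM2r (ltW lv) cr.
have h4 := ler_wpM2l n0r l2.
move: (ln v) (ln 2) (n%:R : R) (c%:R : R) ((primepi v)%:R : R) l2 n0r h3 h4 h2 vn => a b c1 d f l2 n0r h3 h4 h2 vn.
have -> : f * (8 * a) = 8 * (f * a) by ring.
lra.
Qed.

(** Each exact prime power of m is at most z, so it is one of the factors of the factorial. The
    factorial replaces the lcm of the integers up to z; its logarithm, at most z ln z, is small
    enough. *)
Lemma max_prime_power_dvd_fact (m : nat) (z : R) : 0 <= z -> (0 < m)%N ->
  (max_prime_power m)%:R <= z -> (m %| (Num.truncn z)`!)%N.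
Proof.
rewrite /max_prime_power; case: eqP => [-> _ _ _|_ z0 m0 h]; first exact: dvd1n.
apply/dvdn_partP => // l; rewrite mem_primes => /and3P[pl _ lm].
rewrite p_part dvdn_fact // expn_gt0 prime_gt0 //= truncn_ge_nat //.
apply: le_trans h; rewrite ler_nat.
have ld : (l ^ logn l m)%N \in divisors m by rewrite -dvdn_divisors // pfactor_dvdnn.
apply: leq_bigmax_seq => //.
by apply/asboolP; exists l, (logn l m); rewrite logn_gt0 mem_primes pl m0.
Qed.

(* The integers q * prodn K, with q prime in ]v, y / z!] and K a set of j primes counted by
   [primepi_star v z]; since q > v, the set q |: K determines q and K. *)
Lemma carmichael_count_ge (x y v z : R) (j : nat) :
  0 <= z -> 1 <= v -> v <= x -> 1 <= y -> v ^+ j * y <= x ->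
  ((primepi (y / (Num.truncn z)`!%:R))%:R - (primepi v)%:R) * 'C(primepi_star v z, j)%:R
    <= (carmichael_count x y)%:R :> R.
Proof.
move=> z0 v1 vx y1 vyx; set E := (Num.truncn z)`!; set N := Num.truncn x.
have v0 : 0 <= v by lra. have x0 : 0 <= x by lra. have y0 : 0 <= y by lra.
have E0 : (0 < E)%N by rewrite fact_gt0.
have E1 : 1 <= E%:R :> R by rewrite ler1n.
have Er : 0 < E%:R :> R by rewrite ltr0n.
have vj1 : 1 <= v ^+ j by rewrite exprn_ege1.
have yx : y <= x by apply: le_trans vyx; rewrite ler_peMl.
pose Q := [set q : 'I_N.+1 | [&& prime q, v < q%:R & q%:R <= y / E%:R]].
pose S := [set p : 'I_N.+1 | [&& prime p, p%:R <= v & (max_prime_power p.-1)%:R <= z]].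
have yEx : y / E%:R <= x by apply: le_trans yx; rewrite ler_pdivrMr // ler_peMr.
have yE0 : 0 <= y / E%:R by rewrite divr_ge0 // ltW.
have cQ : (primepi (y / E%:R))%:R - (primepi v)%:R <= #|Q|%:R :> R.
  rewrite lerBlDr /primepi !natr_sum.
  rewrite (bigID (fun p => v < p%:R)) /=; apply: lerD.
    rewrite -sum1_card natr_sum; apply: (ler_sum_fiber (f := fun p : 'I_N.+1 => val p)
      (F := fun=> 1 : R) (Q := fun p => prime p && (v < p%:R))) => // n /andP[n0 nY] /andP[pn vn].
    have ny : n%:R <= y / E%:R by rewrite -truncn_ge_nat.
    have nN : (n < N.+1)%N by rewrite ltnS truncn_ge_nat // (le_trans ny).
    by exists (Ordinal nN); rewrite // inE /= pn vn ny.
  rewrite -big_filter -[leRHS]big_filter; apply: ler_sum_subseq => //.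
    by rewrite filter_uniq // iota_uniq.
  move=> p; rewrite !mem_filter !mem_index_iota -leNgt => /andP[/andP[pp pv] /andP[p0 _]].
  by rewrite pp p0 /= ltnS truncn_ge_nat.
have cS : (primepi_star v z <= #|S|)%N.
  rewrite -(ler_nat R) /primepi_star -sum1_card !natr_sum.
  apply: (ler_sum_fiber (f := fun p : 'I_N.+1 => val p) (F := fun=> 1 : R)
     (Q := fun p => prime p && ((max_prime_power p.-1)%:R <= z))) => // n /andP[n0 nV] /andP[pn nz].
  have nv : n%:R <= v by rewrite -truncn_ge_nat.
  have nN : (n < N.+1)%N by rewrite ltnS truncn_ge_nat // (le_trans nv).
  by exists (Ordinal nN); rewrite // inE /= pn nz nv.
apply: (@le_trans _ _ (#|Q|%:R * 'C(#|S|, j)%:R)).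
  apply: le_trans (ler_wpM2r _ cQ) _ => //.
  by apply: ler_wpM2l => //; rewrite ler_nat leq_bin2l.
pose K := [set A : {set 'I_N.+1} | A \subset S & #|A| == j].
have -> : 'C(#|S|, j) = #|K| by rewrite cards_draws.
have KP A : A \in K -> prime_set A.
  rewrite inE => /andP[/subsetP AS _]; apply/prime_setP => p /AS.
  by rewrite inE => /and3P[].
have notin q A : q \in Q -> A \in K -> q \notin A.
  rewrite !inE => /and3P[_ vq _] /andP[/subsetP AS _]; apply/negP => /AS.
  by rewrite inE leNgt vq andbF.
have UP q A : q \in Q -> A \in K -> prime_set (q |: A).
  move=> qQ /KP/prime_setP AP; apply/prime_setP => p; rewrite !inE => /orP[/eqP ->|/AP //].
  by move: qQ; rewrite inE => /and3P[].
have prodU q A : q \in Q -> A \in K -> prodn (q |: A) = (q * prodn A)%N.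
  by move=> qQ AK; rewrite /prodn big_setU1 ?notin.
have prodN q A : q \in Q -> A \in K -> (prodn (q |: A) <= N)%N.
  move=> qQ AK; rewrite prodU // truncn_ge_nat // natrM.
  apply: le_trans vyx; rewrite mulrC; apply: ler_pM => //.
    move: AK; rewrite inE => /andP[/subsetP AS /eqP <-].
    rewrite /prodn natr_prod -prodr_const; apply: ler_prod => p /AS.
    by rewrite inE ler0n => /and3P[].
  move: qQ; rewrite inE => /and3P[_ _ h]; apply: le_trans h _.
  by rewrite ler_pdivrMr // ler_peMr.
rewrite -natrM -cardsX.
pose h (J : 'I_N.+1 * {set 'I_N.+1}) : 'I_N.+1 := inord (prodn (J.1 |: J.2)).
have hE J : J \in setX Q K -> h J = prodn (J.1 |: J.2) :> nat.
  by case: J => q A; rewrite in_setX => /andP[qQ AK]; rewrite inordK // ltnS prodN.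
apply: (@le_trans _ _ (\sum_(n : 'I_N.+1 | (0 < n)%N && ((carmichael n)%:R <= y)) (1 : R))).
  rewrite -sum1_card natr_sum.
  apply: (ler_sum_inj (h := h) (F := fun=> 1 : R)) => //.
    move=> [q A] [q' A'] J1 J2 e.
    have e1 : prodn (q |: A) = prodn (q' |: A') by rewrite -(hE _ J1) -(hE _ J2) e.
    move: J1 J2; rewrite !in_setX => /andP[/= qQ AK] /andP[/= qQ' AK'].
    have e2 := prodn_inj (UP _ _ qQ AK) (UP _ _ qQ' AK') e1.
    have eq : q = q'.
      have : q \in q' |: A' by rewrite -e2 setU11.
      by rewrite !inE => /orP[/eqP //|]; rewrite (negbTE (notin _ _ qQ AK')).
    rewrite -eq in e2 qQ' *; congr (_, _).
    by rewrite -(setU1K (notin _ _ qQ AK)) e2 setU1K // notin.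
  move=> J JX; rewrite hE //; case: J JX => q A; rewrite in_setX => /andP[/= qQ AK].
  rewrite prodn_gt0 ?UP //=.
  have pq : prime q by move: qQ; rewrite inE => /and3P[].
  have q1 : (0 < q.-1 * E)%N by rewrite muln_gt0 E0 prime_pred_gt0.
  apply: (@le_trans _ _ (q.-1 * E)%N%:R).
    rewrite ler_nat; apply: dvdn_leq => //.
    have eprod : prodn (q |: A) = (\prod_(p <- [seq val p | p <- enum (q |: A)]) p)%N.
      by rewrite big_map big_enum.
    rewrite eprod; apply: carmichael_prod_dvd.
    - by rewrite map_inj_uniq ?enum_uniq //; exact: val_inj.
    - apply/allP => p /mapP[r]; rewrite mem_enum => rU ->.
      by move/prime_setP: (UP _ _ qQ AK); apply.
    - rewrite -eprod prodU //; apply: leq_trans (prime_gt1 pq) _.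
      by rewrite leq_pmulr // prodn_gt0 // KP.
    move=> p /mapP[r]; rewrite mem_enum !inE => /orP[/eqP -> ->|rA ->].
      by rewrite dvdn_mulr.
    apply: dvdn_mull; move: AK; rewrite inE => /andP[/subsetP AS _].
    have := AS _ rA; rewrite inE => /and3P[pr _ rz].
    by apply: max_prime_power_dvd_fact => //; apply: prime_pred_gt0.
  move: qQ; rewrite inE => /and3P[_ _]; rewrite ler_pdivlMr // => h2.
  by apply: le_trans h2; rewrite natrM ler_wpM2r ?(ltW Er) // ler_nat leq_pred.
rewrite /carmichael_count natr_sum -/N le_eqVlt; apply/orP; left; apply/eqP.
rewrite -(big_mkord (fun n => (0 < n)%N && ((carmichael n)%:R <= y)) (fun=> 1)).
rewrite big_ltn_cond //= big_nat_cond [RHS]big_nat_cond.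
by apply: eq_bigl => n; case: n.
Qed.
End LowerCount.

Tactic Notation "lin" hyp_list(hs) := clear - hs; lra.

(** * Asymptotics *)

(* In this part x = exp (exp t), y = exp (exp r) and x / y = exp (exp s). *)

Section Growth.
Variable R : realType.

Lemma poly_le_expR (h K : R) : 0 < h ->
  exists t0, forall t, t0 <= t -> 1 <= t /\ K * t ^+ 3 <= expR (h * t).
Proof.
move=> h0; exists (1 + `|K| * 24 / h ^+ 4) => t ht.
have K0 : 0 <= `|K| * 24 / h ^+ 4 by rewrite divr_ge0 ?mulr_ge0 ?exprn_ge0 // ltW.
have t1 : 1 <= t by lra.
split => //; have t0 : 0 < t by lra.
have ht0 : 0 <= h * t by rewrite mulr_ge0 // ltW.
apply: le_trans (_ : (h * t) ^+ 4 / 24 <= _); last first.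
  have := expR_ge1Dxn 3 ht0; rewrite (_ : 4`!%:R = 24) // => h1.
  by apply: le_trans h1; rewrite lerDr.
apply: (@le_trans _ _ (`|K| * t ^+ 3)).
  by apply: ler_wpM2r; rewrite ?exprn_ge0 ?ler_norm // ltW.
have h4 : 0 < h ^+ 4 by rewrite exprn_gt0.
have : `|K| * 24 <= t * h ^+ 4 by rewrite -ler_pdivrMr //; lra.
rewrite ler_pdivlMr // => h1.
have t3 : 0 <= t ^+ 3 by rewrite exprn_ge0 // ltW.
have := ler_wpM2r t3 h1.
have -> : t * h ^+ 4 * t ^+ 3 = (h * t) ^+ 4 by ring.
by rewrite mulrAC.
Qed.

Lemma ln_ge_eventually (M : R) : exists t0, forall t, t0 <= t -> 0 < t /\ M <= ln t.
Proof.
exists (expR M) => t ht; have t0 : 0 < t by apply: lt_le_trans ht; exact: expR_gt0.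
by split => //; rewrite -(expRK M) ler_ln // posrE expR_gt0.
Qed.

Lemma ln_le_lin (h : R) : 0 < h ->
  exists t0, forall t, t0 <= t -> 1 <= t /\ ln t <= h * t.
Proof.
move=> h0; have [t0 H] := poly_le_expR 1 h0; exists t0 => t /H[t1 ht]; split => //.
have tp : 0 < t by lra.
rewrite -(expRK (h * t)) ler_ln ?posrE ?expR_gt0 //; apply: le_trans ht.
rewrite mul1r -{1}[t]expr1; exact: ler_weXn2l.
Qed.

(** That is, t^a log t = o(t); with w = ln t it compares a polynomial with an exponential. *)
Lemma powR_ln_le_lin (a K : R) : a < 1 ->
  exists t0, forall t, t0 <= t -> K * (expR (a * ln t) * (ln t + 1)) <= t.
Proof.
move=> a1; have b0 : 0 < 1 - a by rewrite subr_gt0.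
have [w0 H] := poly_le_expR (`|K| * 2) b0; have [t0 H0] := ln_ge_eventually w0.
exists t0 => t /H0[tp /H[]]; set w := ln t => w1 hw.
have e0 := expR_gt0 (a * w).
have -> : t = expR (a * w) * expR ((1 - a) * w).
  by rewrite -expRD -mulrDl addrC subrK mul1r /w lnK.
rewrite mulrCA; apply: ler_wpM2l; first exact: ltW.
apply: le_trans hw; apply: (@le_trans _ _ (`|K| * (2 * w))).
  apply: (@le_trans _ _ (`|K| * (w + 1))); first by apply: ler_wpM2r (ler_norm _); lra.
  by apply: ler_wpM2l => //; lra.
rewrite mulrA; apply: ler_wpM2l; first by rewrite mulr_ge0.
by rewrite -{1}[w]expr1; apply: ler_weXn2l.
Qed.

Lemma loglog1_le (x : R) : 1 <= x -> loglog1 R (Num.truncn x) <= 1 + ln (1 + ln x).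
Proof.
move=> x1; have x0 : 0 < x by lra.
have N0 : (0 < Num.truncn x)%N by rewrite truncn_gt0.
have lN : 0 <= ln (Num.truncn x)%:R :> R by rewrite ln_ge0 // ler1n.
have lx : ln (Num.truncn x)%:R <= ln x by rewrite ler_ln ?posrE ?ltr0n // truncn_le ltW.
by rewrite /loglog1 lerD2l ler_ln ?posrE; lra.
Qed.

Lemma expR1_ge2 : 2 <= expR 1 :> R.
Proof. by have := expR_ge1Dx (1 : R); lra. Qed.

Lemma ln_le_subr1 (x : R) : 0 < x -> ln x <= x - 1.
Proof.
move=> x0; have h : ln (1 + (x - 1)) <= x - 1 by apply: le_ln1Dx; lra.
by rewrite [1 + _]addrC subrK in h.
Qed.

Lemma loglog1_expR2 (t : R) : 0 <= t -> loglog1 R (Num.truncn (expR (expR t))) <= 2 + t.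
Proof.
move=> t0; have e0 := expR_gt0 t.
apply: le_trans (loglog1_le _) _.
  by apply: le_trans (expR_ge1Dx _); rewrite lerDl ltW.
rewrite expRK; suff : ln (1 + expR t) <= 1 + t by lra.
rewrite -[leRHS]expRK ler_ln ?posrE ?expR_gt0 //; last lra.
rewrite expRD; have := expR1_ge2; have := expR_ge1Dx t; nra.
Qed.

Lemma geom_const_le (k0 k : R) : 0 < k0 -> k0 <= k -> geom_const k <= geom_const k0.
Proof.
move=> k00 k0k; have h0 := powR2N_lt1 k00.
have h1 := powR2N_lt1 (lt_le_trans k00 k0k).
rewrite /geom_const lef_pV2 ?posrE ?subr_gt0 // lerD2l lerN2.
by apply: ler_powR; rewrite ?ler1n // lerN2.
Qed.
End Growth.

(** * Choice of the parameters in the upper bounds *)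

Section UpperAsymptotics.
Variable R : realType.

(** For kappa >= 1/2 the factor [geom_const kappa] is at most its value at 1/2, so every numerical
    factor fits into one C independent of kappa and z. *)
Lemma carmichael_count_large_const : exists2 C : R, 1 <= C &
  forall x y kappa z : R, 1 <= x -> 0 < y -> 2^-1 <= kappa -> kappa < 1 -> 1 <= z ->
  (carmichael_count x y)%:R <= (1 + ln x) *
    (x `^ kappa * y `^ (1 - kappa) *
       expR (C * loglog1 R (Num.truncn x) *
         expR (C * (z `^ (1 - kappa) * loglog1 R (Num.truncn z) + 1))) +
     x * expR (C * loglog1 R (Num.truncn x) - z `^ kappa / 2)).
Proof.
pose C0 := geom_const (2^-1 : R); pose k := 4098 : R.
have C01 : 1 <= C0 by apply: geom_const_ge1; rewrite invr_gt0.
have e81 : 1 <= expR 8 :> R by apply: le_trans (expR_ge1Dx _); rewrite lerDl.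
have k1 : 1 <= k by rewrite ler1n.
exists (2 * k * C0 * expR 8).
  by rewrite -[leLHS](mulr1 1) -{1}[1](mulr1 1) -{1}[1](mulr1 1); rewrite !ler_pM // ?ler1n ?mulr_ge0 ?(le_trans ler01).
move=> x y kappa z x1 y0 k2 kap1 z1.
have := carmichael_count_large x1 y0 k2 kap1 z1; rewrite /branch_bound -/k.
have half0 : 0 < 2^-1 :> R by rewrite invr_gt0.
have cc := geom_const_le half0 k2; rewrite -/C0 in cc.
have c1 : 1 <= geom_const kappa by apply/geom_const_ge1/kappa_gt0.
have N0 : (0 < Num.truncn x)%N by rewrite truncn_gt0.
have Z0 : (0 < Num.truncn z)%N by rewrite truncn_gt0.
have LL1 := loglog1_ge1 R N0; have LZ1 := loglog1_ge1 R Z0.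
have zd : 0 <= z `^ (1 - kappa) by exact: powR_ge0.
move: (loglog1 R (Num.truncn x)) (loglog1 R (Num.truncn z)) (z `^ (1 - kappa)) LL1 LZ1 zd.
move: (expR 8) (geom_const kappa) cc c1 k k1 e81.
clearbody C0; move=> E c cc c1 k k1 E1 L M zd L1 M1 zd0.
have a0 : 0 <= k * E by apply: mulr_ge0; lra.
have a1 : k * C0 * E >= k * C0 by apply: ler_peMr => //; apply: mulr_ge0; lra.
have a2 : k * C0 >= k by apply: ler_peMr => //; lra.
have a3 : k * C0 * E >= k * E.
  by rewrite mulrAC; apply: ler_peMr.
have a4 : k * c <= k * C0 by apply: ler_wpM2l; lra.
have a5 : c <= k * c by apply: ler_peMl; lra.
have zM0 : 0 <= zd * M by rewrite mulr_ge0 //; lra.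
have xp : 0 <= x `^ kappa * y `^ (1 - kappa) by rewrite mulr_ge0 ?powR_ge0.
have x0 : 0 <= x by lra.
move/le_trans; apply; apply: ler_wpM2l; first by rewrite addr_ge0 // ln_ge0.
apply: lerD.
  apply: ler_wpM2l => //; rewrite ler_expR; apply: ler_pM; rewrite ?expR_ge0 //.
  - by rewrite !mulr_ge0 //; lra.
  - by rewrite mulrA; apply: ler_wpM2r; lra.
  rewrite ler_expR (mulrCA zd).
  have h1 : k * c * (zd * M) <= k * C0 * E * (zd * M) by apply: ler_wpM2r => //; lra.
  have -> : 2 * c * (k * (zd * M) + 1) = 2 * (k * c * (zd * M)) + 2 * c by ring.
  have -> : 2 * k * C0 * E * (zd * M + 1) = 2 * (k * C0 * E * (zd * M)) + 2 * (k * C0 * E) by ring.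
  lra.
apply: ler_wpM2l => //; rewrite ler_expR lerD2r mulrAC; apply: ler_wpM2r; first lra.
have -> : 2 * k * C0 * E = 2 * (k * C0 * E) by ring.
lra.
Qed.

(* Rankin exponent 1 - delta with delta = (1 - h) ln s / s, and rough primes are those
   exceeding z = (ln (x / y))^(1 + h). *)
Lemma carmichael_count_le1 (e h : R) : 0 < e -> 0 < h -> h < 1 ->
  exists s0, forall t r s : R, s0 <= s -> 1 <= t -> t <= expR (s / (1 + e)) ->
    expR s + expR r = expR t ->
    (carmichael_count (expR (expR t)) (expR (expR r)))%:R <=
      expR (expR t) * expR (- ((1 - 2 * h) * (expR s * ln s / s))).
Proof.
move=> e0 h0 h1.
have [C C1 HC] := carmichael_count_large_const.
have [g eg] : exists g, g = e / (1 + e) by exists (e / (1 + e)).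
have g0 : 0 < g by rewrite eg divr_gt0 //; lra.
have [eps [eps0 eps1 eps2]] : exists eps, [/\ 0 < eps, eps <= g / 4 & eps <= h / 2].
  exists (Num.min (g / 4) (h / 2)); split; rewrite ?lt_min ?ge_min ?lexx ?orbT //.
  by apply/andP; split; lra.
have h21 : 1 - h ^+ 2 < 1 by rewrite gtrBl exprn_gt0.
have [s1 H1] := powR_ln_le_lin (4 * C / eps) h21.
have [s2 H2] := ln_le_lin eps0.
have [s3 H3] := ln_ge_eventually (2 : R).
have half0 : 0 < 2^-1 :> R by rewrite invr_gt0.
have [s4 H4] := ln_le_lin half0.
have [L5 eL5] : exists L, expR L = 3 * (C + 2) / h.
  by exists (ln (3 * (C + 2) / h)); rewrite lnK // posrE divr_gt0 //; lra.
have [L6 eL6] : exists L, expR L = 2 * (3 * C + 4).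
  by exists (ln (2 * (3 * C + 4))); rewrite lnK // posrE; lra.
have [S5 eS5] : exists S, S * (g / 2) = L5 by exists (L5 / (g / 2)); field; lra.
have [S6 eS6] : exists S, S * (h / 2) = L6 by exists (L6 / (h / 2)); field; lra.
exists (\big[Num.max/0]_(i <- [:: s1; s2; s3; s4; S5; S6]) i) => t r s.
rewrite !big_cons big_nil !ge_max => /and5P[/H1 E1 /H2[s1' E2] /H3[sp w2] /H4[_ E4] /and3P[E5 E6 _]].
move=> t1 ts est.
have [w ew] : exists w, w = ln s by exists (ln s).
have [u eu] : exists u, u = expR (s / (1 + e)) by exists (expR (s / (1 + e))).
rewrite -ew in E1 E2 w2 E4 *; rewrite -eu in ts.
have s0 : 0 < s by [].
have {S5 eS5 E5}E5 : L5 <= s * (g / 2).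
  by rewrite -eS5; apply: ler_wpM2r => //; lin g0.
have {S6 eS6 E6}E6 : L6 <= s * (h / 2).
  by rewrite -eS6; apply: ler_wpM2r => //; lin h0.
have epsg : eps * s <= s * (g / 4) by rewrite mulrC; apply: ler_wpM2l => //; exact: ltW.
have epsh : eps * s <= s * (h / 2) by rewrite mulrC; apply: ler_wpM2l => //; exact: ltW.
have es0 := expR_gt0 s; have et0 := expR_gt0 t.
have [delta edelta] : exists d, d = (1 - h) * (w / s) by exists ((1 - h) * (w / s)).
have ws : w / s <= 2^-1 by rewrite ler_pdivrMr.
have ws0 : 0 < w / s by rewrite divr_gt0 //; lin w2.
have d0 : 0 < delta by rewrite edelta mulr_gt0 // subr_gt0.
have d1 : delta <= 2^-1.
  apply: le_trans ws; rewrite edelta ler_piMl //; [exact: ltW|lin h0].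
have k2 : 2^-1 <= 1 - delta by lin d1.
have k1 : 1 - delta < 1 by lin d0.
have [z ez] : exists z, z = expR ((1 + h) * s) by exists (expR ((1 + h) * s)).
have hs0 : 0 <= (1 + h) * s by rewrite mulr_ge0 // ?ltW //; lin h0.
have z1 : 1 <= z by rewrite ez; apply: le_trans (expR_ge1Dx _); rewrite lerDl.
have x1 : 1 <= expR (expR t) by apply: le_trans (expR_ge1Dx _); rewrite lerDl ltW.
apply: le_trans (HC _ _ _ _ x1 (expR_gt0 _) k2 k1 z1) _ => {HC}.
have LLN := @loglog1_expR2 R t (le_trans ler01 t1).
have N0 : (0 < Num.truncn (expR (expR t)))%N by rewrite truncn_gt0.
have Z0 : (0 < Num.truncn z)%N by rewrite truncn_gt0.
have LL1 := loglog1_ge1 R N0; have LZ1 := loglog1_ge1 R Z0.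
have h2 : 0 <= h ^+ 2 <= 1 by rewrite exprn_ge0 ?expr_le1 ?ltW.
have LZ : loglog1 R (Num.truncn z) <= 3 * (w + 1).
  apply: le_trans (loglog1_le z1) _; rewrite ez expRK.
  suff : ln (1 + (1 + h) * s) <= 2 + w by clear - w2; lra.
  apply: (@le_trans _ _ (ln (3 * s))).
    rewrite ler_ln ?posrE ?mulr_gt0 //; last by clear - hs0; lra.
    have : h * s <= 1 * s by apply: ler_wpM2r; exact: ltW.
    by clear - s1'; lra.
  rewrite lnM ?posrE // -ew lerD2r.
  by have := @ln_le_subr1 R 3; lra.
(* The parameters are tuned for this: z^delta = s^(1 - h^2), which even times ln s is o(s), so the
   inner exponential of the branch bound stays below expR (eps * s). *)
have zd : z `^ delta = expR ((1 - h ^+ 2) * w).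
  rewrite ez powR_expR ?expR_gt0 // expRK; congr expR; rewrite edelta.
  by clear - s0; field; rewrite gt_eqF.
have zk : z `^ (1 - delta) = expR ((1 + h) * s - (1 - h ^+ 2) * w).
  by rewrite powRB ?zd ?powRr1 ?ez ?expR_ge0 // ?(gt_eqF (expR_gt0 _)) ?implybT // -expRB.
have [Q eQ] : exists Q, Q = expR s * w / s by exists (expR s * w / s).
have dd : 1 - (1 - delta) = delta by ring.
have xk : expR (expR t) `^ (1 - delta) * expR (expR r) `^ delta =
    expR (expR t) * expR (- ((1 - h) * Q)).
  rewrite !powR_expR ?expR_gt0 // !expRK -!expRD; congr expR.
  have -> : expR r = expR t - expR s by rewrite -est; ring.
  by rewrite eQ edelta; ring.
rewrite dd xk zd zk expRK -eQ.
have Qe : Q <= expR s.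
  by rewrite eQ -mulrA ler_piMr //; [exact: ltW|lin ws].
have Q0 : 0 <= Q by rewrite eQ -mulrA mulr_ge0 // ltW.
have C0 : 0 < C by lin C1.
set LL := loglog1 _ _ in LLN LL1 *; set LZ' := loglog1 _ _ in LZ LZ1 *.
set E := expR ((1 - h ^+ 2) * w) in E1 *.
have E10 : 1 <= E.
  apply: le_trans (expR_ge1Dx _); rewrite lerDl mulr_ge0 //; last by lin w2.
  by rewrite subr_ge0; case/andP: h2.
have [b eb] : exists b, b = C * LL * expR (C * (E * LZ' + 1)) by eexists.
rewrite -eb.
have BB : b <= C * ((2 + t) * expR (eps * s)).
  rewrite eb mulrA; apply: ler_pM; rewrite ?expR_ge0 //.
  - by rewrite mulr_ge0 //; [lin C0|lin LL1].
  - by apply: ler_wpM2l; [exact: ltW|exact: LLN].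
  rewrite ler_expR.
  have h3 : E * LZ' <= E * (3 * (w + 1)) by apply: ler_wpM2l => //; lin E10.
  have h4 : 1 <= E * (w + 1).
    by rewrite -[1]mulr1; apply: ler_pM => //; lin w2.
  apply: (@le_trans _ _ (C * (4 * (E * (w + 1))))).
    by apply: ler_wpM2l; [exact: ltW|clear - h3 h4; lra].
  by move: E1; rewrite mulrAC ler_pdivrMr // [s * eps]mulrC mulrA [4 * C]mulrC.
have u1 : 1 <= u by apply: le_trans ts.
have tu : 2 + t <= 3 * u by lin u1 ts.
have sg : s / (1 + e) = s * (1 - g) by rewrite eg; clear - e0; field; lra.
(* Here the upper limit on y enters: it gives t <= expR ((1 - g) * s), so b is at most about expR
   ((1 - g + eps) * s), which is negligible against Q. *)
have main1 : t + 2 + b <= h * Q.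
  have ee : 1 <= expR (eps * s).
    by apply: le_trans (expR_ge1Dx _); rewrite lerDl mulr_ge0 // ltW.
  apply: (@le_trans _ _ (3 * (C + 2) * (u * expR (eps * s)))).
    have : u <= u * expR (eps * s) by rewrite ler_peMr // (le_trans ler01).
    have : (2 + t) * expR (eps * s) <= 3 * u * expR (eps * s).
      by apply: ler_wpM2r => //; exact: expR_ge0.
    move: BB; move: (expR (eps * s)) ee => v ee BB hp hq.
    have hr := ler_wpM2l (ltW C0) hp.
    have hu : 0 <= C * (u * v) by rewrite !mulr_ge0 //; [lin C0|lin u1|lin ee].
    by clear - BB hr hq tu hu u1; lra.
  apply: (@le_trans _ _ (h * (expR s / expR w))); last first.
    apply: ler_wpM2l; first exact: ltW.
    rewrite eQ -mulrA {1}ew lnK //; apply: ler_wpM2l; first exact: ltW.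
    by rewrite -{1}[s^-1]mul1r; apply: ler_wpM2r; [rewrite invr_ge0 ltW|lin w2].
  have -> : 3 * (C + 2) = h * expR L5 by rewrite eL5 [h * _]mulrC divfK // gt_eqF.
  rewrite -mulrA -expRB eu -!expRD; apply: ler_wpM2l; first exact: ltW.
  by rewrite ler_expR sg; clear - E5 epsg E2; lra.
(* The exceptional sets: z^(1 - delta) exceeds expR s by the factor expR (h * s) up to a power of s,
   which beats Q. This is why z lies above ln (x / y). *)
have main2 : t + 2 + C * LL + Q <= expR ((1 + h) * s - (1 - h ^+ 2) * w) / 2.
  have us : u <= expR s.
    rewrite eu ler_expR ler_pdivrMr; last by lin e0.
    by rewrite ler_peMr ?ltW //; lin e0.
  apply: (@le_trans _ _ ((3 * C + 4) * expR s)).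
    have h3 : C * LL <= C * (3 * expR s).
      by apply: ler_wpM2l; [exact: ltW|clear - LLN tu us; lra].
    by clear - h3 us Qe tu es0; lra.
  rewrite ler_pdivlMr // mulrC mulrA -eL6 -expRD ler_expR.
  have : (1 - h ^+ 2) * w <= w by case/andP: h2 => h20 _; rewrite ler_piMl //; [lin w2|lin h20].
  by clear - E6 E2 epsh; lra.
(* The margin t + 2 pays for the factor 1 + ln x = 1 + expR t and for the halving that lets the two
   terms be added. *)
have half e1 e2 : t + 2 + e1 <= e2 -> (1 + expR t) * expR e1 <= expR e2 / 2.
  move=> hh; apply: (@le_trans _ _ (expR (t + 1) * expR e1)).
    apply: ler_wpM2r; first exact: expR_ge0.
    rewrite addrC expRD; have a1 := expR1_ge2 R; have a2 := expR_ge1Dx t.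
    have a3 : expR t * 2 <= expR t * expR 1 by apply: ler_wpM2l => //; exact: ltW.
    by clear - a3 a2 t1; lra.
  rewrite -expRD ler_pdivlMr //; apply: (@le_trans _ _ (expR (t + 1 + e1) * expR 1)).
    by apply: ler_wpM2l; rewrite ?expR_ge0 //; exact: expR1_ge2.
  by rewrite -expRD ler_expR; clear - hh; lra.
set P := expR (expR t); have P0 : 0 <= P by exact: expR_ge0.
have t1' : (1 + expR t) * expR (- ((1 - h) * Q) + b) <= expR (- ((1 - 2 * h) * Q)) / 2.
  by apply: half; clear - main1; lra.
set X := expR ((1 + h) * s - _) in main2 *.
have t2' : (1 + expR t) * expR (C * LL - X / 2) <= expR (- ((1 - 2 * h) * Q)) / 2.
  apply: half; have : 0 <= h * Q by rewrite mulr_ge0 // ltW.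
  by clear - main2; lra.
rewrite mulrDr.
have -> : (1 + expR t) * (P * expR (- ((1 - h) * Q)) * expR b) =
   P * ((1 + expR t) * expR (- ((1 - h) * Q) + b)) by rewrite expRD; ring.
rewrite [X in _ + X]mulrCA -mulrDr; apply: ler_wpM2l => //.
by move: (expR (- ((1 - 2 * h) * Q))) t1' t2' => q; clear; lra.
Qed.
End UpperAsymptotics.

Section UpperAsymptotics2.
Variable R : realType.

(** There are at most z primes of m above z, each contributing at most z^(- kappa). *)
Lemma prime_power_sum_le_size (kappa z : R) m : 0 < kappa -> kappa <= 1 -> 1 <= z -> (0 < m)%N ->
  (size (primes m))%:R <= z ->
  prime_power_sum kappa m <= z `^ (1 - kappa) * (4098 * loglog1 R (Num.truncn z) + 1).
Proof.
move=> k0 k1 z1 m0 sz; apply: le_trans (prime_power_sum_le k0 k1 z1 m0) _.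
rewrite [leRHS]mulrDr mulr1 lerD2l.
have z0 : 0 < z by apply: lt_le_trans z1.
apply: (@le_trans _ _ (\sum_(p <- primes m) z `^ (- kappa))).
  rewrite big_mkcond /=; apply: ler_sum => p _; case: ifP => [zp|_]; last exact: powR_ge0.
  rewrite !powRN lef_pV2 ?posrE ?powR_gt0 //; last exact: lt_trans zp.
  by apply: ge0_ler_powR; rewrite ?nnegrE ?ler0n ?(ltW k0) ?(ltW z0) ?(ltW zp).
rewrite big_const_seq count_predT iter_addr_0 -mulr_natl.
have -> : z `^ (1 - kappa) = z * z `^ (- kappa).
  by rewrite powRD ?(gt_eqF z0) ?implybT // powRr1 // ltW.
by apply: ler_wpM2r => //; exact: powR_ge0.
Qed.

Lemma size_primes_le (y : R) m : (0 < m)%N -> m%:R <= y ->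
  (size (primes m))%:R <= 2 * ln y.
Proof.
move=> m0 my; have y0 : 0 < y by apply: lt_le_trans my; rewrite ltr0n.
have h : (size (primes m))%:R * ln 2 <= ln y.
  rewrite mulr_natl -lnXn // ler_ln ?posrE ?exprn_gt0 // -natrX.
  by apply: le_trans my; rewrite ler_nat exp2_num_primes.
have n0 : 0 <= (size (primes m))%:R :> R by [].
have := ler_wpM2l n0 (ln2_ge R).
by move: (_%:R) (ln y) (ln 2) h => a b c; clear; lra.
Qed.

(* Here delta = (1 - h) ln t / r; the primes dividing a value of carmichael are compared
   with 2 ln y. *)
Lemma carmichael_count_le2 (e h : R) : 0 < e -> 0 < h -> h < 1 ->
  exists t0, forall t r : R, t0 <= t -> (1 + e) * ln t <= r -> r <= (1 - h) * t ->
    (carmichael_count (expR (expR t)) (expR (expR r)))%:R <=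
      expR (expR t) * expR (- ((1 - 2 * h) * (expR t * ln t / r))).
Proof.
move=> e0 h0 h1.
have [g eg] : exists g, g = e / (1 + e) by exists (e / (1 + e)).
have g0 : 0 < g by rewrite eg divr_gt0 //; lra.
have [C [eC C1]] : exists C, C = geom_const g /\ 1 <= C.
  by exists (geom_const g); split => //; exact: geom_const_ge1.
have C0 : 0 < C by lin C1.
have [K [eK K1]] : exists K : R, K = 4098 /\ 1 <= K by exists 4098; split => //; rewrite ler1n.
have K0 : 0 < K by lin K1.
have eps0 : 0 < 1 - h by rewrite subr_gt0.
have h2 : 0 < h / 2 by rewrite divr_gt0.
have h1' : 1 - h < 1 by rewrite gtrBl.
have [s1 H1] := powR_ln_le_lin (C * (8 * K) / (1 - h)) h1'.
have [s2 H2] := ln_le_lin h2.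
have [s3 H3] := ln_ge_eventually (2 : R).
have [L eL] : exists L, expR L = (1 + C) / h.
  by exists (ln ((1 + C) / h)); rewrite lnK // posrE divr_gt0 //; lin C1.
have [S eS] : exists S, S * (h / 2) = L by exists (L / (h / 2)); rewrite divfK // gt_eqF.
exists (\big[Num.max/0]_(i <- [:: s1; s2; s3; S]) i) => t r.
rewrite !big_cons big_nil !ge_max => /and5P[/H1 E1 /H2[t1 E2] /H3[t0 p2] E3 _] rp rt.
have {S eS E3}E3 : L <= t * (h / 2) by rewrite -eS; apply: ler_wpM2r => //; exact: ltW.
have [p ep] : exists p, p = ln t by exists (ln t).
rewrite -ep in E1 E2 p2 rp *.
have p0 : 0 < p by lin p2.
have r0 : 0 < r by apply: lt_le_trans rp; rewrite mulr_gt0 //; lin e0.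
have rt1 : r <= t by apply: le_trans rt _; rewrite ler_piMl ?(ltW t0) //; lin h0.
have et0 := expR_gt0 t; have er0 := expR_gt0 r.
have [delta ed] : exists d, d = (1 - h) * (p / r) by exists ((1 - h) * (p / r)).
have pr0 : 0 < p / r by rewrite divr_gt0.
(* The lower limit on y enters here: it keeps the Rankin exponent 1 - delta above g, so [geom_const]
   stays bounded. *)
have pr : p / r <= 1 - g.
  have e1 : 0 < 1 + e by lin e0.
  have -> : 1 - g = (1 + e)^-1 by rewrite eg; clear - e1; field; rewrite gt_eqF.
  by rewrite ler_pdivrMr // mulrC ler_pdivlMr // mulrC.
have d0 : 0 < delta by rewrite ed mulr_gt0.
have d1 : delta <= p / r by rewrite ed ler_piMl ?(ltW pr0) //; lin h0.
have kg : g <= 1 - delta by lin pr d1.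
have k0 : 0 < 1 - delta by lin kg g0.
have k1 : 1 - delta <= 1 by lin d0.
pose z := 2 * expR r.
have z1 : 1 <= z by have := expR_ge1Dx r; rewrite /z; clear - r0; lra.
pose V := z `^ delta * (K * loglog1 R (Num.truncn z) + 1).
have dd : 1 - (1 - delta) = delta by ring.
have HV m : (0 < m)%N -> m%:R <= expR (expR r) -> prime_power_sum (1 - delta) m <= V.
  move=> m0 my; have := @prime_power_sum_le_size (1 - delta) z m k0 k1 z1 m0.
  rewrite dd -eK -/V; apply.
  by have := size_primes_le m0 my; rewrite expRK.
have x0 := expR_gt0 (expR t).
apply: le_trans (carmichael_count_small k0 x0 (expR_ge0 _) HV) _.
have cc : geom_const (1 - delta) <= C by rewrite eC; apply: geom_const_le.
have c0 : 0 < geom_const (1 - delta) by apply: lt_le_trans (geom_const_ge1 k0).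
have Z0 : (0 < Num.truncn z)%N by rewrite truncn_gt0.
have LZ1 := loglog1_ge1 R Z0.
have l2 : ln 2 <= 1 :> R by have := @ln_le_subr1 R 2; lra.
have l20 : 0 <= ln 2 :> R by rewrite ln_ge0 // ler1n.
have lz : ln z = ln 2 + r by rewrite /z lnM ?posrE // expRK.
have LZ : loglog1 R (Num.truncn z) <= 3 * (p + 1).
  apply: le_trans (loglog1_le z1) _; rewrite lz.
  suff : ln (1 + (ln 2 + r)) <= 2 + p by clear - p2; lra.
  apply: (@le_trans _ _ (ln (3 * t))).
    rewrite ler_ln ?posrE ?mulr_gt0 //; last by clear - l20 r0; lra.
    by clear - l2 rt1 t1; lra.
  by rewrite lnM ?posrE // -ep lerD2r; have := @ln_le_subr1 R 3; lra.
have V0 : 0 <= V.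
  rewrite /V mulr_ge0 ?powR_ge0 // addr_ge0 // mulr_ge0 ?(ltW K0) //.
  exact: le_trans ler01 LZ1.
set E := expR ((1 - h) * p) in E1.
have zd : z `^ delta <= 2 * E.
  have zp : 0 < z by lin z1.
  rewrite powR_expR // lz mulrDr expRD.
  have -> : delta * r = (1 - h) * p by rewrite ed -mulrA divfK // gt_eqF.
  apply: ler_wpM2r; first exact: expR_ge0.
  rewrite -[leRHS](@lnK R 2) ?posrE // ler_expR ler_piMl //; lin kg g0.
(* Since delta r = (1 - h) ln t, z^delta is at most 2 t^(1 - h), so V is of order t^(1 - h) ln t =
   o(t). *)
have VE : geom_const (1 - delta) * V <= (1 - h) * t.
  apply: (@le_trans _ _ (C * (2 * E * (4 * K * (p + 1))))).
    apply: ler_pM; rewrite ?(ltW c0) //.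
    apply: ler_pM; rewrite ?powR_ge0 ?addr_ge0 ?mulr_ge0 ?(ltW K0) ?(le_trans ler01 LZ1) //.
    have := ler_wpM2l (ltW K0) LZ.
    have : K * 1 <= K * (p + 1) by apply: ler_wpM2l; [exact: ltW|lin p0].
    by move: (loglog1 R _) => b; clear - K1; lra.
  rewrite -ler_pdivrMl // [leLHS](_ : _ = C * (8 * K) / (1 - h) * (E * (p + 1))) //.
  by clear - eps0; field; rewrite gt_eqF.
move: VE; move: (geom_const (1 - delta) * V) => W VE.
have [Q eQ] : exists Q, Q = expR t * p / r by exists (expR t * p / r).
have xk : expR (expR t) `^ (1 - delta) = expR (expR t) * expR (- ((1 - h) * Q)).
  rewrite powR_expR // expRK -expRD; congr expR.
  by rewrite eQ ed; ring.
rewrite -eQ xk mulrCA -mulrA; apply: ler_wpM2l; first exact: ltW.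
rewrite -!expRD ler_expR.
(* The trivial factor y (through r <= (1 - h) t) and the double exponential both have a logarithm of
   order expR ((1 - h) * t), while Q is at least expR t / t. *)
suff : expR r + geom_const (1 - delta) * expR W <= h * Q.
  by move: (geom_const _ * expR _) => a; clear; lra.
apply: (@le_trans _ _ ((1 + C) * expR ((1 - h) * t))).
  rewrite mulrDl mul1r; apply: lerD; first by rewrite ler_expR.
  by apply: ler_pM; rewrite ?expR_ge0 ?(ltW c0) // ler_expR.
have -> : 1 + C = h * expR L by rewrite eL [h * _]mulrC divfK // gt_eqF.
rewrite -mulrA; apply: ler_wpM2l; first exact: ltW.
apply: (@le_trans _ _ (expR t / expR p)).
  by rewrite -expRD -expRB ler_expR; clear - E3 E2; lra.
rewrite eQ -mulrA; apply: ler_wpM2l; first exact: ltW.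
rewrite {1}ep lnK // -{1}[t^-1]mul1r; apply: ler_pM; rewrite ?invr_ge0 ?ler01 ?(ltW t0) //.
  by lin p2.
by rewrite lef_pV2.
Qed.
End UpperAsymptotics2.

(** * Lower bounds under Hypothesis U *)

Section LowerAsymptotics.
Variable R : realType.

Lemma fact_le_expn (z : R) n : n%:R <= z -> n`!%:R <= z ^+ n.
Proof.
elim: n => [|n IH] nz; first by rewrite expr0.
have nz' : n%:R <= z by apply: le_trans nz; rewrite ler_nat.
by rewrite factS natrM exprS; apply: ler_pM => //; exact: IH.
Qed.

Lemma primepi_le (v : R) : 0 <= v -> (primepi v)%:R <= v.
Proof.
move=> v0; apply: le_trans (_ : (Num.truncn v)%:R <= v); last by rewrite truncn_le.
rewrite ler_nat /primepi; apply: (@leq_trans (\sum_(1 <= p < (Num.truncn v).+1) 1)%N).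
  by rewrite [leqLHS]big_mkcond; apply: leq_sum => p _; case: ifP.
by rewrite sum_nat_const_nat subSS subn0 muln1.
Qed.

Lemma expRn_ge n : 2 ^+ n <= expR (n%:R) :> R.
Proof. 
rewrite -[n%:R]mulr1 expRM_natl; apply: lerXn2r; rewrite ?nnegrE ?expR_ge0 //.
exact: expR1_ge2.
Qed.

(** Here v = expR a and z = expR b, j is the largest number of factors with v^j y <= x, and W is the
    loss u log u of Hypothesis U. In the exponent, expR b * b pays for z!, 4 + r for the density of
    the primes q, a for rounding j, and the last term for choosing j smooth primes. *)
Lemma carmichael_count_ge_exp (t r s a b W : R) :
  0 <= s -> 0 <= r -> 1 <= t -> expR s + expR r = expR t -> 2 <= a -> 0 < b -> a <= expR t -> 0 <= W ->
  (primepi (expR a))%:R * expR (- W) <= (primepi_star (expR a) (expR b))%:R ->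
  s + 3 + W <= a -> a + 4 + r + expR b * b <= expR r ->
  expR (- (expR b * b + 4 + r + a + expR s / a * (3 + s + W))) <=
    (expR (expR t))^-1 * (carmichael_count (expR (expR t)) (expR (expR r)))%:R.
Proof.
move=> s0 rr t1 est a2 b0 aet W0 HN c1 c2.
have es0 := expR_gt0 s; have er0 := expR_gt0 r; have et0 := expR_gt0 t.
have a0 : 0 < a by lin a2.
have sa0 : 0 <= expR s / a by rewrite divr_ge0 ?ltW.
pose j := Num.truncn (expR s / a).
have j1 : j%:R <= expR s / a by rewrite truncn_le.
have j2 : expR s / a < j.+1%:R by apply: truncnS_gt.
set N := primepi_star (expR a) (expR b) in HN.
have v4 : 4 <= expR a.
  apply: le_trans (_ : expR 2%:R <= _); last by rewrite ler_expR.
  by apply: le_trans (expRn_ge 2); rewrite -natrX ler_nat.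
have N1 : expR (a - 3 - ln a - W) <= N%:R.
  apply: le_trans HN; rewrite expRD; apply: ler_wpM2r; first exact: expR_ge0.
  apply: le_trans (primepi_ge v4); rewrite expRK.
  rewrite !expRB lnK // -mulrA -invfM; apply: ler_wpM2l; first exact: expR_ge0.
  rewrite lef_pV2 ?posrE ?mulr_gt0 ?expR_gt0 //; apply: ler_wpM2r; first exact: ltW.
  by apply: le_trans (expRn_ge 3); rewrite -natrX ler_nat.
have jN : (j <= N)%N.
  rewrite -(ler_nat R); apply: le_trans j1 (le_trans _ N1).
  have -> : expR s / a = expR (s - ln a) by rewrite expRB lnK.
  by rewrite ler_expR; clear - c1; lra.
(* A lower bound for ln (N / j): the term ln a cancels between [N1] and j <= expR s / a. *)
set w := a - 3 - W - s.
have w0 : 0 <= w by rewrite /w; clear - c1; lra.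
have HC : expR (j%:R * w) <= 'C(N, j)%:R.
  have hb : N%:R ^+ j <= j%:R ^+ j * 'C(N, j)%:R :> R.
    by rewrite -!natrX -natrM ler_nat; exact: bin_pow_ge.
  have jj : 0 < expR (j%:R * (s - ln a)) by exact: expR_gt0.
  rewrite -(ler_pM2l jj) -expRD.
  apply: (@le_trans _ _ (j%:R ^+ j * 'C(N, j)%:R)).
    apply: le_trans hb; rewrite -mulrDr expRM_natl; apply: lerXn2r; rewrite ?nnegrE ?expR_ge0 //.
    apply: le_trans N1; rewrite ler_expR /w; clear; lra.
  apply: ler_wpM2r => //; rewrite expRM_natl; apply: lerXn2r; rewrite ?nnegrE ?expR_ge0 //.
  by rewrite expRB lnK.
have jw : expR s - expR s / a * (3 + s + W) - a <= j%:R * w.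
  have h1 : expR s / a - 1 <= j%:R by move: j2; rewrite -[j.+1]addn1 natrD; clear; lra.
  have h2 := ler_wpM2r w0 h1; apply: le_trans h2.
  have -> : expR s - expR s / a * (3 + s + W) - a = expR s / a * w - a.
    by rewrite /w; clear - a0; field; rewrite gt_eqF.
  by rewrite mulrBl mul1r /w; clear - W0 s0; lra.
pose E : R := (Num.truncn (expR b))`!%:R.
have E1 : 1 <= E by rewrite ler1n fact_gt0.
have E0 : 0 < E by apply: lt_le_trans E1.
have Eb : E <= expR (expR b * b).
  apply: le_trans (fact_le_expn (z := expR b) _) _; first by rewrite truncn_le expR_ge0.
  rewrite -expRM_natl ler_expR; apply: ler_wpM2r; first exact: ltW.
  by rewrite truncn_le expR_ge0.
pose Y := expR (expR r) / E.
have Y0 : 0 < Y by rewrite divr_gt0 ?expR_gt0.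
have Yge : expR (expR r - expR b * b) <= Y.
  by rewrite expRB; apply: ler_wpM2l; rewrite ?expR_ge0 // lef_pV2 ?posrE ?expR_gt0.
have Yle : ln Y <= expR r.
  rewrite -[leRHS]expRK ler_ln ?posrE ?expR_gt0 // /Y ler_pdivrMr //.
  by rewrite ler_peMr // expR_ge0.
have r0 : 0 <= expR b * b by rewrite mulr_ge0 ?expR_ge0 // ltW.
have aY : expR (a + 4 + r) <= Y.
  by apply: le_trans Yge; rewrite ler_expR; clear - c2; lra.
have Y4 : 4 <= Y.
  apply: le_trans v4 (le_trans _ Yge); rewrite ler_expR.
  by clear - c2 rr; lra.
have lY : 0 < ln Y by rewrite ln_gt0 //; clear - Y4; lra.
have e16 : 16 <= expR 4 :> R.
  by apply: le_trans (expRn_ge 4); rewrite -natrX ler_nat.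
have piY : Y / (8 * expR r) <= (primepi Y)%:R.
  apply: le_trans (primepi_ge Y4); apply: ler_wpM2l; first exact: ltW.
  by rewrite lef_pV2 ?posrE ?mulr_gt0 //; apply: ler_wpM2l.
have vY : expR a <= Y / (16 * expR r).
  rewrite ler_pdivlMr ?mulr_gt0 //; apply: le_trans aY; rewrite [expR (a + 4 + r)]expRD [expR (a + 4)]expRD -mulrA.
  apply: ler_wpM2l; first exact: expR_ge0.
  by apply: ler_wpM2r => //; exact: expR_ge0.
have piv := primepi_le (expR_ge0 a).
have pid : expR (expR r - expR b * b - 4 - r) <= (primepi Y)%:R - (primepi (expR a))%:R.
  apply: (@le_trans _ _ (Y / (16 * expR r))); last first.
    have e8 : Y / (8 * expR r) = 2 * (Y / (16 * expR r)) by clear - er0; field; rewrite gt_eqF.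
    by move: piY vY piv; rewrite e8; clear; lra.
  rewrite [expR (_ - r)]expRB [expR (_ - 4)]expRB -mulrA -invfM.
  apply: ler_pM => //; rewrite ?expR_ge0 ?invr_ge0 ?mulr_ge0 ?expR_ge0 //.
  rewrite lef_pV2 ?posrE ?mulr_gt0 ?expR_gt0 //.
  by apply: ler_wpM2r => //; exact: expR_ge0.
have main := @carmichael_count_ge R (expR (expR t)) (expR (expR r)) (expR a) (expR b) j
  (expR_ge0 _) _ _ _ _.
rewrite ler_pdivlMl ?expR_gt0 //; apply: le_trans (main _ _ _ _) => {main}.
- rewrite -/E -/Y -/N.
  apply: (@le_trans _ _ (expR (expR r - expR b * b - 4 - r) * expR (j%:R * w))).
    by rewrite -!expRD ler_expR; move: jw; rewrite -est; clear; lra.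
  by apply: ler_pM; rewrite ?expR_ge0.
- by clear - v4; lra.
- by rewrite ler_expR.
- by apply: le_trans (expR_ge1Dx _); rewrite lerDl ltW.
rewrite -expRM_natl -expRD ler_expR -est lerD2r.
by rewrite -ler_pdivlMr.
Qed.

Lemma hypothesis_U_exp (e' h : R) : 0 < e' -> 0 < h -> hypothesis_U R ->
  exists B : R, forall a b : R, B <= a -> B <= b -> B <= a / b -> 0 < a -> 0 < b ->
    (1 + e') * ln a <= b ->
    (primepi (expR a))%:R * expR (- ((1 + h) * (a / b * ln (a / b)))) <=
      (primepi_star (expR a) (expR b))%:R.
Proof.
move=> e0 h0 /(_ e' e0 h h0)[B HB]; exists B => a b aB bB uB a0 b0 ab.
have [] := HB (expR a) (expR b).
- by apply: le_trans (expR_ge1Dx _); clear - aB; lra.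
- by apply: le_trans (expR_ge1Dx _); clear - bB; lra.
- by rewrite !expRK.
- by rewrite expRK powR_expR // ler_expR.
by move=> + _; rewrite !expRK mulNr.
Qed.

(** Here T / (1 - h) is the u of Hypothesis U, the divisor 1 - h coming from the exponent of z. The
    constant 4 works because (1 + h) / (1 - h) <= 1 + 4 h for h <= 1/4. *)
Lemma entropy_le (h c T : R) : 0 < h -> h <= 4^-1 -> 1 <= T -> T <= c ->
  (1 + h) * (c / (1 - h)) * ln (T / (1 - h)) <= (1 + 4 * h) * c * (ln T + 1).
Proof.
move=> h0 h4 T1 Tc.
have h1 : 0 < 1 - h by clear - h4; lra.
have T0 : 0 < T by clear - T1; lra.
have lT : 0 <= ln T by exact: ln_ge0.
have hi : (1 - h)^-1 <= 2.
  by rewrite -[leRHS]invrK lef_pV2 ?posrE ?invr_gt0 //; clear - h4; lra.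
have l1 : ln (T / (1 - h)) <= ln T + 1.
  rewrite lnM ?posrE ?invr_gt0 // lerD2l.
  apply: (@le_trans _ _ (ln 2)); first by rewrite ler_ln ?posrE ?invr_gt0.
  by have := @ln_le_subr1 R 2; lra.
apply: ler_pM => //.
- rewrite !mulr_ge0 ?invr_ge0 ?(ltW h1) //; [clear - h0; lra|clear - T1 Tc; lra].
- rewrite ln_ge0 // ler_pdivlMr // mul1r; clear - T1 h0; lra.
have -> : (1 + h) * (c / (1 - h)) = (1 + h) / (1 - h) * c by ring.
apply: ler_wpM2r; first by clear - T1 Tc; lra.
rewrite ler_pdivrMr //.
have : 0 <= h * (2 - 4 * h) by rewrite mulr_ge0 ?(ltW h0) //; clear - h4; lra.
by clear - h0; lra.
Qed.

(* ln v = s^2 and z = (ln (x / y))^(1 - h). *)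
Lemma carmichael_count_ge1 (e eta : R) : 0 < e -> 0 < eta -> hypothesis_U R ->
  exists s0, forall t r s : R, s0 <= s -> s <= t -> 0 <= r -> r <= t -> t <= expR (s / (1 + e)) ->
    expR s + expR r = expR t -> 2 * (expR t * ln t / t) <= expR r ->
    expR (- ((1 + eta) * (expR s * ln s / s))) <=
      (expR (expR t))^-1 * (carmichael_count (expR (expR t)) (expR (expR r)))%:R.
Proof.
move=> e0 eta0 HU.
have [g eg] : exists g, g = e / (1 + e) by exists (e / (1 + e)).
have g0 : 0 < g by rewrite eg divr_gt0 //; lra.
have [h [h0 h4 hg heta]] : exists h, [/\ 0 < h, h <= 4^-1, h <= g & h <= eta / 8].
  exists (Num.min 4^-1 (Num.min g (eta / 8))).
  rewrite !lt_min !ge_min !lexx !orbT; split => //.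
  by rewrite invr_gt0 ltr0n g0 divr_gt0.
have h1 : 0 < 1 - h by clear - h4; lra.
have [B HB] := hypothesis_U_exp (@ltr01 R) h0 HU.
have h160 : 0 < 16^-1 :> R by rewrite invr_gt0.
have [s1 H1] := poly_le_expR (7 : R) h0.
have [s2 H2] := ln_le_lin h160.
have [s3 H3] := ln_ge_eventually (2 + 12 / eta).
exists (\big[Num.max/0]_(i <- [:: s1; s2; s3; 2 * `|B|; 10]) i) => t r s.
rewrite !big_cons big_nil !ge_max => /and5P[s1s s2s s3s sB /andP[s10 _]] st r0 rt ts est yL.
have [w ew] : exists w, w = ln s by exists (ln s).
have [_ E1] := H1 _ s1s; have [_ E2] := H2 _ s2s; have [s0 w2] := H3 _ s3s.
have [_ F1] := H1 _ (le_trans s1s st); have [t0 p2] := H3 _ (le_trans s3s st).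
rewrite -ew in E2 w2 *.
have eta12 : 0 < 12 / eta by rewrite divr_gt0.
have w1 : 2 <= w by clear - eta12 w2; lra.
have weta : 12 <= eta * w by rewrite mulrC -ler_pdivrMr //; clear - w2; lra.
have p1 : 1 <= ln t by clear - eta12 p2; lra.
have sB' : `|B| <= s / 2 by clear - sB; lra.
have Bs : B <= s by have := ler_norm B; have := normr_ge0 B; clear - sB'; lra.
have s1' : 1 <= s by clear - s10; lra.
have ss : s <= s ^+ 2 by rewrite expr2 ler_peMr // ltW.
have b0 : 0 < (1 - h) * s by rewrite mulr_gt0.
have s20 : 0 < s ^+ 2 by rewrite exprn_gt0.
have eu : s ^+ 2 / ((1 - h) * s) = s / (1 - h).
  by clear - s0 h1; field; rewrite !gt_eqF.
have su : s <= s / (1 - h).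
  by rewrite ler_pdivlMr // ler_piMr ?(ltW s0) //; clear - h0; lra.
have lns2 : ln (s ^+ 2) = 2 * w by rewrite lnXn // -ew mulr_natl.
(* With ln v = s^2 one has u = s / (1 - h) and u ln u close to s ln s. A larger power of s would
   increase ln u; a much smaller one would make the loss s expR s / ln v, due to dividing N by j,
   comparable to the main term. *)
have := HB (s ^+ 2) ((1 - h) * s).
rewrite eu lns2; set W := (1 + h) * _ => HN.
have EW : W <= (1 + 4 * h) * s * (w + 1).
  by rewrite /W mulrA ew; apply: entropy_le.
have hh : (1 + 4 * h) <= 2 by clear - h4; lra.
have hsw : (1 + 4 * h) * s * (w + 1) <= 2 * (s * (w + 1)).
  by rewrite -mulrA; apply: ler_wpM2r => //; rewrite mulr_ge0 ?(ltW s0) //; clear - w1; lra.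
have sw : s * w <= 16^-1 * s ^+ 2.
  by rewrite expr2 mulrCA; apply: ler_wpM2l => //; exact: ltW.
have s210 : 10 * s <= s ^+ 2 by rewrite expr2; apply: ler_wpM2r => //; exact: ltW.
have es0 := expR_gt0 s; have et0 := expR_gt0 t.
apply: le_trans (carmichael_count_ge_exp (a := s ^+ 2) (b := (1 - h) * s) (W := W)
  (ltW s0) r0 (le_trans s1' st) est _ b0 _ _ _ _ _).
- rewrite ler_expR lerN2.
  have Ees : expR ((1 - h) * s) = expR s * expR (- (h * s)) by rewrite -expRD; congr expR; ring.
  have q1 : 7 * s ^+ 3 * expR ((1 - h) * s) <= expR s.
    have := ler_wpM2r (expR_ge0 ((1 - h) * s)) E1.
    by rewrite -expRD (_ : h * s + (1 - h) * s = s) //; ring.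
  have eb1 : 1 <= expR ((1 - h) * s) by apply: le_trans (expR_ge1Dx _); rewrite lerDl ltW.
  have tb : t <= expR ((1 - h) * s).
    apply: le_trans ts _; rewrite ler_expR.
    have -> : s / (1 + e) = (1 - g) * s by rewrite eg; clear - e0; field; lra.
    by apply: ler_wpM2r; [exact: ltW|clear - hg; lra].
  have q2 : expR ((1 - h) * s) * ((1 - h) * s) + 4 + r + s ^+ 2 <= expR s / s.
    rewrite ler_pdivlMr //; apply: le_trans q1.
    set X := expR _ in eb1 tb *.
    have -> : 7 * s ^+ 3 * X = 7 * s ^+ 2 * X * s by ring.
    apply: ler_wpM2r; first exact: ltW.
    have k1 : X * ((1 - h) * s) <= X * s ^+ 2.
      apply: ler_wpM2l; first exact: expR_ge0.
      by apply: le_trans ss; rewrite ler_piMl ?(ltW s0) //; clear - h0; lra.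
    have k2 : 1 * X <= s ^+ 2 * X by apply: ler_wpM2r; [exact: expR_ge0|exact: le_trans ss].
    have k3 : s ^+ 2 * 1 <= s ^+ 2 * X by apply: ler_wpM2l; [exact: ltW|].
    by clear - k1 k2 k3 eb1 tb rt; lra.
  have ies : 0 <= expR s / s by rewrite divr_ge0 ?ltW.
  have q3 : expR s / s ^+ 2 * (3 + s + W) <= expR s / s * (2 + (1 + 4 * h) * (w + 1)).
    have -> : expR s / s ^+ 2 = expR s / s * s^-1 by clear - s0; field; rewrite gt_eqF.
    rewrite -mulrA; apply: ler_wpM2l => //; rewrite ler_pdivrMl //.
    by clear - EW s10; lra.
  have -> : expR s * w / s = expR s / s * w by ring.
  apply: (@le_trans _ _ (expR s / s * (3 + (1 + 4 * h) * (w + 1)))).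
    by move: q2 q3; move: (expR _ * _ + _ + _ + _) (expR s / s) => x y; clear; lra.
  rewrite [leRHS]mulrCA; apply: ler_wpM2l => //.
  have k1 : 4 * h * w <= 4 * (eta / 8) * w.
    by apply: ler_wpM2r; [clear - w1; lra|clear - heta; lra].
  by clear - k1 weta hh; lra.
- by clear - s210 s10; lra.
- have [_ G1] := H1 _ s1s.
  apply: (@le_trans _ _ (t ^+ 2)); first by apply: lerXn2r; rewrite ?nnegrE ?(ltW s0) ?(ltW t0).
  have k1 : t ^+ 2 <= 7 * t ^+ 3.
    rewrite [t ^+ 3]exprS mulrA ler_peMl ?exprn_ge0 ?(ltW t0) //; clear - s1' st; lra.
  apply: le_trans k1 (le_trans F1 _); rewrite ler_expR ler_piMl ?(ltW t0) //.
  by clear - h4; lra.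
- rewrite /W !mulr_ge0 ?invr_ge0 ?(ltW s0) ?(ltW h1) //; first by clear - h0; lra.
  by rewrite ln_ge0 //; exact: le_trans su.
- apply: HN => //.
  + exact: le_trans ss.
  + have := ler_norm B; have : s / 2 <= (1 - h) * s.
      by have := ler_wpM2r (ltW s0) h4; clear - s0; lra.
    by clear - sB'; lra.
  + exact: le_trans su.
  have := ler_wpM2r (ltW s0) h4; clear - E2 s0; lra.
- by clear - EW hsw sw s210 s10; lra.
(* The case hypothesis on y enters here: v and z! have logarithms of order at most t^2 expR ((1 - h)
   * t), while y >= calL(x)^2 makes ln y at least expR t / t. *)
have F2 : 7 * t ^+ 3 * expR ((1 - h) * t) <= expR t.
  have := ler_wpM2r (expR_ge0 ((1 - h) * t)) F1.
  by rewrite -expRD (_ : h * t + (1 - h) * t = t) //; ring.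
have t1 : 1 <= t by exact: le_trans st.
have eb1 : 1 <= expR ((1 - h) * t).
  by apply: le_trans (expR_ge1Dx _); rewrite lerDl mulr_ge0 // ltW.
apply: (@le_trans _ _ (7 * t ^+ 2 * expR ((1 - h) * t))).
  have k1 : s ^+ 2 <= t ^+ 2 by apply: lerXn2r; rewrite ?nnegrE ?(ltW s0) ?(ltW t0).
  have k2 : expR ((1 - h) * s) * ((1 - h) * s) <= expR ((1 - h) * t) * t.
    apply: ler_pM; rewrite ?expR_ge0 ?(ltW b0) //.
      by rewrite ler_expR; apply: ler_wpM2l; rewrite ?(ltW h1).
    by apply: le_trans st; rewrite ler_piMl ?(ltW s0) //; clear - h0; lra.
  set X := expR ((1 - h) * t) in k2 eb1 *.
  have tt : t <= t ^+ 2 by rewrite expr2 ler_peMr // ltW.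
  have k3 : t ^+ 2 * 1 <= t ^+ 2 * X by apply: ler_wpM2l; [exact/ltW/exprn_gt0|].
  have k4 : X * t <= X * t ^+ 2 by apply: ler_wpM2l; [exact: expR_ge0|].
  have k5 : 1 <= t ^+ 2 by exact: le_trans tt.
  by clear - k1 k2 k3 k4 k5 tt rt eb1; lra.
apply: le_trans yL.
apply: (@le_trans _ _ (expR t / t)).
  rewrite ler_pdivlMr //; apply: le_trans F2; set X := expR ((1 - h) * t).
  by rewrite le_eqVlt; apply/orP; left; apply/eqP; ring.
have -> : 2 * (expR t * ln t / t) = expR t / t * (2 * ln t) by ring.
by rewrite ler_peMr ?divr_ge0 ?ltW //; clear - p1; lra.
Qed.

(* ln v = t r and z = (ln y)^(1 - h). *)
Lemma carmichael_count_ge2 (e eta : R) : 0 < e -> 0 < eta -> hypothesis_U R ->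
  exists t0, forall t r s : R, t0 <= t -> 0 <= s -> s <= t -> r <= t -> (1 + e) * ln t <= r ->
    expR s + expR r = expR t ->
    expR (- ((1 + eta) * (expR t * ln t / r))) <=
      (expR (expR t))^-1 * (carmichael_count (expR (expR t)) (expR (expR r)))%:R.
Proof.
move=> e0 eta0 HU.
have [g eg] : exists g, g = e / (1 + e) by exists (e / (1 + e)).
have g0 : 0 < g by rewrite eg divr_gt0 //; lra.
have ge : g <= e by rewrite eg ler_pdivrMr; have := mulr_gt0 e0 e0; lra.
have [h [h0 h4 hg heta]] : exists h, [/\ 0 < h, h <= 4^-1, h <= g / 8 & h <= eta / 8].
  exists (Num.min 4^-1 (Num.min (g / 8) (eta / 8))).
  rewrite !lt_min !ge_min !lexx !orbT; split => //.
  by rewrite invr_gt0 ltr0n !divr_gt0.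
have h1 : 0 < 1 - h by clear - h4; lra.
have [B HB] := hypothesis_U_exp h0 h0 HU.
have hh2 : 0 < h / 2 by rewrite divr_gt0.
have [s1 H1] := poly_le_expR (7 : R) h0.
have [s2 H2] := ln_le_lin hh2.
have [s3 H3] := ln_ge_eventually (Num.max (Num.max s1 s2) (Num.max (2 * `|B|) (2 + 12 / eta + 8 / e))).
exists (\big[Num.max/0]_(i <- [:: s1; s3; `|B|; 10]) i) => t r s.
rewrite !big_cons big_nil !ge_max => /and5P[s1t s3t sB t10 _] s0 st rt pr est.
have [t0] := H3 _ s3t; have [p ep] : exists p, p = ln t by exists (ln t).
rewrite -ep !ge_max in pr *; case/andP=> /andP[p1 p2] /andP[pB p3].
have [_ F1] := H1 _ s1t.
have eta12 : 0 < 12 / eta by rewrite divr_gt0.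
have e8 : 0 < 8 / e by rewrite divr_gt0.
have pp2 : 2 <= p by clear - eta12 e8 p3; lra.
have peta : 12 <= eta * p by rewrite mulrC -ler_pdivrMr //; clear - p3 e8; lra.
have pe : 8 <= e * p by rewrite mulrC -ler_pdivrMr //; clear - p3 eta12; lra.
have epr : p <= r.
  by have := mulr_gt0 e0 (lt_le_trans (ltr0n R 2) pp2); clear - pr; lra.
have [r1 G1] := H1 _ (le_trans p1 epr); have [_ G2] := H2 _ (le_trans p2 epr).
have r0 : 0 < r by clear - r1; lra.
have t1 : 1 <= t by clear - t10; lra.
have Bt : B <= t by apply: le_trans (ler_norm B) sB.
have Br : `|B| <= r / 2 by clear - pB epr; lra.
have b0 : 0 < (1 - h) * r by rewrite mulr_gt0.
have tr0 : 0 < t * r by rewrite mulr_gt0.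
have ttr : t <= t * r by rewrite ler_peMr // ltW.
have rtr : r <= t * r by rewrite ler_peMl // ltW.
have eu : t * r / ((1 - h) * r) = t / (1 - h) by clear - r0 h1; field; rewrite !gt_eqF.
have tu : t <= t / (1 - h).
  by rewrite ler_pdivlMr // ler_piMr ?(ltW t0) //; clear - h0; lra.
have lnv : ln (t * r) = p + ln r by rewrite lnM ?posrE // -ep.
(* Now u = t / (1 - h), so W / ln v is about (ln t) / r as wanted, and the extra loss s expR s / (t
   r) is at most expR t / r. *)
have := HB (t * r) ((1 - h) * r).
rewrite eu lnv; set W := (1 + h) * (t / _ * _) => HN.
have EW : W <= (1 + 4 * h) * t * (p + 1).
  by rewrite /W mulrA ep; apply: entropy_le.
have hh : (1 + 4 * h) <= 2 by clear - h4; lra.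
have es0 := expR_gt0 s; have et0 := expR_gt0 t; have er0 := expR_gt0 r.
have F2 : 7 * t ^+ 3 * expR ((1 - h) * t) <= expR t.
  have := ler_wpM2r (expR_ge0 ((1 - h) * t)) F1.
  by rewrite -expRD (_ : h * t + (1 - h) * t = t) //; ring.
have ebt : 1 <= expR ((1 - h) * t).
  by apply: le_trans (expR_ge1Dx _); rewrite lerDl mulr_ge0 // ltW.
have pg : p <= (1 - g) * r.
  have e1 : 0 < 1 + e by clear - e0; lra.
  have -> : (1 - g) * r = r / (1 + e) by rewrite eg; clear - e1; field; rewrite gt_eqF.
  by rewrite ler_pdivlMr // mulrC.
have tb : t <= expR ((1 - h) * r).
  rewrite -{1}(lnK t0) -ep ler_expR; apply: le_trans pg _.
  by apply: ler_wpM2r; [exact: ltW|clear - hg g0; lra].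
apply: le_trans (carmichael_count_ge_exp (a := t * r) (b := (1 - h) * r) (W := W)
  s0 (ltW r0) t1 est _ b0 _ _ _ _ _).
- rewrite ler_expR lerN2.
  have q2 : expR ((1 - h) * r) * ((1 - h) * r) + 4 + r + t * r <= expR t / t.
    rewrite ler_pdivlMr //; apply: le_trans F2.
    have k2 : expR ((1 - h) * r) * ((1 - h) * r) <= expR ((1 - h) * t) * t.
      apply: ler_pM; rewrite ?expR_ge0 ?(ltW b0) //.
        by rewrite ler_expR; apply: ler_wpM2l; rewrite ?(ltW h1).
      by apply: le_trans rt; rewrite ler_piMl ?(ltW r0) //; clear - h0; lra.
    set X := expR ((1 - h) * t) in ebt k2 *.
    have -> : 7 * t ^+ 3 * X = 7 * t ^+ 2 * X * t by ring.
    apply: ler_wpM2r; first exact: ltW.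
    have tt : t <= t ^+ 2 by rewrite expr2 ler_peMr // ltW.
    have k1 : t * r <= t ^+ 2 by rewrite expr2; apply: ler_wpM2l => //; exact: ltW.
    have k3 : t ^+ 2 * 1 <= t ^+ 2 * X by apply: ler_wpM2l; [exact/ltW/exprn_gt0|].
    have k4 : X * t <= X * t ^+ 2 by apply: ler_wpM2l; [exact: expR_ge0|].
    have k5 : 1 <= t ^+ 2 by exact: le_trans tt.
    by clear - k1 k2 k3 k4 k5 tt rt; lra.
  have q1 : expR t / t <= expR t / r.
    by apply: ler_wpM2l; [exact: ltW|rewrite lef_pV2].
  have W0 : 0 <= W.
    rewrite /W !mulr_ge0 ?invr_ge0 ?(ltW t0) ?(ltW h1) //; first by clear - h0; lra.
    by rewrite ln_ge0 //; exact: le_trans tu.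
  have q3 : expR s / (t * r) * (3 + s + W) <= expR t / r * (2 + (1 + 4 * h) * (p + 1)).
    have -> : expR s / (t * r) = expR s / r * t^-1 by rewrite invfM mulrA mulrAC.
    rewrite -mulrA; apply: ler_pM.
    - by rewrite divr_ge0 ?ltW.
    - by rewrite mulr_ge0 ?invr_ge0 ?(ltW t0) //; clear - s0 W0; lra.
    - by apply: ler_wpM2r; [rewrite invr_ge0 ltW|rewrite ler_expR].
    by rewrite ler_pdivrMl //; clear - EW t10 st; lra.
  have -> : expR t * p / r = expR t / r * p by ring.
  apply: (@le_trans _ _ (expR t / r * (3 + (1 + 4 * h) * (p + 1)))).
    move: q1 q2 q3; move: (expR _ * _ + _ + _ + _) (expR t / r) (expR t / t) => x y z.
    by clear; lra.
  rewrite [leRHS]mulrCA; apply: ler_wpM2l; first by rewrite divr_ge0 ?ltW.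
  have k1 : 4 * h * p <= 4 * (eta / 8) * p.
    by apply: ler_wpM2r; [clear - pp2; lra|clear - heta; lra].
  by clear - k1 peta hh; lra.
- by clear - ttr t10; lra.
- apply: (@le_trans _ _ (t ^+ 2)); first by rewrite expr2; apply: ler_wpM2l => //; exact: ltW.
  have k1 : t ^+ 2 <= 7 * t ^+ 3.
    rewrite [t ^+ 3]exprS mulrA ler_peMl ?exprn_ge0 ?(ltW t0) //; clear - t1; lra.
  apply: le_trans k1 (le_trans F1 _); rewrite ler_expR ler_piMl ?(ltW t0) //.
  by clear - h4; lra.
- rewrite /W !mulr_ge0 ?invr_ge0 ?(ltW t0) ?(ltW h1) //; first by clear - h0; lra.
  by rewrite ln_ge0 //; exact: le_trans tu.
- apply: HN => //.
  + exact: le_trans ttr.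
  + have := ler_norm B; have : r / 2 <= (1 - h) * r.
      by have := ler_wpM2r (ltW r0) h4; clear - r0; lra.
    by clear - Br; lra.
  + exact: le_trans tu.
  (* The requirement z >= (ln v)^(1 + h) of Hypothesis U: p <= (1 - g) r and h <= g / 8 give (1 + h)
     (1 - g + h / 2) <= 1 - h, so the smallest admissible y are covered. *)
  have k1 : p + ln r <= (1 - g + h / 2) * r by rewrite mulrDl; apply: lerD.
  have h10 : 0 <= 1 + h by clear - h0; lra.
  apply: le_trans (ler_wpM2l h10 k1) _; rewrite mulrA; apply: ler_wpM2r; first exact: ltW.
  have : 0 <= h * g by rewrite mulr_ge0 ?ltW.
  have : h * h <= h * 4^-1 by apply: ler_wpM2l => //; exact: ltW.
  by clear - hg h0; lra.
(* The smooth primes up to v must outnumber j, so W, close to t ln t, must stay below ln v = t r;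
   the margin e in r >= (1 + e) ln t provides this. *)
- have k1 : t * ((1 + e) * p) <= t * r by apply: ler_wpM2l => //; exact: ltW.
  have k2 : h * p <= e / 8 * p.
    by apply: ler_wpM2r; [clear - pp2; lra|clear - hg ge; lra].
  have k3 : t * (4 + (1 + 4 * h) * p) <= t * ((1 + e) * p).
    by apply: ler_wpM2l; [exact: ltW|clear - k2 pe; lra].
  have k4 : t * (1 + 4 * h) <= t * 2 by apply: ler_wpM2l => //; exact: ltW.
  by clear - EW k1 k3 k4 st t10; lra.
have F3 : 7 * r ^+ 3 * expR ((1 - h) * r) <= expR r.
  have := ler_wpM2r (expR_ge0 ((1 - h) * r)) G1.
  by rewrite -expRD (_ : h * r + (1 - h) * r = r) //; ring.
apply: le_trans F3; set X := expR ((1 - h) * r) in tb *.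
have X1 : 1 <= X by exact: le_trans tb.
have rr : r <= r ^+ 2 by rewrite expr2 ler_peMr // ltW.
have r3 : r <= r ^+ 3 by rewrite [r ^+ 3]exprS ler_peMr ?(ltW r0) //; exact: le_trans rr.
have X0 : 0 <= X by clear - X1; lra.
have k1 : t * r <= X * r by apply: ler_wpM2r => //; exact: ltW.
have k2 : X * ((1 - h) * r) <= X * r.
  by apply: ler_wpM2l => //; rewrite ler_piMl ?(ltW r0) //; clear - h0; lra.
have k3 : X * r <= X * r ^+ 3 by apply: ler_wpM2l.
have k4 : 1 * r <= X * r by apply: ler_wpM2r => //; exact: ltW.
have k5 : X * 1 <= X * r by apply: ler_wpM2l.
by clear - k1 k2 k3 k4 k5 X1; lra.
Qed.
End LowerAsymptotics.

(** * Joining the ranges of y *)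

Section Assembly.
Variable R : realType.

Lemma admissible_expR (e t0 x y : R) : 0 < e -> 1 <= t0 -> expR (expR t0) <= x ->
  admissible e x y ->
  exists t r s, [/\ x = expR (expR t), y = expR (expR r), x / y = expR (expR s),
    expR s + expR r = expR t & [/\ t0 <= t, (1 + e) * ln t <= r & (1 + e) * ln t <= s]].
Proof.
move=> e0 t01 xt0 [x100 y100 ey yx].
have x0 : 0 < x by apply: lt_le_trans x100; rewrite ltr0n.
have y0 : 0 < y by apply: lt_le_trans y100; rewrite ltr0n.
have lx : expR t0 <= ln x by rewrite -(expRK (expR t0)) ler_ln ?posrE ?expR_gt0.
have lx0 : 0 < ln x by apply: lt_le_trans lx; exact: expR_gt0.
have llx : t0 <= ln (ln x) by rewrite -(expRK t0) ler_ln ?posrE ?expR_gt0.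
have ll0 : 0 < ln (ln x) by apply: lt_le_trans llx; apply: lt_le_trans t01.
rewrite /logk /= powR_expR // in ey yx.
set T := expR ((1 + e) * _) in ey yx.
have T0 : 0 < T by exact: expR_gt0.
have Ty : T <= ln y by rewrite -(expRK T) ler_ln ?posrE ?expR_gt0.
have ly0 : 0 < ln y by apply: lt_le_trans Ty.
have xyT : expR T <= x / y.
  by rewrite ler_pdivlMr // mulrC -ler_pdivlMr ?expR_gt0.
have xy0 : 0 < x / y by rewrite divr_gt0.
have Txy : T <= ln (x / y) by rewrite -(expRK T) ler_ln ?posrE ?expR_gt0.
have lxy0 : 0 < ln (x / y) by apply: lt_le_trans Txy.
exists (ln (ln x)), (ln (ln y)), (ln (ln (x / y))); split; rewrite ?lnK //.
  by rewrite ln_div ?posrE // subrK.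
by split => //; rewrite -ler_expR lnK.
Qed.

Lemma main_term_expR (t r s : R) : expR s + expR r = expR t ->
  main_term (expR (expR t)) (expR (expR r)) =
    expR (if 2 * (expR t * ln t / t) <= expR r then expR s * ln s / s else expR t * ln t / r).
Proof.
move=> est; rewrite /main_term /calL /logk /= -expRB -est addrK !expRK est !expRK.
by rewrite -expRM_natl ler_expR; case: ifP.
Qed.

Lemma ln_div_decr (s t : R) : 1 <= ln s -> s <= t -> 0 < s -> ln t / t <= ln s / s.
Proof.
move=> s1 st s0; have t0 : 0 < t by apply: lt_le_trans st.
rewrite ler_pdivrMr // mulrAC ler_pdivlMr //.
have h : ln t <= ln s + (t / s - 1).
  have -> : ln t = ln s + ln (t / s) by rewrite ln_div ?posrE // addrC subrK.
  by rewrite lerD2l; apply: ln_le_subr1; rewrite divr_gt0.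
have ts : 0 <= t / s - 1 by rewrite subr_ge0 ler_pdivlMr // mul1r.
have h2 : t / s - 1 <= ln s * (t / s - 1) by rewrite ler_peMl.
have h3 : ln t <= ln s * (t / s) by clear - h h2; lra.
apply: le_trans (ler_wpM2r (ltW s0) h3) _.
by rewrite -mulrA divfK // gt_eqF.
Qed.

(** The first bound holds for all admissible y, the second only for r <= (1 - h) t. In the gap,
    where y < calL(x)^2 but r > (1 - h) t, ln (x / y) is at least (1 - h) ln x and r is close to t,
    so the two main terms agree up to the factor (1 - h)^2 in the exponent and the first bound
    suffices. *)
Lemma carmichael_count_upper (e eta : R) : 0 < e -> 0 < eta ->
  exists t0, forall t r s : R, t0 <= t -> expR s + expR r = expR t ->
    (1 + e) * ln t <= r -> (1 + e) * ln t <= s ->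
    (carmichael_count (expR (expR t)) (expR (expR r)))%:R <= expR (expR t) *
      expR (- ((1 - eta) * (if 2 * (expR t * ln t / t) <= expR r
                              then expR s * ln s / s else expR t * ln t / r))).
Proof.
move=> e0 eta0.
have [h [h0 h4 heta]] : exists h, [/\ 0 < h, h <= 4^-1 & 4 * h <= eta].
  exists (Num.min 4^-1 (eta / 4)); split.
  - by rewrite lt_min invr_gt0 ltr0n divr_gt0.
  - by rewrite ge_min lexx.
  - by rewrite mulrC -ler_pdivlMr // ge_min lexx orbT.
have h1 : h < 1 by clear - h4; lra.
have [s1 H1] := carmichael_count_le1 e0 h0 h1.
have [s2 H2] := carmichael_count_le2 e0 h0 h1.
have [s3 H3] := ln_ge_eventually (1 : R).
have [s4 H4] := ln_ge_eventually (Num.max 1 (Num.max s1 s3)).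
have h20 : 0 < h / 2 by rewrite divr_gt0.
have [s5 H5] := ln_le_lin h20.
exists (Num.max s2 (Num.max s4 s5)) => t r s.
rewrite !ge_max => /and3P[s2t /H4[t0 +] /H5[t1 pt]] est pr ps.
rewrite !ge_max => /and3P[p1 p2 p3].
set p := ln t in pt pr ps p1 p2 p3 *.
have p0 : 0 < p by exact: lt_le_trans p1.
have epp : p <= (1 + e) * p by rewrite ler_peMl ?(ltW p0) // lerDl ltW.
have rp : p <= r by exact: le_trans pr.
have sp : p <= s by exact: le_trans ps.
have [s0 w1] := H3 _ (le_trans p3 sp).
have r0 : 0 < r by exact: lt_le_trans rp.
have ts : t <= expR (s / (1 + e)).
  rewrite -{1}(lnK t0) ler_expR ler_pdivlMr; last by clear - e0; lra.
  by rewrite mulrC.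
have es0 := expR_gt0 s; have er0 := expR_gt0 r; have et0 := expR_gt0 t.
have U1 := H1 t r s (le_trans p2 sp) t1 ts est.
have weak (a b : R) (c : R) : 0 <= a -> a <= b -> 1 - eta <= c -> 0 <= c ->
    expR (expR t) * expR (- (c * b)) <= expR (expR t) * expR (- ((1 - eta) * a)).
  move=> a0 ab ec c0; apply: ler_wpM2l; first exact: expR_ge0.
  rewrite ler_expR lerN2; apply: (@le_trans _ _ (c * a)); first exact: ler_wpM2r.
  exact: ler_wpM2l.
have c2 : 1 - eta <= 1 - 2 * h by clear - heta h0; lra.
have c20 : 0 <= 1 - 2 * h by clear - h4; lra.
case: ifP => [_|/negbT].
  apply: le_trans U1 _; apply: weak => //.
  by rewrite !mulr_ge0 ?invr_ge0 ?(ltW s0) ?(ltW es0) // (le_trans ler01).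
rewrite -ltNge => yL.
have Q0 : 0 <= expR t * p / r by rewrite !mulr_ge0 ?invr_ge0 ?ltW.
have [rt|rt] := leP r ((1 - h) * t).
  by apply: le_trans (H2 t r s2t pr rt) _; apply: weak.
have st : s <= t by rewrite -ler_expR -est lerDl ltW.
have es : (1 - h) * expR t <= expR s.
  have : expR t * p / t <= expR t * (h / 2).
    rewrite -mulrA; apply: ler_wpM2l; first exact: ltW.
    by rewrite ler_pdivrMr.
  by move: yL; rewrite -/p; clear - est; lra.
have ws := ln_div_decr w1 st s0.
have ptr : (1 - h) * (p / r) <= p / t.
  rewrite mulrCA; apply: ler_wpM2l; first exact: ltW.
  by rewrite ler_pdivrMr // ler_pdivlMl // mulrC ltW.
have pr0 : 0 <= p / r by rewrite divr_ge0 ?ltW.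
have h10 : 0 <= 1 - h by clear - h1; lra.
apply: le_trans U1 _.
have Qs : (1 - h) * (1 - h) * (expR t * p / r) <= expR s * ln s / s.
  have -> : (1 - h) * (1 - h) * (expR t * p / r) = ((1 - h) * expR t) * ((1 - h) * (p / r)) by ring.
  rewrite -[leRHS]mulrA; apply: ler_pM => //; rewrite ?mulr_ge0 ?(ltW et0) ?invr_ge0 ?(ltW p0) ?(ltW r0) //.
  exact: le_trans ptr ws.
apply: ler_wpM2l; first exact: expR_ge0.
(* What remains is (1 - 2 h) (1 - h)^2 >= 1 - 4 h >= 1 - eta. *)
rewrite ler_expR lerN2; apply: le_trans (ler_wpM2l c20 Qs); rewrite [leRHS]mulrA.
apply: ler_wpM2r => //.
have : 0 <= h * h by rewrite mulr_ge0 ?ltW.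
have : h * (h * h) <= 4^-1 * (h * h) by apply: ler_wpM2r => //; rewrite mulr_ge0 ?ltW.
by clear - heta h0; lra.
Qed.

Lemma carmichael_count_lower (e eta : R) : 0 < e -> 0 < eta -> hypothesis_U R ->
  exists t0, forall t r s : R, t0 <= t -> expR s + expR r = expR t ->
    (1 + e) * ln t <= r -> (1 + e) * ln t <= s ->
    expR (- ((1 + eta) * (if 2 * (expR t * ln t / t) <= expR r
                              then expR s * ln s / s else expR t * ln t / r))) <=
    (expR (expR t))^-1 * (carmichael_count (expR (expR t)) (expR (expR r)))%:R.
Proof.
move=> e0 eta0 HU.
have [s1 H1] := carmichael_count_ge1 e0 eta0 HU.
have [s2 H2] := carmichael_count_ge2 e0 eta0 HU.
have [s4 H4] := ln_ge_eventually (Num.max 1 s1).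
exists (Num.max s2 s4) => t r s.
rewrite !ge_max => /andP[s2t /H4[t0 +]] est pr ps.
rewrite ge_max => /andP[p1 p2].
set p := ln t in pr ps p1 p2 *.
have p0 : 0 < p by exact: lt_le_trans p1.
have epp : p <= (1 + e) * p by rewrite ler_peMl ?(ltW p0) // lerDl ltW.
have rp : p <= r by exact: le_trans pr.
have sp : p <= s by exact: le_trans ps.
have r0 : 0 <= r by apply: le_trans rp; exact: ltW.
have s0 : 0 <= s by apply: le_trans sp; exact: ltW.
have st : s <= t by rewrite -ler_expR -est lerDl expR_ge0.
have rt : r <= t by rewrite -ler_expR -est lerDr expR_ge0.
have ts : t <= expR (s / (1 + e)).
  rewrite -{1}(lnK t0) ler_expR ler_pdivlMr; last by clear - e0; lra.
  by rewrite mulrC.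
case: ifP => yL; last by apply: (H2 t r s).
by apply: H1 => //; exact: le_trans sp.
Qed.
End Assembly.

Unset Implicit Arguments.

Theorem theorem1p1 (R : realType) (e : R) (he : 0 < e) :
  (forall eta : R, 0 < eta -> exists x0 : R, forall x y : R,
     x0 <= x -> admissible e x y ->
     x^-1 * (carmichael_count x y)%:R <= main_term x y `^ (-1 + eta))
  /\
  (hypothesis_U R ->
   forall eta : R, 0 < eta -> exists x0 : R, forall x y : R,
     x0 <= x -> admissible e x y ->
     main_term x y `^ (-1 - eta) <= x^-1 * (carmichael_count x y)%:R
     /\ x^-1 * (carmichael_count x y)%:R <= main_term x y `^ (-1 + eta)).
Proof.
have upper (eta : R) : 0 < eta -> exists x0 : R, forall x y : R,
     x0 <= x -> admissible e x y ->
     x^-1 * (carmichael_count x y)%:R <= main_term x y `^ (-1 + eta).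
  move=> eta0; have [t0 H] := carmichael_count_upper he eta0.
  exists (expR (expR (Num.max 1 t0))) => x y xx0 adm.
  have m1 : 1 <= Num.max 1 t0 by rewrite le_max lexx.
  have [t [r [s [-> -> _ est [tt pr ps]]]]] := admissible_expR he m1 xx0 adm.
  rewrite (main_term_expR est) -expRM ler_pdivrMl ?expR_gt0 //.
  have {}tt : t0 <= t by apply: le_trans tt; rewrite le_max lexx orbT.
  apply: le_trans (H t r s tt est pr ps) _; rewrite le_eqVlt; apply/orP; left; apply/eqP.
  by congr (_ * expR _); ring.
split=> // HU eta eta0; have [x1 H1] := upper eta eta0.
have [t0 H] := carmichael_count_lower he eta0 HU.
exists (Num.max x1 (expR (expR (Num.max 1 t0)))) => x y.
rewrite ge_max => /andP[/H1 U xx0] adm; split; last exact: U.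
have m1 : 1 <= Num.max 1 t0 by rewrite le_max lexx.
have [t [r [s [-> -> _ est [tt pr ps]]]]] := admissible_expR he m1 xx0 adm.
rewrite (main_term_expR est) -expRM.
have {}tt : t0 <= t by apply: le_trans tt; rewrite le_max lexx orbT.
apply: le_trans (H t r s tt est pr ps); rewrite le_eqVlt; apply/orP; left; apply/eqP.
by congr (expR _); ring.
Qed.
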